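(* Let $\gamma\in\{0,\infty\}$. Let $\mu,\lambda\in L^\infty(\mathcal Y)$ be non-negative with $\operatorname{ess\,inf}_{y}(2\mu+\lambda)>0$, and suppose that the quadratic form is $Q(x,y,G)=Q(y,G)=2\mu(y)|\mathrm{sym}\,G|^2+\lambda(y)(\mathrm{trace}\,G)^2$ (with $Q(y,\cdot)$ uniformly elliptic on symmetric matrices as specified in the context). Let $B\in L^2(\omega\times S\times\mathcal Y;\mathbb R^{3\times3})$. With the notation of the context: (i) The strain correctors $\chi^{(i)}$, $i=1,\dots,4$, satisfy $$E^{(1)}+\chi^{(1)}=\begin{cases}\frac{\langle\beta\rangle_{\rm hom}}{\beta}\,\mathrm{diag}(1,-\nu,-\nu)&\gamma=0,\\ \mathrm{diag}\big(\frac{\beta_\infty}{M}+2\nu_\infty\frac\lambda M,-\nu_\infty,-\nu_\infty\big)&\gamma=\infty,\end{cases}$$ $$E^{(i)}+\chi^{(i)}=-x_i\big(E^{(1)}+\chi^{(1)}\big)\quad(i=2,3),$$ $$E^{(4)}+\chi^{(4)}=\frac{\langle\mu\rangle_{\rm hom}}{\mu}\begin{pmatrix}0&\frac12(\partial_2\varphi_S-x_3)&\frac12(\partial_3\varphi_S+x_2)\\ \frac12(\partial_2\varphi_S-x_3)&0&0\\ \frac12(\partial_3\varphi_S+x_2)&0&0\end{pmatrix}.$$ (ii) The averaging matrix satisfies $$\mathbb M=\mathrm{diag}\Big(\beta_\gamma\int_Sd\bar x,\ \beta_\gamma\int_Sx_2^2\,d\bar x,\ \beta_\gamma\int_Sx_3^2\,d\bar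 x,\ \langle\mu\rangle_{\rm hom}\tau_S\Big).$$ (iii) The vector $b$ satisfies (for a.e. $x_1\in\omega$) $$\begin{pmatrix} b_1 \\ b_2 \\ b_3 \end{pmatrix}=\beta_\gamma\iint_{S\times Y}B_{11}(e_1-\bar{\boldsymbol x})-\begin{cases}0&\gamma=0,\\ \iint_{S\times Y}g_\infty(B_{22}+B_{33})(e_1-\bar{\boldsymbol x})&\gamma=\infty,\end{cases}$$ $$b_4=\langle\mu\rangle_{\rm hom}\int_S(\partial_2\varphi_S-x_3)\langle B_{12}+B_{21}\rangle+(\partial_3\varphi_S+x_2)\langle B_{13}+B_{31}\rangle\,d\bar x,$$ where $g_\infty:=2(\mu+\lambda)\nu_\infty-(\beta_\infty+2\nu_\infty\lambda)\frac\lambda M$. (iv) The vector $k:=\mathbb M^{-1}b$ is given by $k_i=\mathbb M_{ii}^{-1}b_i$, $i=1,\dots,4$, and $$Q_{\rm hom}(K,a)=|S|\beta_\gamma a^2+\sum_{i=2}^3\beta_\gamma\Big(\int_Sx_i^2\,d\bar x\Big)\kappa_i^2+\langle\mu\rangle_{\rm hom}\tau_S\,\tau^2$$ for every $a\in\mathbb R$ and every $K=\begin{pmatrix}0&\kappa_2&\kappa_3\\ -\kappa_2&0&\tau\\ -\kappa_3&-\tau&0\end{pmatrix}$ with $\kappa_2,\kappa_3,\tau\in\mathbb R$.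
   Context: Notation. $e_1,e_2,e_3$ is the standard basis of $\mathbb R^3$; $\bar x=(x_2,x_3)\in S$; $\bar{\boldsymbol x}:=x_2e_2+x_3e_3\in\mathbb R^3$; $(a\otimes b)c=(b\cdot c)a$; $\mathrm{Sym}(3)$, $\mathrm{Skew}(3)$: symmetric, skew-symmetric $3\times3$ matrices; $Y=[0,1)$, $\mathcal Y=\mathbb R/\mathbb Z$; $\bar\nabla=(\partial_2,\partial_3)$; $(v\,|\,N)$ is the $3\times3$ matrix with first column $v$ and last two columns $N\in\mathbb R^{3\times2}$. $S\subset\mathbb R^2$ is a bounded connected open Lipschitz set with $\int_Sx_2=\int_Sx_3=\int_Sx_2x_3=0$; $\omega=(0,\ell)$. Standing ellipticity: there are $0<c_1\le c_2$ with $c_1|\mathrm{sym}\,G|^2\le Q(y,G)\le c_2|\mathrm{sym}\,G|^2$ for a.e. $y$ and all $G\in\mathbb R^{3\times3}$. The tensor $\mathbb L$ is given by $\langle\mathbb LF,G\rangle=\frac12(Q(F+G)-Q(F)-Q(G))$, and $(F,G):=\iint_{S\times Y}\langle\mathbb L(y)F,G\rangle\,dy\,d\bar x$ for $F,G\in L^2(S\times\mathcal Y;\mathbb R^{3\times3})$. Moduli. $\nu=\frac{\lambda}{2(\mu+\lambda)}$, $\beta=2\mu+\lambda-2\lambda\nu=\frac{\mu(2\mu+3\lambda)}{\mu+\lambda}$, $M=2\mu+\lambda$ (functions of $y$). For a function $f$ of $y$: $\langle f\rangle=\int_Yf\,dy$ and $\langle f\rangle_{\rm hom}=(\int_Y\frac1f\,dy)^{-1}$.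 Furthermore $$\nu_\infty=\frac12\,\frac{\langle M\rangle_{\rm hom}\langle\frac\lambda M\rangle}{\langle\frac\lambda M\rangle^2\langle M\rangle_{\rm hom}-\langle\frac{\lambda^2}M\rangle+\langle\lambda+\mu\rangle},\qquad \beta_0=\langle\beta\rangle_{\rm hom},\qquad \beta_\infty=\langle M\rangle_{\rm hom}\big(1-2\nu_\infty\langle\tfrac\lambda M\rangle\big).$$ Torsion. $\varphi_S\in H^1(S)$ is the unique minimizer with $\int_S\varphi_S=0$ of $\varphi\mapsto\int_S\big((\partial_2\varphi-x_3)^2+(\partial_3\varphi+x_2)^2\big)$ over $H^1(S)$, and $\tau_S$ is the minimum value. Strains. $\mathbf E(K,a)=\mathrm{sym}[(K\bar{\boldsymbol x}+ae_1)\otimes e_1]$ for $(K,a)\in\mathrm{Skew}(3)\times\mathbb R$. $K^{(2)}=e_2\otimes e_1-e_1\otimes e_2$, $K^{(3)}=e_3\otimes e_1-e_1\otimes e_3$, $K^{(4)}=e_3\otimes e_2-e_2\otimes e_3$. $E^{(1)}=\mathbf E(0,1)$, $E^{(i)}=\mathbf E(K^{(i)},0)$ for $i=2,3,4$. $\boldsymbol H^\gamma_{\rm rel}\subset L^2(S\times\mathcal Y;\mathrm{Sym}(3))$ is: for $\gamma=0$, all $\mathrm{sym}[((\partial_y\Psi)\bar{\boldsymbol x}+\partial_y\hat\phi\,|\,\bar\nabla\bar\phi)]$ with $\Psi\in H^1(\mathcal Y;\mathrm{Skew}(3))$, $\hat\phi\in H^1(\mathcal Y;\mathbb R^3)$,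 $\bar\phi\in L^2(\mathcal Y;H^1(S;\mathbb R^3))$; for $\gamma=\infty$, all $\mathrm{sym}[(\partial_y\hat\phi\,|\,\bar\nabla\bar\phi)]$ with $\hat\phi\in L^2(S;H^1(\mathcal Y;\mathbb R^3))$, $\bar\phi\in H^1(S;\mathbb R^3)$. Correctors and effective quantities. $\chi^{(i)}\in\boldsymbol H^\gamma_{\rm rel}$ is the unique solution of $(E^{(i)}+\chi^{(i)},\chi)=0$ for all $\chi\in\boldsymbol H^\gamma_{\rm rel}$. $\mathbb M_{ij}=(E^{(i)}+\chi^{(i)},E^{(j)}+\chi^{(j)})$, $i,j=1,\dots,4$. $b_i=b_i(x_1)=(B(x_1,\cdot),E^{(i)}+\chi^{(i)})$. $Q_{\rm hom}(K,a)=\inf_{\chi\in\boldsymbol H^\gamma_{\rm rel}}\iint_{S\times Y}Q(y,\mathbf E(K,a)+\chi(\bar x,y))\,dy\,d\bar x$. *)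

(* Defs.v *)
From HB Require Import structures.
From mathcomp Require Import all_boot all_order all_algebra.
From mathcomp Require Import all_classical all_reals all_analysis.
From mathcomp Require Import ess_sup_inf.

Set Implicit Arguments.
Unset Strict Implicit.
Unset Printing Implicit Defensive.

Import Order.TTheory GRing.Theory Num.Theory.
Import numFieldNormedType.Exports.

Local Open Scope classical_set_scope.
Local Open Scope ring_scope.

(* Encodings used throughout.
   - A point xbar = (x_2, x_3) of S is a pair x : R * R with x_2 = x.1 and
     x_3 = x.2; a point of S x Y is a pair (xbar, y).
   - Matrix rows and columns are numbered from 0, so G_{12} is G 0 1.
   - The torus R/Z is represented by Y = [0, 1[; functions of y are only used
     on Y.
   - Elements of Lebesgue spaces are functions, identified almost everywhere. *)

Inductive regime := GammaZero | GammaInfty.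

Section Measures.
Context {R : realType}.

Lemma sigma_finite_prod d1 d2 (T1 : measurableType d1) (T2 : measurableType d2)
    (m1 : {sigma_finite_measure set T1 -> \bar R})
    (m2 : {sigma_finite_measure set T2 -> \bar R}) :
  sigma_finite setT (m1 \x m2)%E.
Proof.
exact: (isSigmaFinite.sigma_finiteT
  (lebesgue_integral_fubini.measure_function_Measure_isSigmaFinite__to__measure_function_isSigmaFinite
     m1 m2)).
Qed.

Definition Y : set R := [set` `[0, 1[%R].

(* leb2, leb3 and leb4 are named constants because canonical inference does not
   find the sigma-finite structure on an iterated m1 \x m2. *)
Local Notation RL := (measurableTypeR R).

Definition leb1 : set RL -> \bar R := @lebesgue_measure R.
HB.instance Definition _ := SigmaFiniteMeasure.on leb1.

Definition leb2 : set (RL * RL)%type -> \bar R := (leb1 \x leb1)%E.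
HB.instance Definition _ := Measure.on leb2.
HB.instance Definition _ :=
  Measure_isSigmaFinite.Build _ _ _ leb2 (sigma_finite_prod leb1 leb1).

Definition leb3 : set (RL * RL * RL)%type -> \bar R := (leb2 \x leb1)%E.
HB.instance Definition _ := Measure.on leb3.
HB.instance Definition _ :=
  Measure_isSigmaFinite.Build _ _ _ leb3 (sigma_finite_prod leb2 leb1).

Definition leb4 : set (RL * (RL * RL * RL))%type -> \bar R :=
  (leb1 \x leb3)%E.
HB.instance Definition _ := Measure.on leb4.
HB.instance Definition _ :=
  Measure_isSigmaFinite.Build _ _ _ leb4 (sigma_finite_prod leb1 leb3).

Definition lebY : {measure set RL -> \bar R} :=
  mrestr leb1 (measurable_itv `[0%R, 1%R[).

End Measures.

Section Spaces.
Context (R : realType).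

Definition L2 d (T : measurableType d) (m : {measure set T -> \bar R})
    (D : set T) (f : T -> R) : Prop :=
  measurable_fun D f /\ (\int[m]_(x in D) (f x ^+ 2)%:E < +oo)%E.

Definition L2mx d (T : measurableType d) (m : {measure set T -> \bar R})
    (D : set T) p q (F : T -> 'M[R]_(p, q)) : Prop :=
  forall i j, L2 m D (fun x => F x i j).

Definition LinftyY (f : R -> R) : Prop :=
  measurable_fun Y f /\ (ess_sup lebY (fun y => `|f y|%:E) < +oo)%E.

Definition pd2 (f : R * R -> R) (x : R * R) : R :=
  derive1 (fun t : R => f (t, x.2)) x.1.
Definition pd3 (f : R * R -> R) (x : R * R) : R :=
  derive1 (fun t : R => f (x.1, t)) x.2.

Fixpoint Ck (k : nat) (f : R * R -> R) : Prop :=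
  if k is k'.+1 then
    [/\ continuous f,
        forall x, derivable (fun t : R => f (t, x.2)) x.1 1,
        forall x, derivable (fun t : R => f (x.1, t)) x.2 1,
        Ck k' (pd2 f) & Ck k' (pd3 f)]
  else continuous f.

Definition test_fun (S : set (R * R)%type) (psi : R * R -> R) : Prop :=
  [/\ forall k, Ck k psi,
      compact (closure [set x | psi x != 0])
    & closure [set x | psi x != 0] `<=` S].

(* v belongs to H^1(S) and its weak gradient is (v2, v3). *)
Definition H1S (S : set (R * R)%type) (v v2 v3 : R * R -> R) : Prop :=
  [/\ L2 leb2 S v, L2 leb2 S v2, L2 leb2 S v3
    & forall psi, test_fun S psi ->
        \int[leb2]_(x in S) (v x * pd2 psi x)
          = - (\int[leb2]_(x in S) (v2 x * psi x)) /\
        \int[leb2]_(x in S) (v x * pd3 psi x)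
          = - (\int[leb2]_(x in S) (v3 x * psi x))].

Definition test_per (psi : R -> R) : Prop :=
  periodic psi 1 /\ forall n x, derivable (derive1n n psi) x 1.

(* f belongs to H^1(R/Z) and its weak derivative is df.  The test functions are
   the smooth functions on the torus, so that f has no jump across 0 = 1. *)
Definition H1Y (f df : R -> R) : Prop :=
  [/\ L2 leb1 Y f, L2 leb1 Y df
    & forall psi, test_per psi ->
        \int[leb1]_(y in Y) (f y * derive1 psi y)
          = - (\int[leb1]_(y in Y) (df y * psi y))].

(* v belongs to L^2(R/Z; H^1(S)), with weak gradient (v2, v3) in xbar. *)
Definition L2Y_H1S (S : set (R * R)%type) (v v2 v3 : (R * R) * R -> R) : Prop :=
  [/\ L2 leb3 (S `*` Y) v, L2 leb3 (S `*` Y) v2, L2 leb3 (S `*` Y) v3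
    & {ae leb1, forall y, Y y ->
        H1S S (fun x => v (x, y)) (fun x => v2 (x, y)) (fun x => v3 (x, y))}].

(* v belongs to L^2(S; H^1(R/Z)), with weak derivative dv in y. *)
Definition L2S_H1Y (S : set (R * R)%type) (v dv : (R * R) * R -> R) : Prop :=
  [/\ L2 leb3 (S `*` Y) v, L2 leb3 (S `*` Y) dv
    & {ae leb2, forall x, S x ->
        H1Y (fun y => v (x, y)) (fun y => dv (x, y))}].

End Spaces.

Section CrossSection.
Context (R : realType).

(* p + s t + u n, where n is a unit vector and t is n rotated by a right
   angle. *)
Definition frame_point (p n : R * R) (s u : R) : R * R :=
  (p.1 - s * n.2 + u * n.1, p.2 + s * n.1 + u * n.2).

Definition lipschitz_boundary (S : set (R * R)%type) : Prop :=
  forall p, (closure S `\` interior S) p ->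
    exists (n : R * R) (r h L : R) (g : R -> R),
      [/\ n.1 ^+ 2 + n.2 ^+ 2 = 1, 0 < r, 0 < h,
          forall s s', `|g s - g s'| <= L * `|s - s'|
        & forall s u, `|s| < r -> `|u| < h ->
            (S (frame_point p n s u) <-> g s < u)].

Definition cross_section (S : set (R * R)%type) : Prop :=
  [/\ S !=set0, open S, connected S, bounded_set S & lipschitz_boundary S] /\
  [/\ \int[leb2]_(x in S) x.1 = 0, \int[leb2]_(x in S) x.2 = 0
    & \int[leb2]_(x in S) (x.1 * x.2) = 0].

(* The torsion functional, as a function of the weak gradient (v2, v3). *)
Definition torsion_energy (S : set (R * R)%type) (v2 v3 : R * R -> R) : R :=
  \int[leb2]_(x in S) ((v2 x - x.2) ^+ 2 + (v3 x + x.1) ^+ 2).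

(* phi is the torsion function of S, with weak gradient (phi2, phi3). *)
Definition torsion_function (S : set (R * R)%type) (phi phi2 phi3 : R * R -> R)
    : Prop :=
  [/\ H1S S phi phi2 phi3, \int[leb2]_(x in S) phi x = 0
    & forall v v2 v3, H1S S v v2 v3 ->
        torsion_energy S phi2 phi3 <= torsion_energy S v2 v3].

Definition tauS (S : set (R * R)%type) : R :=
  inf [set t | exists v v2 v3, H1S S v v2 v3 /\ t = torsion_energy S v2 v3].

End CrossSection.

Section Strains.
Context (R : realType).

Definition sym (G : 'M[R]_3) : 'M[R]_3 := 2^-1 *: (G + G^T).

Definition skew (K : 'M[R]_3) : Prop := K^T = - K.

Definition sqnorm (G : 'M[R]_3) : R := \sum_(i < 3) \sum_(j < 3) G i j ^+ 2.

Definition mx3 (s : seq (seq R)) : 'M[R]_3 :=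
  \matrix_(i, j) (nth [::] s i)`_j.

Definition diag3 (a b c : R) : 'M[R]_3 := diag_mx (\row_j [:: a; b; c]`_j).

Definition evec (i : 'I_3) : 'cV[R]_3 := delta_mx i 0.

Definition xvec (x : R * R) : 'cV[R]_3 :=
  x.1 *: evec 1 + x.2 *: evec 2%:R.

Definition tens (a b : 'cV[R]_3) : 'M[R]_3 := a *m b^T.

Definition cols3 (v n2 n3 : 'cV[R]_3) : 'M[R]_3 :=
  \matrix_(i, j) [:: v i 0; n2 i 0; n3 i 0]`_j.

Definition strain (K : 'M[R]_3) (a : R) (x : R * R) : 'M[R]_3 :=
  sym (tens (K *m xvec x + a *: evec 0) (evec 0)).

Definition K2 : 'M[R]_3 := tens (evec 1) (evec 0) - tens (evec 0) (evec 1).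
Definition K3 : 'M[R]_3 :=
  tens (evec 2%:R) (evec 0) - tens (evec 0) (evec 2%:R).
Definition K4 : 'M[R]_3 :=
  tens (evec 2%:R) (evec 1) - tens (evec 1) (evec 2%:R).

(* The basis strains E^(1), ..., E^(4) are numbered from 0. *)
Definition Estrain (i : 'I_4) (x : R * R) : 'M[R]_3 :=
  nth 0 [:: strain 0 1 x; strain K2 0 x; strain K3 0 x; strain K4 0 x] i.

Definition Hrel (gamma : regime) (S : set (R * R)%type)
    (chi : (R * R) * R -> 'M[R]_3) : Prop :=
  L2mx leb3 (S `*` Y) chi /\
  match gamma with
  | GammaZero =>
      exists (Psi dPsi : R -> 'M[R]_3) (phat dphat : R -> 'cV[R]_3)
             (pbar pbar2 pbar3 : (R * R) * R -> 'cV[R]_3),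
        [/\ forall i j, H1Y (fun y => Psi y i j) (fun y => dPsi y i j),
            {ae leb1, forall y, Y y -> skew (Psi y)},
            forall i, H1Y (fun y => phat y i 0) (fun y => dphat y i 0),
            forall i, L2Y_H1S S (fun p => pbar p i 0) (fun p => pbar2 p i 0)
                                (fun p => pbar3 p i 0)
          & {ae leb3, forall p, (S `*` Y) p ->
              chi p = sym (cols3 (dPsi p.2 *m xvec p.1 + dphat p.2)
                                 (pbar2 p) (pbar3 p))}]
  | GammaInfty =>
      exists (phat dphat : (R * R) * R -> 'cV[R]_3)
             (pbar pbar2 pbar3 : R * R -> 'cV[R]_3),
        [/\ forall i, L2S_H1Y S (fun p => phat p i 0) (fun p => dphat p i 0),
            forall i, H1S S (fun x => pbar x i 0) (fun x => pbar2 x i 0)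
                            (fun x => pbar3 x i 0)
          & {ae leb3, forall p, (S `*` Y) p ->
              chi p = sym (cols3 (dphat p) (pbar2 p.1) (pbar3 p.1))}]
  end.

End Strains.
Arguments Estrain {R}.

Section Effective.
Context (R : realType).
Variables (gamma : regime) (S : set (R * R)%type) (Q : R -> 'M[R]_3 -> R).

Definition elliptic (c1 c2 : R) : Prop :=
  {ae leb1, forall y, Y y -> forall G : 'M[R]_3,
     c1 * sqnorm (sym G) <= Q y G /\ Q y G <= c2 * sqnorm (sym G)}.

(* <L(y) F, G> *)
Definition Lform (y : R) (F G : 'M[R]_3) : R :=
  2^-1 * (Q y (F + G) - Q y F - Q y G).

Definition pairing (F G : (R * R) * R -> 'M[R]_3) : R :=
  \int[leb3]_(p in S `*` Y) Lform p.2 (F p) (G p).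

Definition total_strain (chi : 'I_4 -> (R * R) * R -> 'M[R]_3) (i : 'I_4)
    (p : (R * R) * R) : 'M[R]_3 := Estrain i p.1 + chi i p.

Definition correctors (chi : 'I_4 -> (R * R) * R -> 'M[R]_3) : Prop :=
  forall i, Hrel gamma S (chi i) /\
    forall eta, Hrel gamma S eta -> pairing (total_strain chi i) eta = 0.

Definition Mmx (chi : 'I_4 -> (R * R) * R -> 'M[R]_3) : 'M[R]_4 :=
  \matrix_(i, j) pairing (total_strain chi i) (total_strain chi j).

Definition bvec (B : R * ((R * R) * R) -> 'M[R]_3)
    (chi : 'I_4 -> (R * R) * R -> 'M[R]_3) (x1 : R) : 'cV[R]_4 :=
  \col_i pairing (fun p => B (x1, p)) (total_strain chi i).

Definition Qhom (K : 'M[R]_3) (a : R) : \bar R :=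
  ereal_inf [set t | exists2 chi, Hrel gamma S chi
    & t = (\int[leb3]_(p in S `*` Y) (Q p.2 (strain K a p.1 + chi p))%:E)%E].

End Effective.

Section Moduli.
Context (R : realType).
Variables (mu lam : R -> R).

Definition Qiso (y : R) (G : 'M[R]_3) : R :=
  2 * mu y * sqnorm (sym G) + lam y * \tr G ^+ 2.

Definition avg (f : R -> R) : R := \int[leb1]_(y in Y) f y.

Definition hmean (f : R -> R) : R := (\int[leb1]_(y in Y) (f y)^-1)^-1.

Definition nu (y : R) : R := lam y / (2 * (mu y + lam y)).

Definition beta (y : R) : R := 2 * mu y + lam y - 2 * lam y * nu y.

Definition Mmod (y : R) : R := 2 * mu y + lam y.

Definition nu_infty : R :=
  2^-1 * ((hmean Mmod * avg (fun y => lam y / Mmod y)) /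
    (avg (fun y => lam y / Mmod y) ^+ 2 * hmean Mmod
     - avg (fun y => lam y ^+ 2 / Mmod y) + avg (fun y => lam y + mu y))).

Definition beta_infty : R :=
  hmean Mmod * (1 - 2 * nu_infty * avg (fun y => lam y / Mmod y)).

Definition beta_eff (gamma : regime) : R :=
  match gamma with GammaZero => hmean beta | GammaInfty => beta_infty end.

Definition g_infty (y : R) : R :=
  2 * (mu y + lam y) * nu_infty
  - (beta_infty + 2 * nu_infty * lam y) * (lam y / Mmod y).

(* The claimed value of E^(1) + chi^(1). *)
Definition stretch (gamma : regime) (y : R) : 'M[R]_3 :=
  match gamma with
  | GammaZero => (hmean beta / beta y) *: diag3 1 (- nu y) (- nu y)
  | GammaInfty =>
      diag3 (beta_infty / Mmod y + 2 * nu_infty * (lam y / Mmod y))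
            (- nu_infty) (- nu_infty)
  end.

(* The claimed value of E^(4) + chi^(4). *)
Definition torsion_strain (phi2 phi3 : R * R -> R) (p : (R * R) * R)
    : 'M[R]_3 :=
  let s2 := 2^-1 * (phi2 p.1 - p.1.2) in
  let s3 := 2^-1 * (phi3 p.1 + p.1.1) in
  (hmean mu / mu p.2) *: mx3 [:: [:: 0; s2; s3]; [:: s2; 0; 0]; [:: s3; 0; 0]].

End Moduli.

(* Main.v *)
(* The claimed strains are tested against the orthogonality relation.  The stress
   of the claimed E^(i) + chi^(i) is
     w_i(x) (beta e_1 (x) e_1 - g(y) (e_2 (x) e_2 + e_3 (x) e_3)),  i = 1, 2, 3,
   with w = (1, -x_2, -x_3), and g = 0 or g = g_infty, which has mean zero over
   the period; for i = 4 it is <mu>_hom times the shear field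
   (d_2 phi - x_3, d_3 phi + x_2), which does not depend on y and is orthogonal
   to gradients by the Euler-Lagrange equation of the torsion problem.  So every
   pairing with a relaxed strain is an integral of a function of x against a
   y-derivative over the period, or of a divergence-free field against a
   gradient in x, and vanishes.  Conversely claimed strain - E^(i) is a relaxed
   strain: the y-dependence has mean one and is integrated in y, and the
   contraction of the cross section is the gradient of a quadratic polynomial.
   Coercivity then identifies the correctors, M_ij is the pairing of
   E^(i) + chi^(i) with E^(j), and Q_hom follows by completing the square. *)

Require Import Defs.
From HB Require Import structures.
From mathcomp Require Import all_boot all_order all_algebra.
From mathcomp Require Import all_classical all_reals all_analysis.
From mathcomp Require Import ess_sup_inf measurable_realfun.
From mathcomp Require Import ring lra.

Set Implicit Arguments.
Unset Strict Implicit.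
Unset Printing Implicit Defensive.

Import Order.TTheory GRing.Theory Num.Theory.
Import numFieldNormedType.Exports.

Local Open Scope classical_set_scope.
Local Open Scope ring_scope.

(** * Square-integrable functions and Fubini on rectangles *)

(** Ellipticity tested on a shear gives [mu >= c1 / 2]. With [lam >= 0] this keeps [mu], [beta] and
    [Mmod] away from zero, so every coefficient below is a bounded function on the period. Both
    regimes are treated through one description of relaxed strains: the symmetric part of (v | n2 |
    n3), where [v] has mean zero in y for almost every x and (n2 | n3) is a gradient in x for almost
    every y. What separates the regimes is where an oscillating factor may sit. For gamma = 0 the
    potential of (n2 | n3) may depend on y, but [v] is affine in xbar; for gamma = infinity [v] may
    depend on x freely, but (n2 | n3) does not depend on y. Hence the constant transverse
    contraction in the second regime, and two different decompositions of the same twist strain. The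
    delicate point in inverting [Mmx] is [tauS S > 0], since [tauS] is only given as an infimum; its
    positivity is a rigidity statement about weak gradients, checked against an explicit smooth
    bump. *)

Section L2Calculus.
Context d (T : measurableType d) (R : realType).
Context (m : {measure set T -> \bar R}) (D : set T).
Hypothesis mD : measurable D.
Implicit Types f g h : T -> R.

Lemma integrable_EFinP f : measurable_fun D f ->
  (\int[m]_(x in D) (`|f x|)%:E < +oo)%E -> m.-integrable D (EFin \o f).
Proof. by move=> mf fi; apply/integrableP; split; [exact/measurable_EFinP|]. Qed.

Lemma L2_sq_integrable f : L2 m D f -> m.-integrable D (EFin \o (fun x => f x ^+ 2)).
Proof.
move=> [mf fi]; apply: integrable_EFinP; first exact: measurable_funX.
by under eq_integral do rewrite ger0_norm ?sqr_ge0//.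
Qed.

Lemma integrable_dom f g : measurable_fun D f ->
  m.-integrable D (EFin \o g) ->
  {ae m, forall x, D x -> `|f x| <= g x} -> m.-integrable D (EFin \o f).
Proof.
move=> mf gi fg; apply: integrable_EFinP => //.
have mg := measurable_int _ gi.
apply: (@le_lt_trans _ _ (\int[m]_(x in D) `|(EFin \o g) x|)%E); last first.
  by case/integrableP: gi.
apply: ae_ge0_le_integral => //.
- by apply/measurable_EFinP; exact: measurableT_comp.
- exact: measurableT_comp.
- apply: filterS fg => x fgx Dx; rewrite /= lee_fin.
  by apply: (le_trans (fgx Dx)); rewrite ler_norm.
Qed.

Lemma L2P f : L2 m D f <->
  measurable_fun D f /\ m.-integrable D (EFin \o (fun x => f x ^+ 2)).
Proof.
split=> [Lf|[mf fi]]; first by split; [case: Lf|exact: L2_sq_integrable].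
split=> //; move/integrableP: fi => [_]; congr (_ < _)%E.
by apply: eq_integral => x _; rewrite /= ger0_norm ?sqr_ge0.
Qed.

Lemma integrable_comb f g (a b : R) : m.-integrable D (EFin \o f) ->
  m.-integrable D (EFin \o g) ->
  m.-integrable D (EFin \o (fun x => a * f x + b * g x)).
Proof.
move=> fi gi; have := integrableD mD (integrableZl mD a fi) (integrableZl mD b gi).
exact.
Qed.

Lemma integrableDR f g : m.-integrable D (EFin \o f) ->
  m.-integrable D (EFin \o g) ->
  m.-integrable D (EFin \o (fun x => f x + g x)).
Proof. by move=> fi gi; have := integrableD mD fi gi; exact. Qed.

Lemma integrableBR f g : m.-integrable D (EFin \o f) ->
  m.-integrable D (EFin \o g) ->
  m.-integrable D (EFin \o (fun x => f x - g x)).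
Proof. by move=> fi gi; have := integrableB mD fi gi; exact. Qed.

Lemma integrableZR f a : m.-integrable D (EFin \o f) ->
  m.-integrable D (EFin \o (fun x => a * f x)).
Proof. by move=> fi; have := integrableZl mD a fi; exact. Qed.

(** Young's inequality provides the dominating function [f ^+ 2 + g ^+ 2]. *)
Lemma L2_mul f g : L2 m D f -> L2 m D g ->
  m.-integrable D (EFin \o (fun x => f x * g x)).
Proof.
move=> Lf Lg; have [mf _] := Lf; have [mg _] := Lg.
apply: (@integrable_dom _ (fun x => 1 * f x ^+ 2 + 1 * g x ^+ 2)).
- exact: measurable_funM.
- by apply: integrable_comb; exact: L2_sq_integrable.
- apply: aeW => x _; rewrite normrM !mul1r -(real_normK (num_real (f x))).
  rewrite -(real_normK (num_real (g x))).
  by move: (normr_ge0 (f x)) (normr_ge0 (g x)); move: `|f x| `|g x| => a b a0 b0;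
  have := sqr_ge0 (a - b); have := mulr_ge0 a0 b0; lra.
Qed.

Lemma L2D f g : L2 m D f -> L2 m D g -> L2 m D (fun x => f x + g x).
Proof.
move=> Lf Lg; have [mf _] := Lf; have [mg _] := Lg.
apply/L2P; split; first exact: measurable_funD.
apply: (@integrable_dom _ (fun x => 2 * f x ^+ 2 + 2 * g x ^+ 2)).
- by apply: measurable_funX; exact: measurable_funD.
- by apply: integrable_comb; exact: L2_sq_integrable.
- by apply: aeW => x _; rewrite ger0_norm ?sqr_ge0//; move: (f x) (g x) => a b;
  have := sqr_ge0 (a - b); lra.
Qed.

Lemma L2_bddM h f (C : R) : measurable_fun D h ->
  {ae m, forall x, D x -> `|h x| <= C} -> L2 m D f ->
  L2 m D (fun x => h x * f x).
Proof.
move=> mh hC Lf; have [mf _] := Lf.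
apply/L2P; split; first exact: measurable_funM.
apply: (@integrable_dom _ (fun x => C ^+ 2 * f x ^+ 2)).
- by apply: measurable_funX; exact: measurable_funM.
- by apply: integrableZR; exact: L2_sq_integrable.
- apply: filterS hC => x hx Dx; rewrite ger0_norm ?sqr_ge0// exprMn.
  apply: ler_wpM2r; first exact: sqr_ge0.
  by rewrite -(real_normK (num_real (h x))) lerXn2r ?nnegrE ?(le_trans _ (hx Dx)) ?hx.
Qed.

Lemma L2Z f a : L2 m D f -> L2 m D (fun x => a * f x).
Proof.
apply: (@L2_bddM (cst a) _ `|a|); first exact: measurable_cst.
exact: aeW.
Qed.

Lemma L2N f : L2 m D f -> L2 m D (fun x => - f x).
Proof. by move=> /(L2Z (-1)); under eq_fun do rewrite mulN1r. Qed.

Lemma L2B f g : L2 m D f -> L2 m D g -> L2 m D (fun x => f x - g x).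
Proof. by move=> Lf /L2N; exact: L2D. Qed.

Lemma L20 : L2 m D (fun=> 0).
Proof.
split; first exact: measurable_cst.
by under eq_integral do rewrite expr0n/=; rewrite integral0 ltry.
Qed.

Section finite.
Hypothesis mDoo : (m D < +oo)%E.

Lemma bdd_L2 h (C : R) : measurable_fun D h ->
  {ae m, forall x, D x -> `|h x| <= C} -> L2 m D h.
Proof.
move=> mh hC.
have L1 : L2 m D (fun=> 1).
  split; first exact: measurable_cst.
  by under eq_integral do rewrite expr1n; rewrite integral_cst// mul1e.
by have := L2_bddM mh hC L1; under eq_fun do rewrite mulr1.
Qed.

Lemma L2_cst (a : R) : L2 m D (fun=> a).
Proof. by apply: (@bdd_L2 _ `|a|); [exact: measurable_cst|exact: aeW]. Qed.

Lemma L2_integrable f : L2 m D f -> m.-integrable D (EFin \o f).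
Proof.
move=> Lf; have := L2_mul Lf (L2_cst 1).
by congr integrable; apply/funext => x /=; rewrite mulr1.
Qed.
End finite.

Lemma ae_eq_Rintegral f g : measurable_fun D f -> measurable_fun D g ->
  {ae m, forall x, D x -> f x = g x} ->
  \int[m]_(x in D) f x = \int[m]_(x in D) g x.
Proof.
move=> mf mg fg; rewrite /Rintegral; congr fine.
apply: ae_eq_integral => //; try exact/measurable_EFinP.
by apply: filterS fg => x /= fgx Dx; rewrite fgx.
Qed.

Lemma integrable_sumR (I : Type) (s : seq I) (F : I -> T -> R) :
  (forall i, m.-integrable D (EFin \o F i)) ->
  m.-integrable D (EFin \o (fun x => \sum_(i <- s) F i x)).
Proof.
move=> FI; have := integrable_sum mD s (P := predT) (fun i _ => FI i).
by congr integrable; apply/funext => x /=; rewrite sumEFin.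
Qed.

Lemma Rintegral0 : \int[m]_(x in D) (0 : R) = 0.
Proof. by rewrite /Rintegral integral0. Qed.

(** Under the sign condition the integral of [|f|] is the same number 0. Definiteness of the energy
    and positivity of the torsion minimum both reduce to this. *)
Lemma Rintegral_ge0_eq0 f : m.-integrable D (EFin \o f) ->
  {ae m, forall x, D x -> 0 <= f x} -> \int[m]_(x in D) f x = 0 ->
  {ae m, forall x, D x -> f x = 0}.
Proof.
move=> fi f0 If.
have mf := measurable_int _ fi.
have : (\int[m]_(x in D) `|(EFin \o f) x| = 0)%E.
  transitivity (\int[m]_(x in D) (EFin \o f) x)%E.
    apply: ae_eq_integral => //; first exact: measurableT_comp.
    by apply: filterS f0 => x fx Dx; rewrite /= ger0_norm ?fx.
  rewrite -[LHS]fineK; last exact: integrable_fin_num.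
  by rewrite -[X in X%:E = _]/(Rintegral m D f) If.
move/(ae_eq_integral_abs _ mD mf) => /=.
by apply: filterS => x fx Dx; have := fx Dx => -[].
Qed.

(** Filter monotonicity with the measure as a named argument, so that a call can fix which of
    [leb1], [leb2], [leb3] is meant. *)
Lemma ae_mono (P Q : T -> Prop) : (forall x, P x -> Q x) ->
  {ae m, forall x, P x} -> {ae m, forall x, Q x}.
Proof. by move=> PQ; apply: filterS. Qed.

Lemma ae_mono2 (P P' Q : T -> Prop) : (forall x, P x -> P' x -> Q x) ->
  {ae m, forall x, P x} -> {ae m, forall x, P' x} -> {ae m, forall x, Q x}.
Proof. by move=> PQ; apply: filterS2. Qed.

End L2Calculus.

(** * Slices and iterated integrals over a rectangle *)

Section ProductMeasure.
Context d1 d2 (T1 : measurableType d1) (T2 : measurableType d2) (R : realType).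
Context (m1 : {sigma_finite_measure set T1 -> \bar R}).
Context (m2 : {sigma_finite_measure set T2 -> \bar R}).
Context (D1 : set T1) (D2 : set T2).
Hypotheses (mD1 : measurable D1) (mD2 : measurable D2).
Local Notation m12 := (m1 \x m2)%E.

Lemma measurable_fun_lift1 (f : T1 -> R) : measurable_fun D1 f ->
  measurable_fun (D1 `*` D2) (fun p => f p.1).
Proof.
move=> mf; apply: (measurable_comp mD1) => //.
  by move=> x [[y z] [] ? ? <-].
by apply: measurable_funTS; exact: measurable_fst.
Qed.

Lemma measurable_fun_lift2 (f : T2 -> R) : measurable_fun D2 f ->
  measurable_fun (D1 `*` D2) (fun p => f p.2).
Proof.
move=> mf; apply: (measurable_comp mD2) => //.
  by move=> x [[y z] [] ? ? <-].
by apply: measurable_funTS; exact: measurable_snd.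
Qed.

Lemma measurable_fun_slice1 (f : T1 * T2 -> R) x :
  measurable_fun (D1 `*` D2) f -> D1 x -> measurable_fun D2 (fun y => f (x, y)).
Proof.
move=> mf Dx; apply: (@measurable_comp _ _ _ _ _ _ (D1 `*` D2) f) => //.
- exact: measurableX.
- by move=> _ [y Dy <-].
- by apply: measurable_funTS; exact: measurable_pair1.
Qed.

(** The null set [N] lifts to a cylinder over the whole first factor, which stays null even if that
    factor has infinite measure, since infinity times 0 is 0. *)
Lemma ae_lift2 (P : T2 -> Prop) : {ae m2, forall y, P y} ->
  {ae m12, forall p, P p.2}.
Proof.
move=> [N [mN N0 PN]]; exists (setT `*` N); split.
- exact: measurableX.
- by rewrite product_measure1E// N0 mule0.
- by move=> [x y] /= nP; split => //; exact: PN.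
Qed.

Lemma ae_lift1 (P : T1 -> Prop) : {ae m1, forall x, P x} ->
  {ae m12, forall p, P p.1}.
Proof.
move=> [N [mN N0 PN]]; exists (N `*` setT); split.
- exact: measurableX.
- by transitivity (m1 N * m2 setT)%E; [exact: product_measure1E|rewrite N0 mul0e].
- by move=> [x y] /= nP; split => //; exact: PN.
Qed.

(** Extension by zero commutes with slicing; this and its three companions carry Fubini from the
    whole product space to a rectangle. *)
Let restrE (f : T1 * T2 -> \bar R) x y : D1 x ->
  (f \_ (D1 `*` D2)) (x, y) = ((fun y => f (x, y)) \_ D2) y.
Proof.
move=> Dx; rewrite !patchE; case: ifPn => [/set_mem[_ Dy]|].
  by rewrite mem_set.
by case: ifPn => // /set_mem Dy; rewrite mem_set.
Qed.

Let restrE2 (f : T1 * T2 -> \bar R) x y : D2 y ->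
  (f \_ (D1 `*` D2)) (x, y) = ((fun x => f (x, y)) \_ D1) x.
Proof.
move=> Dy; rewrite !patchE; case: ifPn => [/set_mem[Dx _]|].
  by rewrite mem_set.
by case: ifPn => // /set_mem Dx; rewrite mem_set.
Qed.

Let restr0 (f : T1 * T2 -> \bar R) x y : ~ D1 x ->
  (f \_ (D1 `*` D2)) (x, y) = 0%E.
Proof. by move=> nDx; rewrite patchE; case: ifPn => // /set_mem[]. Qed.

Let restr02 (f : T1 * T2 -> \bar R) x y : ~ D2 y ->
  (f \_ (D1 `*` D2)) (x, y) = 0%E.
Proof. by move=> nDx; rewrite patchE; case: ifPn => // /set_mem[]. Qed.

Let inner1 (f : T1 * T2 -> \bar R) x :
  (\int[m2]_y (f \_ (D1 `*` D2)) (x, y))%E =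
  ((fun x => \int[m2]_(y in D2) f (x, y))%E \_ D1) x.
Proof.
rewrite [RHS]patchE; case: ifPn => [/set_mem Dx|/negP nDx].
  by rewrite [RHS]integral_mkcond; apply: eq_integral => y _; rewrite restrE.
by rewrite integral0_eq// => y _; rewrite restr0// => Dx; apply: nDx; rewrite mem_set.
Qed.

Let inner2 (f : T1 * T2 -> \bar R) y :
  (\int[m1]_x (f \_ (D1 `*` D2)) (x, y))%E =
  ((fun y => \int[m1]_(x in D1) f (x, y))%E \_ D2) y.
Proof.
rewrite [RHS]patchE; case: ifPn => [/set_mem Dy|/negP nDy].
  by rewrite [RHS]integral_mkcond; apply: eq_integral => x _; rewrite restrE2.
by rewrite integral0_eq// => x _; rewrite restr02// => Dy; apply: nDy; rewrite mem_set.
Qed.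

Lemma tonelli_setX (f : T1 * T2 -> R) : measurable_fun (D1 `*` D2) f ->
  (forall p, 0 <= f p) ->
  (\int[m12]_(p in D1 `*` D2) (f p)%:E =
   \int[m1]_(x in D1) \int[m2]_(y in D2) (f (x, y))%:E)%E.
Proof.
move=> mf f0; rewrite [LHS]integral_mkcond fubini_tonelli1.
- rewrite [RHS]integral_mkcond; apply: eq_integral => x _.
  by rewrite -(inner1 (EFin \o f)).
- apply/(measurable_restrictT _ _).1; first exact: measurableX.
  exact/measurable_EFinP.
- by move=> p; apply: erestrict_ge0 => q _; rewrite lee_fin.
Qed.

Section integrable.
Context (f : T1 * T2 -> R).
Hypothesis fi : m12.-integrable (D1 `*` D2) (EFin \o f).

Let fiT : m12.-integrable setT ((EFin \o f) \_ (D1 `*` D2)).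
Proof. exact: (integrable_mkcond _ (measurableX mD1 mD2)).1. Qed.

Lemma ae_integrable_slice1 : {ae m1, forall x, D1 x ->
  m2.-integrable D2 (EFin \o (fun y => f (x, y)))}.
Proof.
have := ae_integrable1 fiT; apply: filterS => x /= fx Dx.
apply: (integrable_mkcond _ mD2).2; move: fx; congr integrable.
by apply/funext => y; rewrite restrE.
Qed.

Lemma ae_integrable_slice2 : {ae m2, forall y, D2 y ->
  m1.-integrable D1 (EFin \o (fun x => f (x, y)))}.
Proof.
have := ae_integrable2 fiT; apply: filterS => y /= fy Dy.
apply: (integrable_mkcond _ mD1).2; move: fy; congr integrable.
by apply/funext => x; rewrite restrE2.
Qed.

Let F1 x := (\int[m2]_(y in D2) (f (x, y))%:E)%E.
Let F2 y := (\int[m1]_(x in D1) (f (x, y))%:E)%E.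

Let F1i : m1.-integrable D1 F1.
Proof.
apply: (integrable_mkcond _ mD1).2; have := integrable_fubini_F fiT.
by congr integrable; apply/funext => x; rewrite /fubini_F inner1.
Qed.

Let F2i : m2.-integrable D2 F2.
Proof.
apply: (integrable_mkcond _ mD2).2.
have fT := fiT; have mF := measurable_fubini_G fT.
apply/integrableP; split.
  by move: mF; congr measurable_fun; apply/funext => y; rewrite /fubini_G inner2.
(* Integrability of [f] means that the iterated integral of its absolute value, taken in this order,
   is finite; that number dominates the integral of [|F2|]. *)
have := (integrable21ltyP m1 m2 (measurable_int _ fT)).1 fT.
apply: le_lt_trans; apply: ge0_le_integral => //.
- apply: measurableT_comp => //.
  by move: mF; congr measurable_fun; apply/funext => y; rewrite /fubini_G inner2.
- apply: (measurable_fun_fubini_tonelli_G (abse \o _)) => /=; last by move=> p; exact: abse_ge0.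
  by apply: measurableT_comp => //; exact: measurable_int fT.
- move=> y _; rewrite -(inner2 (EFin \o f)).
  apply: le_abse_integral => //.
  apply: (measurableT_comp (g := fun x => (x, y))).
    exact: measurable_int fT.
  exact: measurable_pair2.
Qed.

(** [F1] is extended-real valued, while the iterated [Rintegral] sees [fine (F1 x)]; the two agree
    wherever the slice is integrable. *)
Let ae_fine1 : {ae m1, forall x, D1 x -> F1 x = (fine (F1 x))%:E}.
Proof.
have := ae_integrable_slice1; apply: filterS => x fx Dx.
by rewrite fineK//; apply: integrable_fin_num => //; exact: fx.
Qed.

Let ae_fine2 : {ae m2, forall y, D2 y -> F2 y = (fine (F2 y))%:E}.
Proof.
have := ae_integrable_slice2; apply: filterS => x fx Dx.
by rewrite fineK//; apply: integrable_fin_num => //; exact: fx.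
Qed.

Let measurable_fine1 : measurable_fun D1 (fine \o F1).
Proof.
by apply: (measurableT_comp (f := fine)) => //; exact: measurable_int F1i.
Qed.

Let measurable_fine2 : measurable_fun D2 (fine \o F2).
Proof.
by apply: (measurableT_comp (f := fine)) => //; exact: measurable_int F2i.
Qed.

Lemma fubini_integrable1 :
  m1.-integrable D1 (EFin \o (fun x => \int[m2]_(y in D2) f (x, y))).
Proof.
apply/integrableP; split; first exact/measurable_EFinP.
have /integrableP[mF] := F1i; congr (_ < _)%E.
apply: ae_eq_integral => //.
- exact: measurableT_comp.
- by apply: measurableT_comp => //; exact/measurable_EFinP.
- by apply: filterS ae_fine1 => x /[apply] ->.
Qed.

Lemma fubini_integrable2 :
  m2.-integrable D2 (EFin \o (fun y => \int[m1]_(x in D1) f (x, y))).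
Proof.
apply/integrableP; split; first exact/measurable_EFinP.
have /integrableP[mF] := F2i; congr (_ < _)%E.
apply: ae_eq_integral => //.
- exact: measurableT_comp.
- by apply: measurableT_comp => //; exact/measurable_EFinP.
- by apply: filterS ae_fine2 => x /[apply] ->.
Qed.

Lemma Rintegral_setX12 : \int[m12]_(p in D1 `*` D2) f p =
  \int[m1]_(x in D1) \int[m2]_(y in D2) f (x, y).
Proof.
rewrite /Rintegral; congr fine.
rewrite [LHS]integral_mkcond -(integral12_prod_meas1 fiT).
transitivity (\int[m1]_(x in D1) F1 x)%E.
  rewrite [RHS]integral_mkcond; apply: eq_integral => x _.
  by rewrite -(inner1 (EFin \o f)).
apply: ae_eq_integral => //; first exact: measurable_int F1i.
exact/measurable_EFinP.
Qed.

Lemma Rintegral_setX21 : \int[m12]_(p in D1 `*` D2) f p =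
  \int[m2]_(y in D2) \int[m1]_(x in D1) f (x, y).
Proof.
rewrite /Rintegral; congr fine.
rewrite [LHS]integral_mkcond -(integral21_prod_meas1 fiT).
transitivity (\int[m2]_(x in D2) F2 x)%E.
  rewrite [RHS]integral_mkcond; apply: eq_integral => x _.
  by rewrite -(inner2 (EFin \o f)).
apply: ae_eq_integral => //; first exact: measurable_int F2i.
exact/measurable_EFinP.
Qed.
End integrable.

Lemma ae_L2_slice1 (f : T1 * T2 -> R) : L2 m12 (D1 `*` D2) f ->
  {ae m1, forall x, D1 x -> L2 m2 D2 (fun y => f (x, y))}.
Proof.
move=> Lf; have [mf _] := Lf.
have /ae_integrable_slice1 := L2_sq_integrable Lf.
apply: filterS => x fx Dx; apply/L2P; split; last exact: fx.
exact: measurable_fun_slice1.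
Qed.

(** Tonelli factors the integral of the square into a product of two finite numbers. *)
Lemma L2_tensor (a : T1 -> R) (b : T2 -> R) : L2 m1 D1 a -> L2 m2 D2 b ->
  L2 m12 (D1 `*` D2) (fun p => a p.1 * b p.2).
Proof.
move=> La Lb; have [ma ai] := La; have [mb bi] := Lb.
have mab : measurable_fun (D1 `*` D2) (fun p => a p.1 * b p.2).
  by apply: measurable_funM; [exact: measurable_fun_lift1|exact: measurable_fun_lift2].
split=> //.
rewrite (tonelli_setX (f := fun p => (a p.1 * b p.2) ^+ 2)); last 2 first.
- exact: measurable_funX.
- by move=> p; exact: sqr_ge0.
set B := (\int[m2]_(y in D2) (b y ^+ 2)%:E)%E in bi *.
have B0 : (0 <= B)%E by apply: integral_ge0 => y _; rewrite lee_fin sqr_ge0.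
rewrite (_ : (\int[m1]_(x in D1) _)%E = (\int[m1]_(x in D1) ((a x ^+ 2)%:E * B))%E).
  rewrite ge0_integralZr//.
  - by apply: lte_mul_pinfty => //; rewrite ?fin_num_abs ?gee0_abs //;
      apply: integral_ge0 => y _; rewrite lee_fin sqr_ge0.
  - by apply/measurable_EFinP; exact: measurable_funX.
  - by move=> x _; rewrite lee_fin sqr_ge0.
apply: eq_integral => x _; rewrite -ge0_integralZl//=.
- by apply: eq_integral => y _; rewrite exprMn EFinM.
- by apply/measurable_EFinP; exact: measurable_funX.
- by move=> y _; rewrite lee_fin sqr_ge0.
- by rewrite lee_fin sqr_ge0.
Qed.

Lemma Rintegral_tensor (a : T1 -> R) (b : T2 -> R) :
  m1.-integrable D1 (EFin \o a) -> m2.-integrable D2 (EFin \o b) ->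
  m12.-integrable (D1 `*` D2) (EFin \o (fun p => a p.1 * b p.2)) ->
  \int[m12]_(p in D1 `*` D2) (a p.1 * b p.2) =
  (\int[m1]_(x in D1) a x) * \int[m2]_(y in D2) b y.
Proof.
move=> ai bi abi; rewrite (Rintegral_setX12 abi) /= -RintegralZr//.
by apply: eq_Rintegral => x _; rewrite RintegralZl.
Qed.

End ProductMeasure.

(** * Sobolev functions on the cross section and on the torus *)

Section PlaneMeasurability.
Context (R : realType).
Local Notation RL := (measurableTypeR R).

Lemma nbhs_pairP (U : set (R * R)) (x : R * R) : nbhs x U <->
  exists2 e : R, 0 < e &
    forall y : R * R, `|x.1 - y.1| < e -> `|x.2 - y.2| < e -> U y.
Proof.
split=> [/nbhs_ballP[e e0 eU]|[e e0 eU]].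
  by exists e => // y y1 y2; apply: eU; split.
by apply/nbhs_ballP; exists e => // y [y1 y2]; exact: eU.
Qed.

Lemma continuous_pairl (y : R) : continuous (fun x : R => (x, y)).
Proof.
move=> x U /nbhs_pairP[e e0 eU]; apply/nbhs_ballP; exists e => // t xt.
by apply: eU => //=; rewrite subrr normr0.
Qed.

Lemma continuous_pairr (x : R) : continuous (fun y : R => (x, y)).
Proof.
move=> y U /nbhs_pairP[e e0 eU]; apply/nbhs_ballP; exists e => // t xt.
by apply: eU => //=; rewrite subrr normr0.
Qed.

(** The measurable sets of [RL * RL] are those of the product sigma-algebra, so openness has to be
    turned into a countable union of rational boxes. Boxes not contained in [U] are replaced by the
    empty set, which lets all indices range over the rationals. *)
Lemma open_measurable_plane (U : set (R * R)) : open U ->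
  measurable (U : set (RL * RL)).
Proof.
move=> oU.
pose bx (a b c d : rat) : set (RL * RL) :=
  `]ratr a, ratr b[%classic `*` `]ratr c, ratr d[%classic.
pose F a b c d := if pselect (bx a b c d `<=` U) then bx a b c d else set0.
have -> : U = \bigcup_a \bigcup_b \bigcup_c \bigcup_d F a b c d.
  apply/seteqP; split => [x Ux|x [a _ [b _ [c _ [d _]]]]]; last first.
    by rewrite /F; case: pselect => // bU /bU.
  have [e e0 eU] := (nbhs_pairP U x).1 (open_nbhs_nbhs (conj oU Ux)).
  have xe (t : R) : exists a b : rat,
      [/\ t - e < ratr a, ratr a < t, t < ratr b & ratr b < t + e].
    have /rat_in_itvoo[a] : t - e < t by rewrite ltrBlDr ltrDl.
    have /rat_in_itvoo[b] : t < t + e by rewrite ltrDl.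
    by rewrite !in_itv/= => /andP[? ?] /andP[? ?]; exists a, b.
  have [a [b [xa ax xb bx1]]] := xe x.1.
  have [c [d [xc cx xd dx]]] := xe x.2.
  exists a => //; exists b => //; exists c => //; exists d => //.
  rewrite /F; case: pselect => [?|[]].
    by split; rewrite /= in_itv/=; apply/andP.
  move=> y [] /=; rewrite !in_itv/= => /andP[y1 y2] /andP[y3 y4].
  by apply: eU; rewrite ltr_norml; apply/andP; split; lra.
apply: bigcupT_measurable_rat => a; apply: bigcupT_measurable_rat => b.
apply: bigcupT_measurable_rat => c; apply: bigcupT_measurable_rat => d.
rewrite /F; case: pselect => ?; last exact: measurable0.
by apply: measurableX; exact: measurable_itv.
Qed.

Lemma continuous_measurable_plane (f : R * R -> R) : continuous f ->
  measurable_fun setT (f : RL * RL -> RL).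
Proof.
move=> /continuousP cf; apply: (measurability _ (RGenOpens.measurableE R)).
move=> _ [_ [a [b ->] <-]]; rewrite setTI; apply: open_measurable_plane.
exact/cf/interval_open.
Qed.

Lemma measurable_Y : measurable (@Y R : set RL).
Proof. exact: measurable_itv. Qed.

Lemma leb1_itvcc (a b : R) : a <= b -> leb1 `[a, b]%classic = (b - a)%:E.
Proof.
by move=> ab; rewrite /leb1 lebesgue_measure_itv/= lte_fin; case: ltgtP ab => // -> _; rewrite subrr.
Qed.

Lemma leb1_Y : leb1 (@Y R) = 1%E.
Proof. by rewrite /leb1 /Y lebesgue_measure_itv/= lte_fin ltr01 oppr0 adde0. Qed.

Lemma leb1_Y_fin : (leb1 (@Y R) < +oo)%E.
Proof. by rewrite leb1_Y ltry. Qed.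

Lemma bounded_plane (S : set (R * R)) : bounded_set S ->
  exists2 A : R, 0 < A & forall x, S x -> `|x.1| < A /\ `|x.2| < A.
Proof.
(* The bound given by [bounded_set] holds only for numbers above [M], hence [M + 1]; the maximum
   ensures positivity and the outer 1 makes the inequality strict. *)
move=> [M [_ SM]]; exists (Num.max 0 (M + 1) + 1) => [|x Sx].
  by rewrite ltr_wpDl// le_max lexx.
have xM : `|x| <= Num.max 0 (M + 1).
  by apply: (SM _ _ x Sx); rewrite lt_max orbC ltrDl ltr01.
have lt1 t : t <= `|x| -> t < Num.max 0 (M + 1) + 1.
  by move=> tx; rewrite (le_lt_trans (le_trans tx xM))// ltrDl.
by split; apply: lt1; rewrite prod_normE le_max lexx ?orbT.
Qed.

Lemma leb2_rect (a b c d : R) : a <= b -> c <= d ->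
  leb2 (`[a, b]%classic `*` `[c, d]%classic : set (RL * RL)) = ((b - a) * (d - c))%:E.
Proof.
move=> ab cd; transitivity (leb1 `[a, b]%classic * leb1 `[c, d]%classic)%E.
  by apply: product_measure1E; exact: measurable_itv.
by rewrite !leb1_itvcc// -EFinM.
Qed.

Lemma leb2_open_gt0 (U : set (R * R)) : open U -> U !=set0 -> (0 < leb2 U)%E.
Proof.
move=> oU [p Up]; have [e e0 eU] := (nbhs_pairP U p).1 (open_nbhs_nbhs (conj oU Up)).
have h1 (t : R) : t - e / 2 <= t + e / 2 by lra.
apply: (@lt_le_trans _ _ (leb2 (`[p.1 - e / 2, p.1 + e / 2]%classic `*`
    `[p.2 - e / 2, p.2 + e / 2]%classic : set (RL * RL)))).
  by rewrite leb2_rect// lte_fin mulr_gt0//; lra.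
apply: le_measure; rewrite ?inE.
- by apply: measurableX; exact: measurable_itv.
- exact: open_measurable_plane.
- move=> x [] /=; rewrite !in_itv/= => /andP[? ?] /andP[? ?].
  by apply: eU; rewrite ltr_norml; apply/andP; split; lra.
Qed.

Lemma leb2_bounded_fin (S : set (R * R)) : open S -> bounded_set S ->
  (leb2 S < +oo)%E.
Proof.
move=> oS /bounded_plane[A A0 SA].
apply: (@le_lt_trans _ _ (leb2 (`[-A, A]%classic `*` `[-A, A]%classic : set (RL * RL)))).
  apply: le_measure; rewrite ?inE; first exact: open_measurable_plane.
    by apply: measurableX; exact: measurable_itv.
  move=> x /SA [x1 x2]; split => /=; rewrite in_itv/= -ler_norml; exact: ltW.
by rewrite leb2_rect ?ltry//; lra.
Qed.

Lemma derivable_continuous (f : R -> R) :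
  (forall x, derivable f x 1) -> continuous f.
Proof. by move=> df x; apply: differentiable_continuous; exact/derivable1_diffP. Qed.

Lemma ftc_itvcc (F : R -> R) (a b : R) : a <= b ->
  (forall x, derivable F x 1) -> continuous (derive1 F) ->
  \int[leb1]_(x in `[a, b]) derive1 F x = F b - F a.
Proof.
rewrite le_eqVlt => /predU1P[->|ab] dF cF.
  by rewrite set_itv1 subrr /leb1 Rintegral_set1.
have cFF := derivable_continuous dF.
have dab : derivable_oo_LRcontinuous F a b.
  split => [x _||]; first exact: dF.
  + exact/cvg_at_right_filter/cFF.
  + exact/cvg_at_left_filter/cFF.
have cab : {within `[a, b], continuous (derive1 F)} by exact: continuous_subspaceT.
have FF : {in `]a, b[, derive1 F =1 derive1 F} by [].
have := continuous_FTC2 ab cab dab FF.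
by rewrite /Rintegral => ->.
Qed.

Lemma continuous_bounded_itvcc (f : R -> R) (a b : R) : continuous f ->
  exists C : R, forall x, a <= x <= b -> `|f x| <= C.
Proof.
move=> cf.
have : compact (f @` `[a, b]%classic).
  apply: continuous_compact; last exact: segment_compact.
  exact: continuous_subspaceT.
move=> /compact_bounded[M [_ fM]]; exists (M + 1) => x xab.
by apply: (fM (M + 1)); [rewrite ltrDl|exists x => //=; rewrite in_itv/=].
Qed.

Lemma derive1_near0 (f : R -> R) (x : R) : (\near x, f x = 0) -> derive1 f x = 0.
Proof.
move=> f0; rewrite derive1E (@near_eq_derive _ _ _ f (cst 0)) //.
by rewrite -derive1E derive1_cst.
Qed.

End PlaneMeasurability.

(** * Weak derivatives on the cross section *)

Section Sobolev.
Context (R : realType).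
Local Notation RL := (measurableTypeR R).
Implicit Types (S : set (R * R)) (f : R * R -> R).

Lemma continuous_bounded_box f (A : R) : continuous f ->
  exists C : R, forall x : R * R, -A <= x.1 <= A -> -A <= x.2 <= A -> `|f x| <= C.
Proof.
move=> cf.
have : compact (f @` (`[-A, A]%classic `*` `[-A, A]%classic)).
  apply: continuous_compact; first exact: continuous_subspaceT.
  by apply: compact_setX; exact: segment_compact.
move=> /compact_bounded[M [_ fM]]; exists (M + 1) => x x1 x2.
by apply: (fM (M + 1)); [rewrite ltrDl|exists x => //=; split; rewrite /= in_itv/=].
Qed.

Lemma continuous_L2 S f : open S -> bounded_set S -> continuous f -> L2 leb2 S f.
Proof.
move=> oS bS cf; have [A A0 SA] := bounded_plane bS.
have [C fC] := continuous_bounded_box A cf.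
have mS := open_measurable_plane oS.
apply: (bdd_L2 (m := leb2) mS (leb2_bounded_fin oS bS) (C := C)).
  by apply: measurable_funTS; exact: continuous_measurable_plane.
by apply: aeW => x /SA[x1 x2]; apply: fC; rewrite -ler_norml ltW.
Qed.

Section divergence.
Context S (K : set (R * R)) (f : R * R -> R) (A : R).
Hypotheses (A0 : 0 < A) (cK : closed K).
Hypotheses (KS : K `<=` S) (KA : forall x, K x -> `|x.1| < A /\ `|x.2| < A).
Hypothesis f0 : forall x, ~ K x -> f x = 0.
Local Notation I := `[-A, A]%classic.

(** [K] lies in both [S] and the box, and [g] vanishes off [K]: the domain of integration becomes a
    rectangle, whatever the shape of [S]. *)
Let support_box (g : R * R -> R) : (forall x, ~ K x -> g x = 0) ->
  \int[leb2]_(x in S) g x = \int[leb2]_(x in (I `*` I : set (RL * RL))) g x.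
Proof.
move=> g0; rewrite [LHS]Rintegral_mkcond [RHS]Rintegral_mkcond.
congr (Rintegral leb2 _ _); apply/funext => x.
have [Kx|nKx] := pselect (K x).
  have Ix : (I `*` I) x.
    by have [x1 x2] := KA Kx; split; rewrite /= in_itv/= -ler_norml ltW.
  by rewrite !patchE (mem_set (KS Kx)) (mem_set Ix).
by rewrite !patchE g0//; do 2 case: ifP.
Qed.

Let integrable_box (g : R * R -> R) : continuous g ->
  leb2.-integrable (I `*` I : set (RL * RL)) (EFin \o g).
Proof.
move=> cg; have [C gC] := continuous_bounded_box A cg.
have mI : measurable (I `*` I : set (RL * RL)).
  by apply: measurableX; exact: measurable_itv.
have AA : - A <= A by rewrite -subr_ge0 opprK addr_ge0// ltW.
have fI : (leb2 (I `*` I : set (RL * RL)) < +oo)%E by rewrite (leb2_rect AA AA) ltry.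
apply: (L2_integrable (m := leb2)) => //; apply: (bdd_L2 (m := leb2) mI fI (C := C)) => //.
  by apply: measurable_funTS; exact: continuous_measurable_plane.
by apply: aeW => -[x y] [] /=; rewrite !in_itv/= => x1 y1; exact: gC.
Qed.

Let outside (x : R * R) : ~ K x ->
  (\forall t \near x.1, f (t, x.2) = 0) /\ (\forall t \near x.2, f (x.1, t) = 0).
Proof.
move=> nKx.
have /nbhs_pairP[e e0 eK] : nbhs x (~` K).
  by apply: open_nbhs_nbhs; split=> //; exact: closed_openC.
split; apply/nbhs_ballP; exists e => //= t xt; apply: f0; apply: eK => //=;
  by rewrite subrr normr0.
Qed.

(** On the box, Fubini with x_2 innermost and the fundamental theorem of calculus leave the values
    of [f] at |x_2| = A, which vanish because [K] stays strictly inside. *)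
Lemma integral_pd2_eq0 : continuous (pd2 f) ->
  (forall x, derivable (fun t => f (t, x.2)) x.1 1) ->
  \int[leb2]_(x in S) pd2 f x = 0.
Proof.
move=> cf df; rewrite support_box; last first.
  by move=> x /outside[nx _]; exact: derive1_near0.
have := Rintegral_setX21 (m1 := leb1) (m2 := leb1) (measurable_itv _) (measurable_itv _)
  (integrable_box cf).
rewrite -/leb2 => ->.
rewrite -[RHS](Rintegral0 leb1 I); apply: eq_Rintegral => y _.
rewrite (ftc_itvcc (F := fun t => f (t, y))).
- have fA t : `|t| = A -> f (t, y) = 0.
    by move=> tA; apply: f0 => /KA[]; rewrite /= tA ltxx.
  by rewrite !fA ?subrr ?normrN ?gtr0_norm.
- by rewrite -subr_ge0 opprK addr_ge0// ltW.
- by move=> x; exact: (df (x, y)).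
- move=> x; apply: (@continuous_comp _ _ _ (fun x => (x, y)) (pd2 f)); last exact: cf.
  exact: continuous_pairl.
Qed.

Lemma integral_pd3_eq0 : continuous (pd3 f) ->
  (forall x, derivable (fun t => f (x.1, t)) x.2 1) ->
  \int[leb2]_(x in S) pd3 f x = 0.
Proof.
move=> cf df; rewrite support_box; last first.
  by move=> x /outside[_ nx]; exact: derive1_near0.
have := Rintegral_setX12 (m1 := leb1) (m2 := leb1) (measurable_itv _) (measurable_itv _)
  (integrable_box cf).
rewrite -/leb2 => ->.
rewrite -[RHS](Rintegral0 leb1 I); apply: eq_Rintegral => x _.
rewrite (ftc_itvcc (F := fun t => f (x, t))).
- have fA t : `|t| = A -> f (x, t) = 0.
    by move=> tA; apply: f0 => /KA[]; rewrite /= tA ltxx.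
  by rewrite !fA ?subrr ?normrN ?gtr0_norm.
- by rewrite -subr_ge0 opprK addr_ge0// ltW.
- by move=> y; exact: (df (x, y)).
- move=> y; apply: (@continuous_comp _ _ _ (fun y => (x, y)) (pd3 f)); last exact: cf.
  exact: continuous_pairr.
Qed.

End divergence.

(** The product rule turns the weak identities into vanishing integrals of derivatives of [q * psi],
    whose support lies in [S]. This is how explicit polynomials enter H^1. *)
Lemma H1S_C1 S (q q2 q3 : R * R -> R) : open S -> bounded_set S ->
  continuous q -> continuous q2 -> continuous q3 ->
  (forall x : R * R, is_derive (x.1 : R) (1 : R) (fun t : R => q (t, x.2)) (q2 x)) ->
  (forall x : R * R, is_derive (x.2 : R) (1 : R) (fun t : R => q (x.1, t)) (q3 x)) ->
  H1S S q q2 q3.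
Proof.
move=> oS bS cq cq2 cq3 dq2 dq3.
have mS := open_measurable_plane oS.
split; try exact: continuous_L2.
move=> psi [Cpsi cpsi psiS].
have [c0 d2 d3 c2 c3] := Cpsi 1%N.
have psi0 x : ~ closure [set x | psi x != 0] x -> psi x = 0.
  by move=> nx; apply: contrapT => /eqP px; apply: nx; exact: subset_closure.
have [A A0 KA] := bounded_plane (compact_bounded cpsi).
have cK : closed (closure [set x | psi x != 0]) by exact: closed_closure.
have iM (g h : R * R -> R) : continuous g -> continuous h ->
    leb2.-integrable S (EFin \o (fun x => g x * h x)).
  by move=> cg ch; apply: (@L2_mul _ _ _ leb2 S mS g h); exact: continuous_L2.
pose f x := q x * psi x.
have f0 x : ~ closure [set x | psi x != 0] x -> f x = 0.
  by move=> /psi0 px; rewrite /f px mulr0.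
have H2 x : is_derive (x.1 : R) (1 : R) (fun t : R => f (t, x.2)) (q x * pd2 psi x + q2 x * psi x).
  have dpsi := derivableP (d2 x); rewrite -derive1E -/(pd2 psi x) in dpsi.
  have := is_deriveM (dq2 x) dpsi; congr is_derive.
  by rewrite /GRing.scale/= -!surjective_pairing (mulrC (psi x)).
have H3 x : is_derive (x.2 : R) (1 : R) (fun t : R => f (x.1, t)) (q x * pd3 psi x + q3 x * psi x).
  have dpsi := derivableP (d3 x); rewrite -derive1E -/(pd3 psi x) in dpsi.
  have := is_deriveM (dq3 x) dpsi; congr is_derive.
  by rewrite /GRing.scale/= -!surjective_pairing (mulrC (psi x)).
have cM (g h : R * R -> R) : continuous g -> continuous h -> continuous (fun x => g x * h x).
  by move=> cg ch x; apply: cvgM; [exact: cg|exact: ch].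
have cD (g h : R * R -> R) : continuous g -> continuous h -> continuous (fun x => g x + h x).
  by move=> cg ch x; apply: cvgD; [exact: cg|exact: ch].
have p2E : pd2 f = fun x => q x * pd2 psi x + q2 x * psi x.
  by apply/funext => x; rewrite /pd2 derive1E; exact: (@derive_val _ _ _ _ _ _ _ (H2 x)).
have p3E : pd3 f = fun x => q x * pd3 psi x + q3 x * psi x.
  by apply/funext => x; rewrite /pd3 derive1E; exact: (@derive_val _ _ _ _ _ _ _ (H3 x)).
split; apply/eqP; rewrite -addr_eq0; apply/eqP.
  rewrite -RintegralD//; try exact: iM.
  rewrite -p2E; apply: (integral_pd2_eq0 A0 cK psiS KA f0).
    by rewrite p2E; apply: cD; exact: cM.
  by move=> x; exact: (@ex_derive _ _ _ _ _ _ _ (H2 x)).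
rewrite -RintegralD//; try exact: iM.
rewrite -p3E; apply: (integral_pd3_eq0 A0 cK psiS KA f0).
  by rewrite p3E; apply: cD; exact: cM.
by move=> x; exact: (@ex_derive _ _ _ _ _ _ _ (H3 x)).
Qed.

Lemma test_fun_L2 S psi : open S -> bounded_set S -> test_fun S psi ->
  [/\ L2 leb2 S psi, L2 leb2 S (pd2 psi) & L2 leb2 S (pd3 psi)].
Proof.
move=> oS bS [/(_ 1%N)[c0 _ _ c2 c3] _ _].
split; [exact: continuous_L2 c0|exact: continuous_L2 c2|exact: continuous_L2 c3].
Qed.

Lemma H1S_comb S (a b : R) (u u2 u3 v v2 v3 : R * R -> R) :
  open S -> bounded_set S -> H1S S u u2 u3 -> H1S S v v2 v3 ->
  H1S S (fun x => a * u x + b * v x) (fun x => a * u2 x + b * v2 x)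
    (fun x => a * u3 x + b * v3 x).
Proof.
move=> oS bS [Lu Lu2 Lu3 Hu] [Lv Lv2 Lv3 Hv].
have mS := open_measurable_plane oS.
split; first exact (L2D mS (L2Z mS a Lu) (L2Z mS b Lv)).
- exact (L2D mS (L2Z mS a Lu2) (L2Z mS b Lv2)).
- exact (L2D mS (L2Z mS a Lu3) (L2Z mS b Lv3)).
move=> psi tpsi; have [L0 L2p L3p] := test_fun_L2 oS bS tpsi.
have [u2E u3E] := Hu _ tpsi; have [v2E v3E] := Hv _ tpsi.
have lin (g h k : R * R -> R) : L2 leb2 S g -> L2 leb2 S h -> L2 leb2 S k ->
    \int[leb2]_(x in S) ((a * g x + b * h x) * k x) =
    a * \int[leb2]_(x in S) (g x * k x) + b * \int[leb2]_(x in S) (h x * k x).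
  move=> Lg Lh Lk; have gk := L2_mul mS Lg Lk; have hk := L2_mul mS Lh Lk.
  rewrite -!RintegralZl// -RintegralD//; try exact: integrableZR.
  by apply: eq_Rintegral => x _; ring.
split.
  rewrite (lin _ _ _ Lu Lv L2p) (lin _ _ _ Lu2 Lv2 L0) u2E v2E.
  by rewrite !mulrN opprD.
rewrite (lin _ _ _ Lu Lv L3p) (lin _ _ _ Lu3 Lv3 L0) u3E v3E.
by rewrite !mulrN opprD.
Qed.

End Sobolev.

(** * Periodic Sobolev functions *)

Section SobolevTorus.
Context (R : realType).
Local Notation RL := (measurableTypeR R).
Implicit Types (f df psi : R -> R).

Lemma continuous_L2_Y f : continuous f -> L2 leb1 Y f.
Proof.
move=> cf; have [C fC] := continuous_bounded_itvcc 0 1 cf.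
apply: (bdd_L2 (m := leb1) (@measurable_Y R) (leb1_Y_fin R) (C := C)).
  by apply: measurable_funTS; exact: continuous_measurable_fun.
by apply: aeW => y; rewrite /Y /= in_itv/= => /andP[y0 y1]; apply: fC; rewrite y0 ltW.
Qed.

Lemma test_per_continuous psi : test_per psi ->
  continuous psi /\ continuous (derive1 psi).
Proof.
move=> [_ dpsi]; split; apply: derivable_continuous.
  exact: (dpsi 0%N).
exact: (dpsi 1%N).
Qed.

Lemma test_per_cst (c : R) : test_per (fun=> c).
Proof.
split=> [x //|n x].
have -> : derive1n n (fun=> c) = (fun=> if n is 0 then c else 0) :> (R -> R).
  elim: n => [//|n IH]; rewrite derive1nS IH; apply/funext => y.
  exact: derive1_cst.
exact: derivable_cst.
Qed.

(** The constant 1 is an admissible test function, because test functions are periodic rather than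
    compactly supported. *)
Lemma H1Y_mean0 f df : H1Y f df -> \int[leb1]_(y in Y) df y = 0.
Proof.
move=> [Lf Ldf /(_ (fun=> 1) (test_per_cst 1))].
have -> : derive1 (fun=> 1 : R) = (fun=> 0 : R).
  by apply/funext => y; exact: derive1_cst.
rewrite (_ : (fun x => f x * 0) = (fun=> 0)); last first.
  by apply/funext => y; rewrite mulr0.
rewrite (_ : (fun x => df x * 1) = df); last by apply/funext => y; rewrite mulr1.
by rewrite Rintegral0 => /esym/eqP; rewrite oppr_eq0 => /eqP.
Qed.

Lemma H1Y_comb (a b : R) f df (g dg : R -> R) : H1Y f df -> H1Y g dg ->
  H1Y (fun y => a * f y + b * g y) (fun y => a * df y + b * dg y).
Proof.
move=> [Lf Ldf Hf] [Lg Ldg Hg]; have mY := @measurable_Y R.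
split; first exact (L2D mY (L2Z mY a Lf) (L2Z mY b Lg)).
  exact (L2D mY (L2Z mY a Ldf) (L2Z mY b Ldg)).
move=> psi tpsi; have [cp cdp] := test_per_continuous tpsi.
have lin (u v k : R -> R) : L2 leb1 Y u -> L2 leb1 Y v -> L2 leb1 Y k ->
    \int[leb1]_(x in Y) ((a * u x + b * v x) * k x) =
    a * \int[leb1]_(x in Y) (u x * k x) + b * \int[leb1]_(x in Y) (v x * k x).
  move=> Lu Lv Lk; have uk := L2_mul mY Lu Lk; have vk := L2_mul mY Lv Lk.
  rewrite -!RintegralZl// -RintegralD//; try exact: integrableZR.
  by apply: eq_Rintegral => x _; ring.
have L0 := continuous_L2_Y cp; have L1 := continuous_L2_Y cdp.
rewrite (lin _ _ _ Lf Lg L1) (lin _ _ _ Ldf Ldg L0) (Hf _ tpsi) (Hg _ tpsi).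
by rewrite !mulrN opprD.
Qed.

Lemma H1Y0 : H1Y (fun=> 0 : R) (fun=> 0).
Proof.
have L0 : L2 leb1 Y (fun=> 0 : R) by apply: L20.
by split=> // psi _; rewrite -[RHS]mulN1r; under eq_Rintegral do rewrite mul0r;
  under [in RHS]eq_Rintegral do rewrite mul0r; rewrite Rintegral0 mulr0.
Qed.

(* Integrating over all of Y makes the measurability of the primitive and the
   integration by parts against a test function instances of Fubini. *)
Definition primitive f (y : R) : R := \int[leb1]_(t in Y) (f t * (t < y)%R%:R).

Section primitive.
Context f (C : R).
Hypotheses (mf : measurable_fun Y f)
  (fC : {ae leb1, forall y : R, Y y -> `|f y| <= C}).

Let mY := @measurable_Y R.

Let measurable_lt : measurable_fun (@setT (RL * RL)) (fun p => (p.1 < p.2)%R%:R : RL).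
Proof.
have -> : (fun p : RL * RL => (p.1 < p.2)%R%:R : RL) = \1_[set p | p.1 < p.2].
  apply/funext => p; rewrite indicE; case: ltP => pp; first by rewrite mem_set.
  by rewrite memNset//= ltNge pp.
apply/measurable_indicP; apply: open_measurable_plane.
rewrite openE => x /= xx; apply/nbhs_pairP.
exists ((x.2 - x.1) / 2) => [|y]; first by rewrite divr_gt0// subr_gt0.
by rewrite !ltr_norml => /andP[? ?] /andP[? ?] /=; lra.
Qed.

(** Applied with [g = 1] to get the measurability of the primitive, and with [g] the derivative of a
    test function to integrate by parts. *)
Let kernel_integrable (g : R -> R) : continuous g ->
  leb2.-integrable (Y `*` Y : set (RL * RL))
    (EFin \o (fun p => f p.1 * (p.1 < p.2)%R%:R * g p.2)).
Proof.
move=> cg; have [D gD] := continuous_bounded_itvcc 0 1 cg.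
have mYY : measurable (Y `*` Y : set (RL * RL)) by exact: measurableX.
have fYY : (leb2 (Y `*` Y : set (RL * RL)) < +oo)%E.
  have -> : leb2 (Y `*` Y : set (RL * RL)) = (leb1 (@Y R) * leb1 (@Y R))%E.
    exact: product_measure1E.
  by rewrite leb1_Y mule1 ltry.
apply: (L2_integrable (m := leb2) mYY fYY).
apply: (bdd_L2 (m := leb2) mYY fYY (C := `|C| * D)).
  apply: measurable_funM; first apply: measurable_funM.
  - exact: measurable_fun_lift1.
  - exact: measurable_funTS.
  - apply: measurable_fun_lift2 => //; apply: measurable_funTS.
    exact: continuous_measurable_fun.
have := ae_lift1 leb1 fC.
apply: filterS => p pC [p1 p2].
rewrite !normrM; apply: ler_pM => //.
  apply: (@le_trans _ _ `|f p.1|); last by rewrite (le_trans (pC p1))// ler_norm.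
  by case: ltP => _; rewrite ?normr1 ?normr0 ?mulr1// mulr0.
by apply: gD; move: p2; rewrite /Y /= in_itv/= => /andP[-> /ltW].
Qed.

Let one_continuous : continuous ((fun=> 1) : R -> R).
Proof. by move=> x; exact: cvg_cst. Qed.

Lemma measurable_primitive : measurable_fun Y (primitive f).
Proof.
have := fubini_integrable2 (m1 := leb1) (m2 := leb1) mY mY (kernel_integrable one_continuous).
move=> /(measurable_int _)/measurable_EFinP.
by congr measurable_fun; apply/funext => y; apply: eq_Rintegral => t _ /=; rewrite mulr1.
Qed.

Let f_integrable : leb1.-integrable Y (EFin \o f).
Proof.
by apply: (L2_integrable (m := leb1) mY (leb1_Y_fin R)); exact: (bdd_L2 mY (leb1_Y_fin R) mf fC).
Qed.

Lemma primitive_bounded : exists D, forall y, `|primitive f y| <= D.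
Proof.
exists (\int[leb1]_(t in Y) `|f t|) => y.
have mlt : measurable_fun Y (fun t : RL => (t < y)%R%:R : RL).
  apply: measurable_funTS; have := measurableT_comp measurable_lt (measurable_pair2 (T1 := RL) y).
  exact.
have fi : leb1.-integrable Y (EFin \o (fun t => f t * (t < y)%R%:R)).
  apply: (integrable_dom (m := leb1) mY (g := fun t => `|f t|)).
  - exact: measurable_funM.
  - exact: (integrable_norm f_integrable).
  - apply: aeW => t _; rewrite normrM.
    by case: ltP => _; rewrite ?normr1 ?normr0 ?mulr1// mulr0.
apply: (le_trans (le_normr_Rintegral mY fi)).
apply: le_Rintegral => //.
- exact: (integrable_norm fi).
- exact: (integrable_norm f_integrable).
- move=> t _; rewrite normrM.
  by case: ltP => _; rewrite ?normr1 ?normr0 ?mulr1// mulr0.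
Qed.

(** Exchanging the integrals turns the left side of the weak identity into the integral of
    [f t * (psi 1 - psi t)]. The term with [psi 1] drops since [f] has mean zero, which is also the
    condition for the primitive not to jump across the period. *)
Lemma H1Y_primitive : \int[leb1]_(y in Y) f y = 0 -> H1Y (primitive f) f.
Proof.
move=> If; have [D pD] := primitive_bounded.
split.
- by apply: (bdd_L2 (m := leb1) mY (leb1_Y_fin R) (C := D) measurable_primitive); exact: aeW.
- exact: (bdd_L2 mY (leb1_Y_fin R) mf fC).
move=> psi tpsi; have [cp cdp] := test_per_continuous tpsi.
have [per dpsi] := tpsi.
have ki := kernel_integrable cdp.
have E21 := Rintegral_setX21 (m1 := leb1) (m2 := leb1) mY mY ki.
have E12 := Rintegral_setX12 (m1 := leb1) (m2 := leb1) mY mY ki.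
refine (etrans _ (etrans (etrans (esym E21) E12) _)).
  have := ae_integrable_slice2 (m1 := leb1) (m2 := leb1) mY mY (kernel_integrable one_continuous).
  move=> H; apply: ae_eq_Rintegral => //.
  - apply: measurable_funM; first exact: measurable_primitive.
    by apply: measurable_funTS; exact: continuous_measurable_fun.
  - have := fubini_integrable2 (m1 := leb1) (m2 := leb1) mY mY ki.
    by move=> /(measurable_int _)/measurable_EFinP.
  - apply: filterS H => y H Yy; rewrite -RintegralZr//.
    by have := H Yy; congr integrable; apply/funext => t /=; rewrite mulr1.
have inner t : Y t -> \int[leb1]_(y in Y) ((t < y)%R%:R * derive1 psi y) = psi 1 - psi t.
  rewrite /Y /= in_itv/= => /andP[t0 t1].
  have -> : \int[leb1]_(y in Y) ((t < y)%R%:R * derive1 psi y) =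
            \int[leb1]_(y in `]t, 1[) derive1 psi y.
    rewrite [LHS]Rintegral_mkcond [RHS]Rintegral_mkcond.
    congr (Rintegral leb1 _ _); apply/funext => y; rewrite !patchE /Y.
    case: ifPn => [|]; rewrite !(inE, notin_setE) /= in_itv/=.
      move=> /andP[y0 y1]; case: ltP => ty; rewrite ?mul1r ?mul0r.
        by rewrite mem_set//= in_itv/= ty y1.
      by rewrite memNset//= in_itv/= => /andP[]; rewrite ltNge ty.
    move=> ny; rewrite memNset//= in_itv/= => /andP[ty y1]; apply: ny.
    by rewrite y1 andbT (le_trans t0)// ltW.
  have i1 : leb1.-integrable `[t, 1]%classic (EFin \o derive1 psi).
    apply: continuous_compact_integrable; first exact: segment_compact.
    exact: continuous_subspaceT.
  rewrite -(ftc_itvcc (ltW t1) (dpsi 0%N) cdp).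
  rewrite -(Rintegral_itv_obnd_cbnd (r := t)); last first.
    by apply: integrableS i1 => //; exact: subset_itv_oc_cc.
  rewrite -(Rintegral_itv_bndo_bndc (r := 1))//.
  by apply: integrableS i1 => //; exact: subset_itv_oo_cc.
have p10 : psi 1 = psi 0 by rewrite -[1]add0r per.
transitivity (\int[leb1]_(t in Y) (f t * psi 1 - f t * psi t)).
  apply: eq_Rintegral => t; rewrite inE => Yt /=; rewrite -mulrBr -inner//.
  rewrite -RintegralZl//; first by apply: eq_Rintegral => y _; rewrite mulrA.
  apply: (L2_integrable (m := leb1) mY (leb1_Y_fin R)).
  apply: (@L2_bddM _ _ _ leb1 Y mY (fun y => (t < y)%R%:R) (derive1 psi) 1).
  + apply: measurable_funTS.
    by have := measurableT_comp measurable_lt (measurable_pair1 (T2 := RL) t); exact.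
  + by apply: aeW => y _; case: ltP; rewrite ?normr1 ?normr0.
  + exact: continuous_L2_Y.
have Lf : L2 leb1 Y f by exact: (bdd_L2 mY (leb1_Y_fin R) mf fC).
have fp := L2_mul mY Lf (continuous_L2_Y cp).
rewrite RintegralB//; last first.
  exact (L2_mul mY Lf (L2_cst mY (leb1_Y_fin R) (psi 1))).
by rewrite RintegralZr// If mul0r sub0r.
Qed.

End primitive.
End SobolevTorus.

(** * Bump functions and the torsion problem *)

Section SmoothFunctions.
Context (R : realType).
Implicit Types (f g : R -> R) (P : {poly R}).

Fixpoint smooth n f : Prop :=
  if n is n'.+1 then (forall x, derivable f x 1) /\ smooth n' (derive1 f) else True.

Lemma smoothW n f : smooth n.+1 f -> smooth n f.
Proof. by elim: n f => [//|n IH] f [df /IH]. Qed.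

Lemma derive1_is_derive f df : (forall x, is_derive x (1 : R) f (df x)) ->
  (forall x, derivable f x 1) /\ derive1 f = df.
Proof.
move=> H; split=> [x|]; first exact: (@ex_derive _ _ _ _ _ _ _ (H x)).
by apply/funext => x; rewrite derive1E; exact: (@derive_val _ _ _ _ _ _ _ (H x)).
Qed.

Lemma derivable_is_derive f x : derivable f x 1 -> is_derive x (1 : R) f (derive1 f x).
Proof. by move=> /derivableP; rewrite -derive1E. Qed.

Lemma smooth_cst n (c : R) : smooth n (fun=> c).
Proof.
elim: n c => [//|n IH] c /=; split=> [x|]; first exact: derivable_cst.
by have [_ ->] := derive1_is_derive (fun x => is_derive_cst c x 1); exact: IH.
Qed.

Lemma smoothD n f g : smooth n f -> smooth n g -> smooth n (fun x => f x + g x).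
Proof.
elim: n f g => [//|n IH] f g /= [df sf] [dg sg].
have [dfg ->] : (forall x, derivable (fun x => f x + g x) x 1) /\
    derive1 (fun x => f x + g x) = fun x => derive1 f x + derive1 g x.
  apply: derive1_is_derive => x.
  exact (is_deriveD (derivable_is_derive (df x)) (derivable_is_derive (dg x))).
by split=> //; exact: IH.
Qed.

Lemma smoothM n f g : smooth n f -> smooth n g -> smooth n (fun x => f x * g x).
Proof.
elim: n f g => [//|n IH] f g fn gn.
have [df sf] := fn; have [dg sg] := gn.
have [dfg /= ->] : (forall x, derivable (fun x => f x * g x) x 1) /\
    derive1 (fun x => f x * g x) = fun x => f x * derive1 g x + g x * derive1 f x.
  apply: derive1_is_derive => x.
  exact (is_deriveM (derivable_is_derive (df x)) (derivable_is_derive (dg x))).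
by split=> //; apply: smoothD; apply: IH => //; exact: smoothW.
Qed.

Lemma smooth_affine n f (a b : R) : smooth n f -> smooth n (fun x => f (a * x + b)).
Proof.
elim: n f => [//|n IH] f [df sf] /=.
have [dfa ->] : (forall x, derivable (fun x => f (a * x + b)) x 1) /\
    derive1 (fun x => f (a * x + b)) = fun x => derive1 f (a * x + b) * a.
  apply: derive1_is_derive => x.
  apply: (@is_derive1_comp _ f (fun x => a * x + b)); first exact: derivable_is_derive.
  have := is_deriveD (is_deriveZ a (is_derive_id x (1 : R))) (is_derive_cst b x (1 : R)).
  by rewrite addr0; congr is_derive; rewrite /GRing.scale/= mulr1.
by split=> //; apply: smoothM; [exact: IH|exact: smooth_cst].
Qed.

Lemma continuous_tensor f g : continuous f -> continuous g ->
  continuous (fun x : R * R => f x.1 * g x.2).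
Proof.
move=> cf cg x; apply: cvgM.
  by apply: (@cvg_comp _ _ _ fst f _ (nbhs x.1)); [exact: cvg_fst|exact: cf].
by apply: (@cvg_comp _ _ _ snd g _ (nbhs x.2)); [exact: cvg_snd|exact: cg].
Qed.

Lemma smooth_tensor_Ck k f g : (forall n, smooth n f) -> (forall n, smooth n g) ->
  Ck k (fun x => f x.1 * g x.2).
Proof.
have cfg f' g' (sf' : forall n, smooth n f') (sg' : forall n, smooth n g') :=
  continuous_tensor (derivable_continuous (sf' 1%N).1)
    (derivable_continuous (sg' 1%N).1).
elim: k f g => [|k IH] f g sf sg; first exact: cfg.
have d2 (x : R * R) : is_derive (x.1 : R) (1 : R) (fun t => f t * g x.2) (derive1 f x.1 * g x.2).
  have := is_deriveM (derivable_is_derive ((sf 1%N).1 x.1)) (is_derive_cst (g x.2) x.1 (1 : R)).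
  by rewrite scaler0 add0r; congr is_derive; rewrite /GRing.scale/= mulrC.
have d3 (x : R * R) : is_derive (x.2 : R) (1 : R) (fun t => f x.1 * g t) (f x.1 * derive1 g x.2).
  exact (is_deriveZ (f x.1) (derivable_is_derive ((sg 1%N).1 x.2))).
split.
- exact: cfg.
- by move=> x; exact: (@ex_derive _ _ _ _ _ _ _ (d2 x)).
- by move=> x; exact: (@ex_derive _ _ _ _ _ _ _ (d3 x)).
- have -> : pd2 (fun x : R * R => f x.1 * g x.2) = fun x => derive1 f x.1 * g x.2.
    by apply/funext => x; rewrite /pd2 derive1E; exact: (@derive_val _ _ _ _ _ _ _ (d2 x)).
  by apply: IH => // n; exact: (sf n.+1).2.
- have -> : pd3 (fun x : R * R => f x.1 * g x.2) = fun x => f x.1 * derive1 g x.2.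
    by apply/funext => x; rewrite /pd3 derive1E; exact: (@derive_val _ _ _ _ _ _ _ (d3 x)).
  by apply: IH => // n; exact: (sg n.+1).2.
Qed.

(** The classical function exp(-1/t), extended by zero, with a polynomial factor in 1/t. The factor
    makes the family stable under differentiation, so smoothness becomes an induction over all
    [P]. *)
Definition flat P (t : R) : R := if 0 < t then P.[t^-1] * expR (- t^-1) else 0.

(** Each monomial satisfies s^n <= n! exp(s), being n! times a term of the exponential series. *)
Lemma poly_le_expR P : exists C, forall s, 0 <= s -> `|P.[s]| <= C * expR s.
Proof.
exists (\sum_(i < size P) `|P`_i| * i`!%:R) => s s0.
rewrite horner_coef mulr_suml; apply: (le_trans (ler_norm_sum _ _ _)).
apply: ler_sum => i _; rewrite normrM -mulrA; apply: ler_wpM2l => //.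
rewrite normrX (ger0_norm s0).
case: (nat_of_ord i) => [|n].
  by rewrite expr0 fact0 mul1r -expR0 ler_expR.
rewrite mulrC -ler_pdivrMr ?ltr0n ?fact_gt0//.
by apply: le_trans (expR_ge1Dxn n s0); rewrite lerDr.
Qed.

Lemma flat_le_sqr P : exists C, forall t, `|flat P t| <= C * `|t| ^+ 2.
Proof.
(* The factor ['X^2] evaluated at 1/t produces the [t ^+ 2] of the bound; the maximum with 0 covers
   [t <= 0], where [flat] vanishes. *)
have [C PC] := poly_le_expR (P * 'X^2); exists (Num.max C 0) => t.
rewrite /flat; case: ifPn => [t0|_]; last first.
  by rewrite normr0 mulr_ge0// ?le_max ?lexx ?orbT// sqr_ge0.
have ti0 : 0 <= t^-1 by rewrite invr_ge0 ltW.
have := PC _ ti0; rewrite hornerM hornerXn normrM normrX (ger0_norm ti0) => H.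
rewrite normrM (ger0_norm (expR_ge0 _)) (gtr0_norm t0).
rewrite expRN ler_pdivrMr ?expR_gt0//.
have -> : `|P.[t^-1]| = `|P.[t^-1]| * t^-1 ^+ 2 * t ^+ 2.
  by rewrite -mulrA -exprMn mulVf ?gt_eqF// expr1n mulr1.
rewrite [leRHS]mulrAC; apply: ler_wpM2r; first exact: sqr_ge0.
apply: (le_trans H); apply: ler_wpM2r; first exact: expR_ge0.
by rewrite le_max lexx.
Qed.

(** For t > 0 the chain rule brings out a factor t^-2 from both 1/t and -1/t, with opposite signs;
    this gives the polynomial X^2 (P - P'). *)
Lemma is_derive_flat P t :
  is_derive t (1 : R) (flat P) (flat ('X^2 * (P - P^`())) t).
Proof.
have [t0|t0|->] := ltgtP t 0.
- have -> : flat ('X^2 * (P - P^`())) t = 0 by rewrite /flat ltNge (ltW t0).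
  apply: (near_eq_is_derive _ (is_derive_cst (0 : R) t (1 : R))).
  near=> x; rewrite /flat; case: ifPn => // x0.
  have : x < 0 by near: x; exact: lt_nbhsl.
  by rewrite ltNge (ltW x0).
- have -> : flat ('X^2 * (P - P^`())) t = ('X^2 * (P - P^`())).[t^-1] * expR (- t^-1).
    by rewrite /flat t0.
  have dV : is_derive t (1 : R) (fun x : R => x^-1) (- t ^- 2).
    have := is_deriveV (lt0r_neq0 t0) (is_derive_id t (1 : R)).
    by congr is_derive; rewrite /GRing.scale/= mulr1.
  have dP := is_derive1_comp (is_derive_poly P t^-1) dV.
  have dE := @is_derive1_comp _ expR (fun x => - x^-1) _ _ _ (is_derive_expR (- t^-1)) (is_deriveN dV).
  have := is_deriveM dP dE.
  move=> H.
  have E : \forall x \near t, P.[x^-1] * expR (- x^-1) = flat P x.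
    near=> x; rewrite /flat ifT//; near: x; exact: lt_nbhsr.
  apply: (near_eq_is_derive E); move: H; congr is_derive; rewrite /GRing.scale/= hornerM hornerXn hornerD hornerN.
  by rewrite -!exprVn; ring.
- have fP0 : flat P 0 = 0 by rewrite /flat ltxx.
  have -> : flat ('X^2 * (P - P^`())) 0 = 0 by rewrite /flat ltxx.
  (* At 0 the quadratic bound makes the difference quotient at most C |h|. *)
  have [C PC] := flat_le_sqr P.
  have cv : (h^-1 *: ((flat P \o shift 0) (h *: (1 : R)) - flat P 0)) @[h --> 0^'] --> (0 : R).
    apply: (cvg_to_0_linear (K := C) (k := 1)) => // h /andP[h0 _].
    rewrite /= fP0 subr0 addr0 /GRing.scale/= mulr1 normrM normfV.
    rewrite mulrC ler_pdivrMr//; apply: (le_trans (PC h)).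
    by rewrite expr2 mulrA.
  apply: DeriveDef; first by apply/cvg_ex; exists 0.
  exact/cvg_lim.
Unshelve. all: by end_near. Qed.

Lemma smooth_flat n P : smooth n (flat P).
Proof.
elim: n P => [//|n IH] P /=.
by have [dP ->] := derive1_is_derive (is_derive_flat P).
Qed.

Definition bump (l r t : R) : R := flat 1 (t - l) * flat 1 (r - t).

Lemma smooth_bump n l r : smooth n (bump l r).
Proof.
have s1 := smooth_affine 1 (- l) (smooth_flat n 1).
have s2 := smooth_affine (-1) r (smooth_flat n 1).
have := smoothM s1 s2; congr smooth; apply/funext => t.
by rewrite /bump mul1r mulN1r [- t + r]addrC.
Qed.

Lemma flat1_ge0 t : 0 <= flat 1 t.
Proof. by rewrite /flat; case: ifP => // _; rewrite hornerC mul1r expR_ge0. Qed.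

Lemma bump_ge0 l r t : 0 <= bump l r t.
Proof. by rewrite mulr_ge0// flat1_ge0. Qed.

Lemma bump_gt0 l r t : l < t < r -> 0 < bump l r t.
Proof.
move=> /andP[lt tr]; rewrite /bump /flat !subr_gt0 lt tr !hornerC !mul1r.
by rewrite mulr_gt0// expR_gt0.
Qed.

Lemma bump_support l r t : bump l r t != 0 -> l < t < r.
Proof.
rewrite /bump /flat !subr_gt0; case: ifP => lt; last by rewrite mul0r eqxx.
by case: ifP => // tr; rewrite mulr0 eqxx.
Qed.

Lemma closed_box (l1 r1 l2 r2 : R) :
  closed (`[l1, r1]%classic `*` `[l2, r2]%classic : set (R * R)).
Proof.
have -> : (`[l1, r1]%classic `*` `[l2, r2]%classic : set (R * R)) =
    (fst @^-1` `[l1, r1]%classic) `&` (snd @^-1` `[l2, r2]%classic) by [].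
apply: closedI; apply: closed_comp; do ?[exact: itv_closed].
- by move=> x _; exact: cvg_fst.
- by move=> x _; exact: cvg_snd.
Qed.

Lemma test_fun_bump (S : set (R * R)) (l1 r1 l2 r2 : R) :
  (`[l1, r1]%classic `*` `[l2, r2]%classic `<=` S) ->
  test_fun S (fun x => bump l1 r1 x.1 * bump l2 r2 x.2).
Proof.
move=> IS.
have suppI : closure [set x : R * R | bump l1 r1 x.1 * bump l2 r2 x.2 != 0] `<=`
    `[l1, r1]%classic `*` `[l2, r2]%classic.
  rewrite [X in _ `<=` X](closure_id _).1; last exact: closed_box.
  apply: closureS => x /=; rewrite mulf_eq0 negb_or.
  move=> /andP[/bump_support/andP[? ?] /bump_support/andP[? ?]].
  by split; rewrite /= in_itv/= !ltW.
split=> [k||].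
- by apply: smooth_tensor_Ck => n; exact: smooth_bump.
- apply: (subclosed_compact (B := `[l1, r1]%classic `*` `[l2, r2]%classic)).
  + exact: closed_closure.
  + by apply: compact_setX; exact: segment_compact.
  + exact: suppI.
- exact: subset_trans suppI IS.
Qed.

End SmoothFunctions.

(** * Euler-Lagrange equation and positivity of the torsion minimum *)

Section Torsion.
Context (R : realType) (S : set (R * R)).
Hypotheses (oS : open S) (bS : bounded_set S).
Local Notation RL := (measurableTypeR R).

Let mS := open_measurable_plane oS.

Lemma continuous_fst : continuous (fun x : R * R => x.1).
Proof. by move=> x; exact: cvg_fst. Qed.

Lemma continuous_snd : continuous (fun x : R * R => x.2).
Proof. by move=> x; exact: cvg_snd. Qed.

Lemma L2_fst : L2 leb2 S (fun x => x.1).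
Proof. exact (continuous_L2 oS bS continuous_fst). Qed.

Lemma L2_snd : L2 leb2 S (fun x => x.2).
Proof. exact (continuous_L2 oS bS continuous_snd). Qed.

(** By continuity [f] is positive on a nonempty open subset of [S], which has positive measure; a
    vanishing integral would make that subset null. *)
Lemma integral_gt0 (f : R * R -> R) : continuous f -> (forall x, S x -> 0 <= f x) ->
  (exists2 x, S x & 0 < f x) -> 0 < \int[leb2]_(x in S) f x.
Proof.
move=> cf f0 [p Sp fp].
have fi := L2_integrable (m := leb2) mS (leb2_bounded_fin oS bS) (continuous_L2 oS bS cf).
rewrite lt0r Rintegral_ge0 ?andbT//; apply/eqP => If.
have f0ae : {ae leb2, forall x, S x -> 0 <= f x} by exact: aeW.
have := Rintegral_ge0_eq0 (m := leb2) mS fi f0ae If.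
pose U := S `&` f @^-1` [set t | 0 < t].
have oU : open U by apply: openI => //; move/continuousP: cf; apply; exact: open_gt.
have mU := open_measurable_plane oU.
move=> H; have : leb2.-negligible U.
  by apply: negligibleS H => x [Sx fx] /(_ Sx) fx0; move: fx; rewrite /= fx0 ltxx.
move=> /(measure_negligible mU) U0.
by have := leb2_open_gt0 oU (ex_intro _ p (conj Sp fp)); rewrite U0 ltxx.
Qed.

(** Along a line the energy is a parabola in [t], whose linear coefficient is the first variation.
    The factors 1 match the shape produced by [H1S_comb]. *)
Lemma torsion_energy_expand (v2 v3 u2 u3 : R * R -> R) (t : R) :
  L2 leb2 S v2 -> L2 leb2 S v3 -> L2 leb2 S u2 -> L2 leb2 S u3 ->
  torsion_energy S (fun x => 1 * v2 x + t * u2 x) (fun x => 1 * v3 x + t * u3 x) =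
  torsion_energy S v2 v3 +
  2 * t * \int[leb2]_(x in S) ((v2 x - x.2) * u2 x + (v3 x + x.1) * u3 x) +
  t ^+ 2 * \int[leb2]_(x in S) (u2 x ^+ 2 + u3 x ^+ 2).
Proof.
move=> Lv2 Lv3 Lu2 Lu3.
have La : L2 leb2 S (fun x => v2 x - x.2) by exact (L2B mS Lv2 L2_snd).
have Lb : L2 leb2 S (fun x => v3 x + x.1) by exact (L2D mS Lv3 L2_fst).
have i1 : leb2.-integrable S (EFin \o (fun x => (v2 x - x.2) ^+ 2 + (v3 x + x.1) ^+ 2)).
  exact (integrableDR mS (L2_sq_integrable La) (L2_sq_integrable Lb)).
have i2 : leb2.-integrable S (EFin \o (fun x => (v2 x - x.2) * u2 x + (v3 x + x.1) * u3 x)).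
  exact (integrableDR mS (L2_mul mS La Lu2) (L2_mul mS Lb Lu3)).
have i3 : leb2.-integrable S (EFin \o (fun x => u2 x ^+ 2 + u3 x ^+ 2)).
  exact (integrableDR mS (L2_sq_integrable Lu2) (L2_sq_integrable Lu3)).
have j2 := integrableZR mS (2 * t) i2.
have j3 := integrableZR mS (t ^+ 2) i3.
rewrite -(RintegralZl (2 * t) mS i2) -(RintegralZl (t ^+ 2) mS i3).
rewrite /torsion_energy -(RintegralD mS i1 j2) -(RintegralD mS (integrableDR mS i1 j2) j3).
by apply: eq_Rintegral => x _; ring.
Qed.

Lemma torsion_euler_lagrange phi phi2 phi3 : torsion_function S phi phi2 phi3 ->
  forall v v2 v3, H1S S v v2 v3 ->
  \int[leb2]_(x in S) ((phi2 x - x.2) * v2 x + (phi3 x + x.1) * v3 x) = 0.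
Proof.
move=> [Hphi _ phi_min] v v2 v3 Hv.
have [_ L2phi L3phi _] := Hphi; have [_ L2v L3v _] := Hv.
set L := Rintegral _ _ _; set E := torsion_energy S phi2 phi3.
pose N := \int[leb2]_(x in S) (v2 x ^+ 2 + v3 x ^+ 2).
have N0 : 0 <= N by apply: Rintegral_ge0 => x _; rewrite addr_ge0// sqr_ge0.
have H t : 0 <= 2 * t * L + t ^+ 2 * N.
  have := phi_min _ _ _ (H1S_comb 1 t oS bS Hphi Hv).
  rewrite (torsion_energy_expand t L2phi L3phi L2v L3v) -/L -/E -/N.
  by move: L E N {N0} => L E N; lra.
move: L N N0 H => {E} L N N0 H.
(* The parabola 2 t L + t^2 N is smallest at -L / N; the added 1 covers N = 0 and still gives a
   negative value unless L = 0. *)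
have {H} := H (- L / (N + 1)).
have N1 : 0 < N + 1 by lra.
have -> : 2 * (- L / (N + 1)) * L + (- L / (N + 1)) ^+ 2 * N =
          - (L ^+ 2 * ((N + 2) / (N + 1) ^+ 2)) by field; lra.
rewrite oppr_ge0 => H; apply/eqP; rewrite -sqrf_eq0 eq_le sqr_ge0 andbT.
by move: H; rewrite pmulr_lle0// divr_gt0 ?exprn_gt0//; lra.
Qed.

Lemma tauSE phi phi2 phi3 : torsion_function S phi phi2 phi3 ->
  tauS S = torsion_energy S phi2 phi3.
Proof.
move=> [Hphi _ phi_min]; apply/eqP; rewrite eq_le; apply/andP; split.
  apply: ge_inf; last by exists phi, phi2, phi3.
  by exists (torsion_energy S phi2 phi3) => _ [v [v2 [v3 [Hv ->]]]]; exact: phi_min Hv.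
apply: lb_le_inf; first by exists (torsion_energy S phi2 phi3), phi, phi2, phi3.
by move=> _ [v [v2 [v3 [Hv ->]]]]; exact: phi_min Hv.
Qed.

Lemma H1S_fst : H1S S (fun x => x.1) (fun=> 1) (fun=> 0).
Proof.
apply: (H1S_C1 oS bS continuous_fst (fun x => cvg_cst _) (fun x => cvg_cst _)) => x.
exact (is_derive_cst x.1 x.2 (1 : R)).
Qed.

Lemma H1S_snd : H1S S (fun x => x.2) (fun=> 0) (fun=> 1).
Proof.
apply: (H1S_C1 oS bS continuous_snd (fun x => cvg_cst _) (fun x => cvg_cst _)) => x.
exact (is_derive_cst x.2 x.1 (1 : R)).
Qed.

(** Allows a weak gradient to be tested with derivatives of a test function, as the argument on
    mixed second derivatives requires. *)
Lemma test_fun_pd psi : test_fun S psi -> test_fun S (pd2 psi) /\ test_fun S (pd3 psi).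
Proof.
move=> [Cpsi cpsi psiS].
have out x : ~ closure [set x | psi x != 0] x -> pd2 psi x = 0 /\ pd3 psi x = 0.
  move=> nx; have /nbhs_pairP[e e0 eK] : nbhs x (~` closure [set x | psi x != 0]).
    by apply: open_nbhs_nbhs; split=> //; apply: closed_openC; exact: closed_closure.
  have psi0 y : (~` closure [set x | psi x != 0]) y -> psi y = 0.
    by move=> ny; apply: contrapT => /eqP py; apply: ny; exact: subset_closure.
  split; apply: derive1_near0; apply/nbhs_ballP; exists e => //= t xt;
    by apply: psi0; apply: eK => //=; rewrite subrr normr0.
have sub (g : R * R -> R) : (forall x, ~ closure [set x | psi x != 0] x -> g x = 0) ->
    closure [set x | g x != 0] `<=` closure [set x | psi x != 0].
  move=> g0; rewrite [X in _ `<=` X](closure_id _).1; last exact: closed_closure.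
  apply: closureS => x /= gx; apply: contrapT => /g0 gx0.
  by move: gx; rewrite gx0 eqxx.
split; split.
- by move=> k; have [] := Cpsi k.+1.
- apply: (subclosed_compact _ cpsi); first exact: closed_closure.
  by apply: sub => x /out[].
- by apply: subset_trans psiS; apply: sub => x /out[].
- by move=> k; have [] := Cpsi k.+1.
- apply: (subclosed_compact _ cpsi); first exact: closed_closure.
  by apply: sub => x /out[].
- by apply: subset_trans psiS; apply: sub => x /out[].
Qed.

(** A product a(x_2) b(x_3) of two bumps inside a box around a point of [S]; both of its mixed
    derivatives compute to a'(x_2) b'(x_3). *)
Lemma test_fun_exists : S !=set0 -> exists psi,
  [/\ test_fun S psi, pd2 (pd3 psi) = pd3 (pd2 psi) & 0 < \int[leb2]_(x in S) psi x].
Proof.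
move=> [p Sp].
have [e e0 eS] := (nbhs_pairP S p).1 (open_nbhs_nbhs (conj oS Sp)).
pose a := bump (p.1 - e / 2) (p.1 + e / 2); pose b := bump (p.2 - e / 2) (p.2 + e / 2).
have da := derivable_is_derive ((smooth_bump 1 (p.1 - e / 2) (p.1 + e / 2)).1 _).
have db := derivable_is_derive ((smooth_bump 1 (p.2 - e / 2) (p.2 + e / 2)).1 _).
have tpsi : test_fun S (fun x => a x.1 * b x.2).
  apply: test_fun_bump => x [] /=; rewrite !in_itv/= => /andP[? ?] /andP[? ?].
  by apply: eS; rewrite ltr_norml; apply/andP; split; lra.
exists (fun x => a x.1 * b x.2); split; first exact tpsi.
- have p2 (g : R -> R) : pd2 (fun x => a x.1 * g x.2) = fun x => derive1 a x.1 * g x.2.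
    apply/funext => x; rewrite /pd2 derive1E; apply: (@derive_val _ _ _ _ _ _ _ _).
    have := is_deriveM (da x.1) (is_derive_cst (g x.2) x.1 (1 : R)).
    by rewrite scaler0 add0r; congr is_derive; rewrite /GRing.scale/= mulrC.
  have p3 (g : R -> R) : pd3 (fun x => g x.1 * b x.2) = fun x => g x.1 * derive1 b x.2.
    apply/funext => x; rewrite /pd3 derive1E; apply: (@derive_val _ _ _ _ _ _ _ _).
    exact (is_deriveZ (g x.1) (db x.2)).
  by rewrite p3 p2 p2 p3.
- apply: integral_gt0; first by have [/(_ 0%N)] := tpsi.
    by move=> x _; rewrite mulr_ge0// bump_ge0.
  by exists p => //; rewrite mulr_gt0// bump_gt0//; apply/andP; split; lra.
Qed.

(* A potential with gradient (x_3, -x_2) would contradict the symmetry of the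
   mixed second derivatives. *)
Lemma not_H1S_rotation phi phi2 phi3 : S !=set0 -> H1S S phi phi2 phi3 ->
  ~ {ae leb2, forall x, S x -> phi2 x = x.2 /\ phi3 x = - x.1}.
Proof.
move=> S0 [Lphi Lphi2 Lphi3 Hphi] rot.
have [psi [tpsi psi23 psi_gt0]] := test_fun_exists S0.
have [t2 t3] := test_fun_pd tpsi.
have [L0 L2p L3p] := test_fun_L2 oS bS tpsi.
have [_ _ _ /(_ _ tpsi)[x2E _]] := H1S_fst.
have [_ _ _ /(_ _ tpsi)[_ x3E]] := H1S_snd.
(* Testing with [pd3 psi] and [pd2 psi] equates the integrals of [phi3 * pd2 psi] and
   [phi2 * pd3 psi]; for the rotation field these are [I] and [- I]. *)
have [E3 _] := Hphi _ t3; have [_ E2] := Hphi _ t2.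
rewrite psi23 E2 in E3; move: E3.
set I := Rintegral _ _ _ in psi_gt0.
have -> : \int[leb2]_(x in S) (phi3 x * pd2 psi x) = I.
  transitivity (- \int[leb2]_(x in S) (x.1 * pd2 psi x)).
    rewrite -mulN1r -(RintegralZl (-1) mS (L2_mul mS L2_fst L2p)).
    apply: (ae_eq_Rintegral (m := leb2) mS).
    - exact: (measurable_funM Lphi3.1 L2p.1).
    - by apply: measurable_funM; [exact: measurable_cst|exact: (measurable_funM L2_fst.1 L2p.1)].
    - by apply: (ae_mono (m := leb2) _ rot) => x rx Sx; have [_ r3] := rx Sx; rewrite r3 mulN1r mulNr.
  by rewrite x2E opprK /I; apply: eq_Rintegral => x _; rewrite mul1r.
have -> : \int[leb2]_(x in S) (phi2 x * pd3 psi x) = - I.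
  transitivity (\int[leb2]_(x in S) (x.2 * pd3 psi x)).
    apply: (ae_eq_Rintegral (m := leb2) mS).
    - exact: (measurable_funM Lphi2.1 L3p.1).
    - exact: (measurable_funM L2_snd.1 L3p.1).
    - by apply: (ae_mono (m := leb2) _ rot) => x rx Sx; have [r2 _] := rx Sx; rewrite r2.
  by rewrite x3E; congr (- _); apply: eq_Rintegral => x _; rewrite mul1r.
by rewrite opprK => /eqP; rewrite eqNr => /eqP I0; rewrite I0 ltxx in psi_gt0.
Qed.

(** Zero energy would force the gradient of [phi] to be the rotation field (x_3, -x_2). Positivity
    makes the last diagonal entry of the averaging matrix invertible. *)
Lemma tauS_gt0 phi phi2 phi3 : S !=set0 -> torsion_function S phi phi2 phi3 ->
  0 < tauS S.
Proof.
move=> S0 tphi; have [Hphi _ _] := tphi; rewrite (tauSE tphi).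
have [_ Lphi2 Lphi3 _] := Hphi.
have La : L2 leb2 S (fun x => phi2 x - x.2) by exact (L2B mS Lphi2 L2_snd).
have Lb : L2 leb2 S (fun x => phi3 x + x.1) by exact (L2D mS Lphi3 L2_fst).
have sq0 x : 0 <= (phi2 x - x.2) ^+ 2 + (phi3 x + x.1) ^+ 2.
  by rewrite addr_ge0// sqr_ge0.
have i1 := integrableDR mS (L2_sq_integrable La) (L2_sq_integrable Lb).
rewrite lt0r Rintegral_ge0 ?andbT => [|x _]; last exact: sq0.
apply/eqP => E0; apply: (not_H1S_rotation S0 Hphi).
have sq0ae : {ae leb2, forall x, S x -> 0 <= (phi2 x - x.2) ^+ 2 + (phi3 x + x.1) ^+ 2}.
  by apply: aeW => x _; exact: sq0.
have := Rintegral_ge0_eq0 (m := leb2) mS i1 sq0ae E0.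
apply: (ae_mono (m := leb2)) => x H /H/eqP; rewrite paddr_eq0 ?sqr_ge0// !sqrf_eq0.
by rewrite subr_eq0 addr_eq0 => /andP[/eqP -> /eqP ->].
Qed.

End Torsion.

(** * Effective moduli *)

Section BoundedCoefficients.
Context (R : realType).
Local Notation RL := (measurableTypeR R).
Implicit Types (f g : R -> R).

Let mY := @measurable_Y R.
Let fY := leb1_Y_fin R.

(** Inversion is continuous off 0, and the remaining point is a measurable singleton. *)
Lemma measurable_inv : measurable_fun setT (GRing.inv : RL -> RL).
Proof.
have -> : setT = [set~ (0 : R)] `|` [set 0] by rewrite setUC setUv.
have o0 : open [set~ (0 : R)] by apply: closed_openC; exact: closed_eq.
apply/measurable_funU; first exact: open_measurable.
- exact: measurable_set1.
split; last exact: measurable_fun_set1.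
apply: open_continuous_measurable_fun => // x; rewrite inE /= => /eqP x0.
exact: inv_continuous.
Qed.

(** Essential boundedness with an explicit constant instead of [ess_sup], which makes stability
    under sums, products and reciprocals immediate. *)
Definition bddY f := measurable_fun Y f /\
  exists C : R, {ae leb1, forall y, Y y -> `|f y| <= C}.

Lemma bddY_cst (c : R) : bddY (fun=> c).
Proof. by split; [exact: measurable_cst|exists `|c|; exact: aeW]. Qed.

Lemma bddYD f g : bddY f -> bddY g -> bddY (fun y => f y + g y).
Proof.
move=> [mf [C fC]] [mg [D gD]]; split; first exact: measurable_funD.
exists (C + D); apply: (ae_mono2 (m := leb1) _ fC gD) => y fy gy Yy.
by rewrite (le_trans (ler_normD _ _))// lerD ?fy ?gy.
Qed.

Lemma bddYM f g : bddY f -> bddY g -> bddY (fun y => f y * g y).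
Proof.
move=> [mf [C fC]] [mg [D gD]]; split; first exact: measurable_funM.
exists (C * D); apply: (ae_mono2 (m := leb1) _ fC gD) => y fy gy Yy.
by rewrite normrM ler_pM ?fy ?gy.
Qed.

Lemma bddYN f : bddY f -> bddY (fun y => - f y).
Proof.
move=> fb; have := bddYM (bddY_cst (-1)) fb.
by under eq_fun do rewrite mulN1r.
Qed.

Lemma bddYB f g : bddY f -> bddY g -> bddY (fun y => f y - g y).
Proof. by move=> fb gb; exact: bddYD fb (bddYN gb). Qed.

Lemma bddYV f (c : R) : 0 < c -> bddY f -> {ae leb1, forall y, Y y -> c <= f y} ->
  bddY (fun y => (f y)^-1).
Proof.
move=> c0 [mf _] fc; split; first exact: (measurableT_comp measurable_inv).
exists c^-1; apply: (ae_mono (m := leb1) _ fc) => y fy Yy.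
have fy0 : 0 < f y by rewrite (lt_le_trans c0)// fy.
by rewrite gtr0_norm ?invr_gt0// lef_pV2 ?posrE ?fy.
Qed.

Lemma bddY_L2 f : bddY f -> L2 leb1 Y f.
Proof. by move=> [mf [C fC]]; exact: (bdd_L2 mY fY mf fC). Qed.

Lemma bddY_integrable f : bddY f -> leb1.-integrable Y (EFin \o f).
Proof. by move=> fb; exact: (L2_integrable (m := leb1) mY fY (bddY_L2 fb)). Qed.

Lemma avg_cst (c : R) : avg (fun=> c) = c.
Proof.
transitivity (c * fine (leb1 (@Y R))); last by rewrite leb1_Y mulr1.
exact: (Rintegral_cst leb1 mY c).
Qed.

Lemma avgD f g : bddY f -> bddY g -> avg (fun y => f y + g y) = avg f + avg g.
Proof. by move=> fb gb; apply: RintegralD => //; exact: bddY_integrable. Qed.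

Lemma avgB f g : bddY f -> bddY g -> avg (fun y => f y - g y) = avg f - avg g.
Proof. by move=> fb gb; apply: RintegralB => //; exact: bddY_integrable. Qed.

Lemma avgZ f (c : R) : bddY f -> avg (fun y => c * f y) = c * avg f.
Proof. by move=> fb; apply: RintegralZl => //; exact: bddY_integrable. Qed.

Lemma avg_ge f (c : R) : bddY f -> {ae leb1, forall y, Y y -> c <= f y} -> c <= avg f.
Proof.
move=> fb fc; rewrite -subr_ge0 -[c in _ - c]avg_cst -avgB//; last exact: bddY_cst.
have [mf _] := fb.
have mfc : measurable_fun Y (fun y => f y - c).
  by apply: measurable_funB => //; exact: measurable_cst.
have E : avg (fun y => f y - c) = avg (fun y => `|f y - c|).
  apply: (ae_eq_Rintegral (m := leb1) mY mfc); first exact: measurableT_comp.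
  apply: (ae_mono (m := leb1) _ fc) => y fy Yy.
  by rewrite ger0_norm// subr_ge0 fy.
by rewrite E; apply: Rintegral_ge0.
Qed.

Section hmean.
Context (f : R -> R) (c : R).
Hypotheses (c0 : 0 < c) (fb : bddY f) (fc : {ae leb1, forall y, Y y -> c <= f y}).

Lemma avg_inv_gt0 : 0 < avg (fun y => (f y)^-1).
Proof.
have [_ [C fC]] := fb.
(* A positive upper bound of [f], whatever the sign of [C]; its inverse bounds the average from
   below. *)
have C0 : 0 < `|C| + 1 by rewrite ltr_wpDl.
apply: (@lt_le_trans _ _ (`|C| + 1)^-1); first by rewrite invr_gt0.
apply: avg_ge; first exact: bddYV fc.
apply: (ae_mono2 (m := leb1) _ fC fc) => y fyC fyc Yy.
have fy0 : 0 < f y by rewrite (lt_le_trans c0)// fyc.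
rewrite lef_pV2 ?posrE//; apply: (le_trans (ler_norm _)); apply: (le_trans (fyC Yy)).
by rewrite (le_trans (ler_norm _))// lerDl.
Qed.

Lemma hmean_gt0 : 0 < hmean f.
Proof. by rewrite invr_gt0; exact: avg_inv_gt0. Qed.

Lemma avg_inv : avg (fun y => (f y)^-1) = (hmean f)^-1.
Proof. by rewrite /hmean invrK. Qed.

Lemma avg_hmean_div : avg (fun y => hmean f / f y) = 1.
Proof.
by rewrite avgZ ?avg_inv ?divff ?gt_eqF ?hmean_gt0//; exact: bddYV fc.
Qed.

End hmean.
End BoundedCoefficients.

(** * Positivity and mean values of the effective moduli *)

Section Moduli.
Context (R : realType) (mu lam : R -> R) (c : R).
Hypotheses (c0 : 0 < c) (bmu : bddY mu) (blam : bddY lam).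
Hypothesis mulam : {ae leb1, forall y, Y y -> c <= mu y /\ 0 <= lam y}.

Let mu_c : {ae leb1, forall y, Y y -> c <= mu y}.
Proof. by apply: (ae_mono (m := leb1) _ mulam) => y H /H[]. Qed.

Let bMmod : bddY (Mmod mu lam).
Proof. exact: bddYD (bddYM (bddY_cst 2) bmu) blam. Qed.

Let Mmod_c : {ae leb1, forall y, Y y -> c <= Mmod mu lam y}.
Proof.
apply: (ae_mono (m := leb1) _ mulam) => y H /H[]; rewrite /Mmod.
by move: (mu y) (lam y) c0 => m l cc; lra.
Qed.

Lemma bddY_inv_Mmod : bddY (fun y => (Mmod mu lam y)^-1).
Proof. exact: bddYV Mmod_c. Qed.

Lemma bddY_inv_mu : bddY (fun y => (mu y)^-1).
Proof. exact: bddYV mu_c. Qed.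

Lemma bddY_nu : bddY (nu mu lam).
Proof.
apply: bddYM => //; apply: (bddYV c0).
  exact: bddYM (bddY_cst 2) (bddYD bmu blam).
apply: (ae_mono (m := leb1) _ mulam) => y H /H[].
by move: (mu y) (lam y) c0 => m l cc; lra.
Qed.

Lemma bddY_beta : bddY (beta mu lam).
Proof.
by apply: bddYB; [exact: bMmod|exact: bddYM (bddYM (bddY_cst 2) blam) bddY_nu].
Qed.

(** Eliminating [nu] gives beta = 2 mu + lam mu / (mu + lam), which is at least 2 mu. *)
Lemma beta_ge : {ae leb1, forall y, Y y -> c <= beta mu lam y}.
Proof.
apply: (ae_mono (m := leb1) _ mulam) => y H /H[]; rewrite /beta /nu.
move: (mu y) (lam y) c0 => m l c_gt0 cm l0.
have ml : 0 < m + l by lra.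
have -> : 2 * m + l - 2 * l * (l / (2 * (m + l))) = 2 * m + l * m / (m + l).
  by field; rewrite gt_eqF.
have : 0 <= l * m / (m + l) by rewrite divr_ge0 ?mulr_ge0//; lra.
by move: (l * m / (m + l)) => t; lra.
Qed.

Lemma bddY_lam_Mmod : bddY (fun y => lam y / Mmod mu lam y).
Proof. exact: bddYM blam bddY_inv_Mmod. Qed.

Local Notation H := (hmean (Mmod mu lam)).
Local Notation L := (avg (fun y => lam y / Mmod mu lam y)).
Local Notation P := (avg (fun y => lam y ^+ 2 / Mmod mu lam y)).
Local Notation A := (avg (fun y => lam y + mu y)).

Let bP : bddY (fun y => lam y ^+ 2 / Mmod mu lam y).
Proof. exact: bddYM (bddYM blam blam) bddY_inv_Mmod. Qed.

Let bA : bddY (fun y => lam y + mu y).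
Proof. exact: bddYD blam bmu. Qed.

Let H_gt0 : 0 < H. Proof. exact: hmean_gt0 Mmod_c. Qed.

(** Pointwise, lam + mu - lam^2 / M = mu + 2 mu lam / M, which is at least [c]. This keeps the
    denominator of [nu_infty] positive. *)
Let AP_gt0 : 0 < A - P.
Proof.
rewrite -avgB//; apply: (lt_le_trans c0); apply: avg_ge; first exact: bddYB.
apply: (ae_mono (m := leb1) _ mulam) => y K /K[]; rewrite /Mmod.
move: (mu y) (lam y) c0 => m l c_gt0 cm l0.
have M0 : 0 < 2 * m + l by lra.
have -> : l + m - l ^+ 2 / (2 * m + l) = m + 2 * m * l / (2 * m + l).
  by field; rewrite gt_eqF.
have : 0 <= 2 * m * l / (2 * m + l) by rewrite divr_ge0 ?mulr_ge0//; lra.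
by move: (_ / _) => t; lra.
Qed.

Let den_gt0 : 0 < L ^+ 2 * H - P + A.
Proof.
rewrite -addrA [- P + A]addrC ltr_wpDl// mulr_ge0 ?sqr_ge0//.
exact: ltW.
Qed.

(** Inserting [nu_infty] gives beta_infty = H (A - P) / (L^2 H - P + A), a quotient of positive
    quantities. *)
Lemma beta_infty_gt0 : 0 < beta_infty mu lam.
Proof.
rewrite /beta_infty /nu_infty.
move: H_gt0 AP_gt0 den_gt0; move: H L P A => h l p a h0 ap0 d0.
have -> : h * (1 - 2 * (2^-1 * (h * l / (l ^+ 2 * h - p + a))) * l) =
  h * ((a - p) / (l ^+ 2 * h - p + a)) by field; rewrite gt_eqF.
by rewrite mulr_gt0// divr_gt0.
Qed.

(** Since 1/M has mean 1/H, the definition of [beta_infty] makes the mean equal to (1 - 2 n L) + 2 n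
    L, with n = [nu_infty]. Mean one is what turns the axial stretch minus 1 into a y-derivative. *)
Lemma avg_stretch_infty : avg (fun y => beta_infty mu lam / Mmod mu lam y +
  2 * nu_infty mu lam * (lam y / Mmod mu lam y)) = 1.
Proof.
rewrite avgD; last 2 first.
- exact: bddYM (bddY_cst _) bddY_inv_Mmod.
- exact: bddYM (bddY_cst _) bddY_lam_Mmod.
rewrite (avgZ (beta_infty mu lam) bddY_inv_Mmod) (avgZ _ bddY_lam_Mmod) avg_inv.
rewrite /beta_infty; move: H_gt0 (nu_infty mu lam); move: H L => h l h0 n.
by field; rewrite gt_eqF.
Qed.

Lemma bddY_g_infty : bddY (g_infty mu lam).
Proof.
apply: bddYB.
  exact: bddYM (bddYM (bddY_cst 2) (bddYD bmu blam)) (bddY_cst _).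
exact: bddYM (bddYD (bddY_cst _) (bddYM (bddY_cst _) blam)) bddY_lam_Mmod.
Qed.

(** This condition determines [nu_infty]: with b = H (1 - 2 n L), mean zero is the linear equation 2
    n (L^2 H - P + A) = H L for n. Mechanically, the lateral stress vanishes on average over the
    period. *)
Lemma avg_g_infty : avg (g_infty mu lam) = 0.
Proof.
set b := beta_infty mu lam; set n := nu_infty mu lam.
have -> : avg (g_infty mu lam) = avg (fun y => 2 * n * (lam y + mu y)
    - (b * (lam y / Mmod mu lam y) + 2 * n * (lam y ^+ 2 / Mmod mu lam y))).
  congr avg; apply/funext => y; rewrite /g_infty -/b -/n.
  by move: (mu y) (lam y) (Mmod mu lam y)^-1 => m l M; ring.
have b1 : bddY (fun y => b * (lam y / Mmod mu lam y)).
  exact: bddYM (bddY_cst _) bddY_lam_Mmod.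
have b2 : bddY (fun y => 2 * n * (lam y ^+ 2 / Mmod mu lam y)).
  exact: bddYM (bddY_cst _) bP.
have b3 : bddY (fun y => 2 * n * (lam y + mu y)) by exact: bddYM (bddY_cst _) bA.
rewrite (avgB b3 (bddYD b1 b2)) (avgD b1 b2) (avgZ _ bA) (avgZ _ bddY_lam_Mmod) (avgZ _ bP).
rewrite /b /beta_infty /n /nu_infty.
move: den_gt0; move: H L P A => h l p a d0.
by field; rewrite gt_eqF.
Qed.

End Moduli.

(** * Relaxed strains *)

Section Matrices3.
Context (R : realType).
Implicit Types (F G : 'M[R]_3) (x : R * R) (v : 'cV[R]_3).

Lemma ord3P (P : 'I_3 -> Prop) : P 0 -> P 1 -> P 2%:R -> forall i, P i.
Proof.
move=> P0 P1 P2 [[|[|[|//]]] p].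
- by rewrite (_ : Ordinal p = 0)//; exact: val_inj.
- by rewrite (_ : Ordinal p = 1)//; exact: val_inj.
- by rewrite (_ : Ordinal p = 2%:R)//; exact: val_inj.
Qed.

Lemma sum3E (V : nmodType) (f : 'I_3 -> V) : \sum_(i < 3) f i = f 0 + f 1 + f 2%:R.
Proof.
rewrite 2!big_ord_recl big_ord1 addrA; congr (_ + f _ + f _); exact: val_inj.
Qed.

Lemma matrix3P F G :
  F 0 0 = G 0 0 -> F 0 1 = G 0 1 -> F 0 2%:R = G 0 2%:R ->
  F 1 0 = G 1 0 -> F 1 1 = G 1 1 -> F 1 2%:R = G 1 2%:R ->
  F 2%:R 0 = G 2%:R 0 -> F 2%:R 1 = G 2%:R 1 -> F 2%:R 2%:R = G 2%:R 2%:R ->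
  F = G.
Proof. by move=> *; apply/matrixP; apply: ord3P; apply: ord3P. Qed.

Definition col3 (a b c : R) : 'cV[R]_3 := \col_i [:: a; b; c]`_i.

Lemma col3E a b c : (col3 a b c 0 0 = a) * (col3 a b c 1 0 = b) * (col3 a b c 2%:R 0 = c).
Proof. by rewrite !mxE. Qed.

Lemma col3P v : v = col3 (v 0 0) (v 1 0) (v 2%:R 0).
Proof. by apply/matrixP => i j; rewrite ord1; move: i; apply: ord3P; rewrite col3E. Qed.

Lemma mx3E a b c d e f g h k (m := mx3 [:: [:: a; b; c]; [:: d; e; f]; [:: g; h; k]] : 'M[R]_3) :
  ((m 0 0 = a) * (m 0 1 = b) * (m 0 2%:R = c)) *
  ((m 1 0 = d) * (m 1 1 = e) * (m 1 2%:R = f)) *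
  ((m 2%:R 0 = g) * (m 2%:R 1 = h) * (m 2%:R 2%:R = k)).
Proof. by rewrite /m !mxE. Qed.

Lemma evecE i j : evec R i j 0 = (j == i)%:R.
Proof. by rewrite mxE andbT. Qed.

Lemma evec0E : evec R 0 = col3 1 0 0.
Proof. by rewrite [LHS]col3P !evecE. Qed.

Lemma xvecE x : xvec x = col3 0 x.1 x.2.
Proof. by rewrite [LHS]col3P !mxE/= !mulr0 !mulr1 !addr0 !add0r. Qed.

Lemma mulmx_col3 F a b c i : (F *m col3 a b c) i 0 = F i 0 * a + F i 1 * b + F i 2%:R * c.
Proof. by rewrite mxE sum3E !col3E. Qed.

Lemma tens_cols3 v : tens v (evec R 0) = cols3 v 0 0.
Proof.
apply/matrixP => i; apply: ord3P; rewrite mxE big_ord1 evec0E !mxE/= ?mulr1 ?mulr0 //.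
Qed.

Lemma diag3E a b c : diag3 a b c = mx3 [:: [:: a; 0; 0]; [:: 0; b; 0]; [:: 0; 0; c]] :> 'M[R]_3.
Proof. by apply: matrix3P; rewrite mx3E !mxE. Qed.

Lemma sym_cols3E a b c d e f g h k :
  sym (cols3 (col3 a b c) (col3 d e f) (col3 g h k)) =
  mx3 [:: [:: a; 2^-1 * (b + d); 2^-1 * (c + g)];
          [:: 2^-1 * (b + d); e; 2^-1 * (f + h)];
          [:: 2^-1 * (c + g); 2^-1 * (f + h); k]].
Proof.
apply: matrix3P; rewrite mx3E !mxE/=; by field.
Qed.

Lemma sym_comb (s t : R) F G : sym (s *: F + t *: G) = s *: sym F + t *: sym G.
Proof. by apply/matrixP => i j; rewrite !mxE; ring. Qed.

Lemma cols3_comb (s t : R) v n2 n3 v' n2' n3' :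
  cols3 (s *: v + t *: v') (s *: n2 + t *: n2') (s *: n3 + t *: n3') =
  s *: cols3 v n2 n3 + t *: cols3 v' n2' n3'.
Proof. by apply/matrixP => i; apply: ord3P; rewrite !mxE. Qed.

Lemma mx3Z (t a b c d e f g h k : R) :
  t *: (mx3 [:: [:: a; b; c]; [:: d; e; f]; [:: g; h; k]] : 'M[R]_3) =
  mx3 [:: [:: t * a; t * b; t * c]; [:: t * d; t * e; t * f]; [:: t * g; t * h; t * k]].
Proof. by apply: matrix3P; rewrite mxE !mx3E. Qed.

Lemma mx3D (a b c d e f g h k a' b' c' d' e' f' g' h' k' : R) :
  (mx3 [:: [:: a; b; c]; [:: d; e; f]; [:: g; h; k]] : 'M[R]_3) +
  (mx3 [:: [:: a'; b'; c']; [:: d'; e'; f']; [:: g'; h'; k']] : 'M[R]_3) =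
  (mx3 [:: [:: a + a'; b + b'; c + c']; [:: d + d'; e + e'; f + f'];
          [:: g + g'; h + h'; k + k']] : 'M[R]_3).
Proof. by apply: matrix3P; rewrite mxE !mx3E. Qed.

Lemma mx3B (a b c d e f g h k a' b' c' d' e' f' g' h' k' : R) :
  (mx3 [:: [:: a; b; c]; [:: d; e; f]; [:: g; h; k]] : 'M[R]_3) -
  (mx3 [:: [:: a'; b'; c']; [:: d'; e'; f']; [:: g'; h'; k']] : 'M[R]_3) =
  (mx3 [:: [:: a - a'; b - b'; c - c']; [:: d - d'; e - e'; f - f'];
          [:: g - g'; h - h'; k - k']] : 'M[R]_3).
Proof. by apply: matrix3P; rewrite mxE [X in _ + X]mxE !mx3E. Qed.

Lemma K2_xvec x : K2 R *m xvec x = col3 (- x.1) 0 0.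
Proof.
rewrite xvecE [LHS]col3P !mulmx_col3 /K2 !tens_cols3 /tens !mxE !big_ord1 !mxE/=.
by congr col3; ring.
Qed.

Lemma K3_xvec x : K3 R *m xvec x = col3 (- x.2) 0 0.
Proof.
rewrite xvecE [LHS]col3P !mulmx_col3 /K3 !tens_cols3 /tens !mxE !big_ord1 !mxE/=.
by congr col3; ring.
Qed.

Lemma K4_xvec x : K4 R *m xvec x = col3 0 (- x.2) x.1.
Proof.
rewrite xvecE [LHS]col3P !mulmx_col3 /K4 /tens !mxE !big_ord1 !mxE/=.
by congr col3; ring.
Qed.

Lemma skew_tens (u v : 'cV[R]_3) : Defs.skew (tens u v - tens v u).
Proof. by apply/matrixP => i j; rewrite !mxE !big_ord1 !mxE opprB;
  rewrite [u j _ * _]mulrC [v j _ * _]mulrC. Qed.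

Lemma strainE (K : 'M[R]_3) a x : strain K a x = sym (cols3 (K *m xvec x + a *: evec R 0) 0 0).
Proof. by rewrite /strain tens_cols3. Qed.

(** The polarized form sees only the symmetric parts of its arguments, whence the sums of transposed
    entries. *)
Lemma LformE (mu lam : R -> R) y F G : Lform (Qiso mu lam) y F G =
  mu y * (2 * (F 0 0 * G 0 0 + F 1 1 * G 1 1 + F 2%:R 2%:R * G 2%:R 2%:R) +
          (F 0 1 + F 1 0) * (G 0 1 + G 1 0) +
          (F 0 2%:R + F 2%:R 0) * (G 0 2%:R + G 2%:R 0) +
          (F 1 2%:R + F 2%:R 1) * (G 1 2%:R + G 2%:R 1)) +
  lam y * (F 0 0 + F 1 1 + F 2%:R 2%:R) * (G 0 0 + G 1 1 + G 2%:R 2%:R).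
Proof.
rewrite /Lform /Qiso /sqnorm !sum3E /mxtrace !sum3E /sym !mxE.
by field.
Qed.

Lemma QisoE (mu lam : R -> R) y G : Qiso mu lam y G = Lform (Qiso mu lam) y G G.
Proof.
rewrite LformE /Qiso /sqnorm !sum3E /mxtrace !sum3E /sym !mxE.
by field.
Qed.

End Matrices3.

(** * Integration over the cross section times the period *)

Section Cylinder.
Context (R : realType) (S : set (R * R)).
Hypotheses (oS : open S) (bS : bounded_set S).
Local Notation RL := (measurableTypeR R).
Local Notation SY := (S `*` Y : set (RL * RL * RL)).

Let mS := open_measurable_plane oS.
Let mY := @measurable_Y R.
Let fS := leb2_bounded_fin oS bS.
Let fY := leb1_Y_fin R.

Lemma measurable_SY : measurable SY.
Proof. exact: measurableX. Qed.

Lemma leb3_SY_fin : (leb3 SY < +oo)%E.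
Proof.
have -> : leb3 SY = (leb2 S * leb1 (@Y R))%E by exact: product_measure1E.
by rewrite leb1_Y mule1.
Qed.

Let mSY := measurable_SY.
Let fSY := leb3_SY_fin.

Lemma L2_tensor3 (a : R * R -> R) (b : R -> R) : L2 leb2 S a -> L2 leb1 Y b ->
  L2 leb3 SY (fun p => a p.1 * b p.2).
Proof. by move=> La Lb; exact (L2_tensor (m1 := leb2) (m2 := leb1) mS mY La Lb). Qed.

Lemma L2_lift1 (a : R * R -> R) : L2 leb2 S a -> L2 leb3 SY (fun p => a p.1).
Proof.
move=> La; have := L2_tensor3 La (L2_cst mY fY 1).
by under eq_fun do rewrite mulr1.
Qed.

Lemma L2_lift2 (b : R -> R) : L2 leb1 Y b -> L2 leb3 SY (fun p => b p.2).
Proof.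
move=> Lb; have := L2_tensor3 (L2_cst mS fS 1) Lb.
by under eq_fun do rewrite mul1r.
Qed.

Lemma L2_integrable3 (f : (R * R) * R -> R) : L2 leb3 SY f ->
  leb3.-integrable SY (EFin \o f).
Proof. by move=> Lf; exact (L2_integrable (m := leb3) mSY fSY Lf). Qed.

Lemma ae_lift_y (P : R -> Prop) : {ae leb1, forall y, P y} -> {ae leb3, forall p, P p.2}.
Proof. by move=> H; exact (ae_lift2 leb2 H). Qed.

Lemma bddY_L2M (g : R -> R) (f : (R * R) * R -> R) : bddY g -> L2 leb3 SY f ->
  L2 leb3 SY (fun p => g p.2 * f p).
Proof.
move=> [mg [C gC]] Lf.
apply: (@L2_bddM _ _ _ leb3 SY mSY (fun p => g p.2) f C) => //.
  exact (measurable_fun_lift2 (D1 := S) mY mg).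
by apply: (ae_mono (m := leb3) _ (ae_lift_y gC)) => p H [_ Yp]; exact: H.
Qed.

Lemma Rintegral3_tensor (a : R * R -> R) (b : R -> R) : L2 leb2 S a -> L2 leb1 Y b ->
  \int[leb3]_(p in SY) (a p.1 * b p.2) =
  (\int[leb2]_(x in S) a x) * avg b.
Proof.
move=> La Lb; have i3 := L2_integrable3 (L2_tensor3 La Lb).
exact (Rintegral_tensor (m1 := leb2) (m2 := leb1) mS mY (L2_integrable (m := leb2) mS fS La)
  (L2_integrable (m := leb1) mY fY Lb) i3).
Qed.

Lemma Rintegral3_lift1 (a : R * R -> R) : L2 leb2 S a ->
  \int[leb3]_(p in SY) a p.1 = \int[leb2]_(x in S) a x.
Proof.
move=> La; have := Rintegral3_tensor La (L2_cst mY fY 1).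
rewrite avg_cst mulr1 => <-.
by apply: eq_Rintegral => p _; rewrite mulr1.
Qed.

(** Integrating in y first, [s x] leaves the inner integral and only the mean of the slice of [v]
    remains. *)
Lemma Rintegral3_mean0 (s : R * R -> R) (v : (R * R) * R -> R) :
  L2 leb2 S s -> L2 leb3 SY v ->
  {ae leb2, forall x, S x -> avg (fun y => v (x, y)) = 0} ->
  \int[leb3]_(p in SY) (s p.1 * v p) = 0.
Proof.
move=> Ls Lv v0.
have svi : leb3.-integrable SY (EFin \o (fun p => s p.1 * v p)).
  exact (L2_mul mSY (L2_lift1 Ls) Lv).
transitivity (\int[leb2]_(x in S) \int[leb1]_(y in Y) (s x * v (x, y))).
  exact (Rintegral_setX12 (m1 := leb2) (m2 := leb1) mS mY svi).
rewrite -[RHS](Rintegral0 leb2 S).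
have i1 := fubini_integrable1 (m1 := leb2) (m2 := leb1) mS mY svi.
have sl := ae_integrable_slice1 (m1 := leb2) (m2 := leb1) mS mY (L2_integrable3 Lv).
apply: (ae_eq_Rintegral (m := leb2) mS).
- by have /measurable_EFinP := measurable_int _ i1.
- exact: measurable_cst.
- apply: (ae_mono2 (m := leb2) _ v0 sl) => x vx slx Sx.
  by rewrite (RintegralZl (s x) mY (slx Sx)) -/(avg _) vx ?mulr0.
Qed.

(** Here x is integrated first: for almost every y the slice of (v2, v3) is a gradient, against
    which (a, b) is assumed to integrate to zero. *)
Lemma Rintegral3_gradient (a b : R * R -> R) (v2 v3 : (R * R) * R -> R) :
  L2 leb2 S a -> L2 leb2 S b -> L2 leb3 SY v2 -> L2 leb3 SY v3 ->
  {ae leb1, forall y, Y y -> exists v, H1S S v (fun x => v2 (x, y)) (fun x => v3 (x, y))} ->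
  (forall u u2 u3, H1S S u u2 u3 -> \int[leb2]_(x in S) (a x * u2 x + b x * u3 x) = 0) ->
  \int[leb3]_(p in SY) (a p.1 * v2 p + b p.1 * v3 p) = 0.
Proof.
move=> La Lb Lv2 Lv3 Hv ab.
have fi : leb3.-integrable SY (EFin \o (fun p => a p.1 * v2 p + b p.1 * v3 p)).
  exact (integrableDR mSY (L2_mul mSY (L2_lift1 La) Lv2) (L2_mul mSY (L2_lift1 Lb) Lv3)).
transitivity (\int[leb1]_(y in Y) \int[leb2]_(x in S) (a x * v2 (x, y) + b x * v3 (x, y))).
  exact (Rintegral_setX21 (m1 := leb2) (m2 := leb1) mS mY fi).
rewrite -[RHS](Rintegral0 leb1 Y).
have i1 := fubini_integrable2 (m1 := leb2) (m2 := leb1) mS mY fi.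
apply: (ae_eq_Rintegral (m := leb1) mY).
- by have /measurable_EFinP := measurable_int _ i1.
- exact: measurable_cst.
- by apply: (ae_mono (m := leb1) _ Hv) => y Hy Yy; have [v /ab] := Hy Yy.
Qed.

Lemma L2Y_H1S_comb (s t : R) u u2 u3 v v2 v3 :
  L2Y_H1S S u u2 u3 -> L2Y_H1S S v v2 v3 ->
  L2Y_H1S S (fun p => s * u p + t * v p) (fun p => s * u2 p + t * v2 p)
    (fun p => s * u3 p + t * v3 p).
Proof.
move=> [Lu Lu2 Lu3 Hu] [Lv Lv2 Lv3 Hv]; split.
- exact (L2D mSY (L2Z mSY s Lu) (L2Z mSY t Lv)).
- exact (L2D mSY (L2Z mSY s Lu2) (L2Z mSY t Lv2)).
- exact (L2D mSY (L2Z mSY s Lu3) (L2Z mSY t Lv3)).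
- apply: (ae_mono2 (m := leb1) _ Hu Hv) => y Huy Hvy Yy.
  exact (H1S_comb s t oS bS (Huy Yy) (Hvy Yy)).
Qed.

Lemma L2S_H1Y_comb (s t : R) u du v dv :
  L2S_H1Y S u du -> L2S_H1Y S v dv ->
  L2S_H1Y S (fun p => s * u p + t * v p) (fun p => s * du p + t * dv p).
Proof.
move=> [Lu Ldu Hu] [Lv Ldv Hv]; split.
- exact (L2D mSY (L2Z mSY s Lu) (L2Z mSY t Lv)).
- exact (L2D mSY (L2Z mSY s Ldu) (L2Z mSY t Ldv)).
- apply: (ae_mono2 (m := leb2) _ Hu Hv) => x Hux Hvx Sx.
  exact (H1Y_comb s t (Hux Sx) (Hvx Sx)).
Qed.

Lemma L2Y_H1S_tensor (m : R -> R) (q q2 q3 : R * R -> R) : bddY m -> H1S S q q2 q3 ->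
  L2Y_H1S S (fun p => m p.2 * q p.1) (fun p => m p.2 * q2 p.1) (fun p => m p.2 * q3 p.1).
Proof.
move=> bm Hq; have [Lq Lq2 Lq3 _] := Hq; split.
- exact (bddY_L2M bm (L2_lift1 Lq)).
- exact (bddY_L2M bm (L2_lift1 Lq2)).
- exact (bddY_L2M bm (L2_lift1 Lq3)).
(* On a slice [m y] is a constant; scalar multiples are obtained as combinations with second
   coefficient 0. *)
- apply: aeW => y _; have := H1S_comb (m y) 0 oS bS Hq Hq.
  by congr H1S; apply/funext => x; rewrite mul0r addr0.
Qed.

Lemma L2S_H1Y_tensor (v : R * R -> R) (f : R -> R) : L2 leb2 S v -> bddY f -> avg f = 0 ->
  L2S_H1Y S (fun p => v p.1 * primitive f p.2) (fun p => v p.1 * f p.2).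
Proof.
move=> Lv bf f0; have [mf [C fC]] := bf.
have Hf := H1Y_primitive mf fC f0; have [Lpf _ _] := Hf; split.
- exact (L2_tensor3 Lv Lpf).
- exact (L2_tensor3 Lv (bddY_L2 bf)).
- apply: aeW => x _; have := H1Y_comb (v x) 0 Hf Hf.
  by congr H1Y; apply/funext => y; rewrite mul0r addr0.
Qed.

End Cylinder.

(** * Linearity and common structure of the relaxed strains *)

Section RelaxedStrains.
Context (R : realType) (S : set (R * R)).
Hypotheses (oS : open S) (bS : bounded_set S).
Local Notation RL := (measurableTypeR R).
Local Notation SY := (S `*` Y : set (RL * RL * RL)).
Implicit Types (chi : (R * R) * R -> 'M[R]_3).

Let mS := open_measurable_plane oS.
Let mSY := measurable_SY oS.

Lemma combE m n (s t : R) (A B : 'M[R]_(m, n)) i j :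
  (s *: A + t *: B) i j = s * A i j + t * B i j.
Proof. by rewrite !mxE. Qed.

Lemma L2mx_comb (s t : R) chi chi' : L2mx leb3 SY chi -> L2mx leb3 SY chi' ->
  L2mx leb3 SY (fun p => s *: chi p + t *: chi' p).
Proof.
move=> L L' i j; have := L2D mSY (L2Z mSY s (L i j)) (L2Z mSY t (L' i j)).
by congr L2; apply/funext => p; rewrite combE.
Qed.

Lemma Hrel_comb gamma (s t : R) chi chi' : Hrel gamma S chi -> Hrel gamma S chi' ->
  Hrel gamma S (fun p => s *: chi p + t *: chi' p).
Proof.
move=> [Lchi H] [Lchi' H']; split; first exact: L2mx_comb.
case: gamma H H' => /=.
- move=> [Psi [dPsi [ph [dph [pb [pb2 [pb3 [HPsi sPsi Hph Hpb Echi]]]]]]]].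
  move=> [Psi' [dPsi' [ph' [dph' [pb' [pb2' [pb3' [HPsi' sPsi' Hph' Hpb' Echi']]]]]]]].
  exists (fun y => s *: Psi y + t *: Psi' y), (fun y => s *: dPsi y + t *: dPsi' y).
  exists (fun y => s *: ph y + t *: ph' y), (fun y => s *: dph y + t *: dph' y).
  exists (fun p => s *: pb p + t *: pb' p), (fun p => s *: pb2 p + t *: pb2' p).
  exists (fun p => s *: pb3 p + t *: pb3' p); split.
  + move=> i j; have := H1Y_comb s t (HPsi i j) (HPsi' i j).
    by congr H1Y; apply/funext => y; rewrite combE.
  + apply: (ae_mono2 (m := leb1) _ sPsi sPsi') => y sy sy' Yy.
    by rewrite /Defs.skew linearD !linearZ/= sy// sy'// !scalerN -opprD.
  + move=> i; have := H1Y_comb s t (Hph i) (Hph' i).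
    by congr H1Y; apply/funext => y; rewrite combE.
  + move=> i; have := L2Y_H1S_comb oS bS s t (Hpb i) (Hpb' i).
    by congr L2Y_H1S; apply/funext => y; rewrite combE.
  + apply: (ae_mono2 (m := leb3) _ Echi Echi') => p E E' Dp.
    have -> : (s *: dPsi p.2 + t *: dPsi' p.2) *m xvec p.1 + (s *: dph p.2 + t *: dph' p.2) =
        s *: (dPsi p.2 *m xvec p.1 + dph p.2) + t *: (dPsi' p.2 *m xvec p.1 + dph' p.2).
      by rewrite mulmxDl -!scalemxAl !scalerDr addrACA.
    by rewrite (E Dp) (E' Dp) cols3_comb sym_comb.
- move=> [ph [dph [pb [pb2 [pb3 [Hph Hpb Echi]]]]]].
  move=> [ph' [dph' [pb' [pb2' [pb3' [Hph' Hpb' Echi']]]]]].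
  exists (fun p => s *: ph p + t *: ph' p), (fun p => s *: dph p + t *: dph' p).
  exists (fun p => s *: pb p + t *: pb' p), (fun p => s *: pb2 p + t *: pb2' p).
  exists (fun p => s *: pb3 p + t *: pb3' p); split.
  + move=> i; have := L2S_H1Y_comb oS s t (Hph i) (Hph' i).
    by congr L2S_H1Y; apply/funext => y; rewrite combE.
  + move=> i; have := H1S_comb s t oS bS (Hpb i) (Hpb' i).
    by congr H1S; apply/funext => y; rewrite combE.
  + apply: (ae_mono2 (m := leb3) _ Echi Echi') => p E E' Dp.
    by rewrite (E Dp) (E' Dp) -sym_comb -cols3_comb.
Qed.

(* The gradient columns n2, n3 depend on y when gamma = 0 and only on x when
   gamma = infty, which is why g has to vanish in the first case but only to have
   mean zero in the second. *)
Lemma Hrel_decomp gamma (g : R -> R) chi : Hrel gamma S chi ->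
  (if gamma is GammaZero then forall y, g y = 0 else bddY g /\ avg g = 0) ->
  exists v n2 n3 : (R * R) * R -> 'cV[R]_3,
  [/\ forall k, [/\ L2 leb3 SY (fun p => v p k 0), L2 leb3 SY (fun p => n2 p k 0)
        & L2 leb3 SY (fun p => n3 p k 0)],
      {ae leb3, forall p, SY p -> chi p = sym (cols3 (v p) (n2 p) (n3 p))},
      forall k (s : R * R -> R), L2 leb2 S s -> \int[leb3]_(p in SY) (s p.1 * v p k 0) = 0,
      forall k (a b : R * R -> R), L2 leb2 S a -> L2 leb2 S b ->
        (forall u u2 u3, H1S S u u2 u3 -> \int[leb2]_(x in S) (a x * u2 x + b x * u3 x) = 0) ->
        \int[leb3]_(p in SY) (a p.1 * n2 p k 0 + b p.1 * n3 p k 0) = 0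
    & forall k (w : R * R -> R), L2 leb2 S w -> (exists C, forall x, S x -> `|w x| <= C) ->
        \int[leb3]_(p in SY) (g p.2 * (w p.1 * n2 p k 0)) = 0 /\
        \int[leb3]_(p in SY) (g p.2 * (w p.1 * n3 p k 0)) = 0].
Proof.
move=> [Lchi H]; case: gamma H => /=.
- move=> [Psi [dPsi [ph [dph [pb [pb2 [pb3 [HPsi sPsi Hph Hpb Echi]]]]]]]] g0.
  have LdPsi i j : L2 leb1 Y (fun y => dPsi y i j) by have [] := HPsi i j.
  have Ldph i : L2 leb1 Y (fun y => dph y i 0) by have [] := Hph i.
  exists (fun p => dPsi p.2 *m xvec p.1 + dph p.2), pb2, pb3.
  have vE k x y : (dPsi y *m xvec x + dph y) k 0 =
      x.1 * dPsi y k 1 + x.2 * dPsi y k 2%:R + dph y k 0.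
    by rewrite mxE xvecE mulmx_col3 mulr0 add0r (mulrC x.1) (mulrC x.2).
  have Lv k : L2 leb3 SY (fun p => (dPsi p.2 *m xvec p.1 + dph p.2) k 0).
    under eq_fun do rewrite vE.
    exact (L2D mSY (L2D mSY (L2_tensor3 oS (L2_fst oS bS) (LdPsi k 1))
      (L2_tensor3 oS (L2_snd oS bS) (LdPsi k 2%:R))) (L2_lift2 oS bS (Ldph k))).
  split=> //.
  + move=> k; have [_ L2k L3k _] := Hpb k; split; [exact (Lv k)|exact L2k|exact L3k].
  + move=> k s Ls; apply: (Rintegral3_mean0 oS bS Ls (Lv k)).
    apply: aeW => x Sx; under eq_fun do rewrite vE.
    (* At fixed [x] the first column is the y-derivative of a combination of [Psi k 1], [Psi k 2]
       and [ph k] with constant coefficients, so it has mean zero over the period. *)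
    have := H1Y_comb 1 1 (H1Y_comb x.1 x.2 (HPsi k 1) (HPsi k 2%:R)) (Hph k).
    move=> /H1Y_mean0; rewrite /avg => <-.
    by apply: eq_Rintegral => y _; rewrite !mul1r.
  + move=> k a b La Lb ab; have [_ L2k L3k Hk] := Hpb k.
    refine (Rintegral3_gradient oS La Lb L2k L3k _ ab).
    by apply: (ae_mono (m := leb1) _ Hk) => y Hy Yy; exists (fun x => pb (x, y) k 0); exact: Hy.
  + move=> k w _ _; split; rewrite -[RHS](Rintegral0 leb3 SY); apply: eq_Rintegral => p _;
      by rewrite g0 mul0r.
- move=> [ph [dph [pb [pb2 [pb3 [Hph Hpb Echi]]]]]] [bg g0].
  exists dph, (fun p => pb2 p.1), (fun p => pb3 p.1).
  have Ldph k : L2 leb3 SY (fun p => dph p k 0) by have [] := Hph k.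
  split=> //.
  + move=> k; have [_ L2k L3k _] := Hpb k.
    split; [exact (Ldph k)|exact (L2_lift1 oS L2k)|exact (L2_lift1 oS L3k)].
  + move=> k s Ls; apply: (Rintegral3_mean0 oS bS Ls (Ldph k)).
    have [_ _ Hk] := Hph k; apply: (ae_mono (m := leb2) _ Hk) => x Hx Sx.
    exact: H1Y_mean0 (Hx Sx).
  + move=> k a b La Lb ab; have [_ L2k L3k _] := Hpb k.
    refine (Rintegral3_gradient oS La Lb (L2_lift1 oS L2k) (L2_lift1 oS L3k) _ ab).
    by apply: aeW => y _; exists (fun x => pb x k 0); exact: Hpb.
  + move=> k w Lw [C wC]; have [_ L2k L3k _] := Hpb k.
    have wn (n : R * R -> R) : L2 leb2 S n ->
        \int[leb3]_(p in SY) (g p.2 * (w p.1 * n p.1)) = 0.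
      move=> Ln; have Lwn : L2 leb2 S (fun x => w x * n x).
        apply: (@L2_bddM _ _ _ leb2 S mS w n C Lw.1) => //.
        exact: aeW.
      (* The gradient column does not depend on y here, so the integral factors and the mean of [g]
         annihilates it. *)
      have := Rintegral3_tensor oS bS Lwn (bddY_L2 bg).
      rewrite g0 mulr0 => <-; apply: eq_Rintegral => p _; exact: mulrC.
    by split; [exact (wn (fun x => pb2 x k 0) L2k)|exact (wn (fun x => pb3 x k 0) L3k)].
Qed.

End RelaxedStrains.

(** * Explicit relaxed strains *)

Section StrainGenerators.
Context (R : realType) (S : set (R * R)).
Hypotheses (oS : open S) (bS : bounded_set S).
Local Notation RL := (measurableTypeR R).
Local Notation SY := (S `*` Y : set (RL * RL * RL)).

Let mSY := measurable_SY oS.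

Lemma H1S0 : H1S S (fun=> 0) (fun=> 0) (fun=> 0).
Proof.
have := H1S_comb 0 0 oS bS (H1S_fst oS bS) (H1S_fst oS bS).
by congr H1S; apply/funext => x; rewrite !mul0r addr0.
Qed.

Let c1 := @continuous_fst R.
Let c2 := @continuous_snd R.
Let cM (f g : R * R -> R) : continuous f -> continuous g -> continuous (fun x => f x * g x).
Proof. by move=> cf cg x; apply: cvgM; [exact: cf|exact: cg]. Qed.
Let cC (a : R) : continuous ((fun=> a) : R * R -> R).
Proof. by move=> x; exact: cvg_cst. Qed.

(** This and the next two lemmas supply the quadratic potentials of the in-plane contraction in
    bending. *)
Lemma H1S_sq_fst : H1S S (fun x => x.1 ^+ 2) (fun x => 2 * x.1) (fun=> 0).
Proof.
have d2 (x : R * R) : is_derive (x.1 : R) (1 : R) (fun t : R => t ^+ 2) (2 * x.1).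
  have := is_deriveX 2 (is_derive_id x.1 (1 : R)).
  by congr is_derive; rewrite /GRing.scale/= mulr1 mulr_natl expr1.
have d3 (x : R * R) := is_derive_cst (x.1 ^+ 2) x.2 (1 : R).
exact (H1S_C1 oS bS (@cM _ _ c1 c1) (@cM _ _ (@cC 2) c1) (@cC 0) d2 d3).
Qed.

Lemma H1S_sq_snd : H1S S (fun x => x.2 ^+ 2) (fun=> 0) (fun x => 2 * x.2).
Proof.
have d3 (x : R * R) : is_derive (x.2 : R) (1 : R) (fun t : R => t ^+ 2) (2 * x.2).
  have := is_deriveX 2 (is_derive_id x.2 (1 : R)).
  by congr is_derive; rewrite /GRing.scale/= mulr1 mulr_natl expr1.
have d2 (x : R * R) := is_derive_cst (x.2 ^+ 2) x.1 (1 : R).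
exact (H1S_C1 oS bS (@cM _ _ c2 c2) (@cC 0) (@cM _ _ (@cC 2) c2) d2 d3).
Qed.

Lemma H1S_fst_snd : H1S S (fun x => x.1 * x.2) (fun x => x.2) (fun x => x.1).
Proof.
have d2 (x : R * R) : is_derive (x.1 : R) (1 : R) (fun t : R => t * x.2) x.2.
  have := is_deriveM (is_derive_id x.1 (1 : R)) (is_derive_cst x.2 x.1 (1 : R)).
  by congr is_derive; rewrite /GRing.scale/= mulr0 add0r mulr1.
have d3 (x : R * R) : is_derive (x.2 : R) (1 : R) (fun t : R => x.1 * t) x.1.
  have := is_deriveZ x.1 (is_derive_id x.2 (1 : R)).
  by congr is_derive; rewrite /GRing.scale/= mulr1.
exact (H1S_C1 oS bS (@cM _ _ c1 c2) c2 c1 d2 d3).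
Qed.

Lemma L2mx_sym_cols3 (v n2 n3 : (R * R) * R -> 'cV[R]_3) :
  (forall k, L2 leb3 SY (fun p => v p k 0)) -> (forall k, L2 leb3 SY (fun p => n2 p k 0)) ->
  (forall k, L2 leb3 SY (fun p => n3 p k 0)) ->
  L2mx leb3 SY (fun p => sym (cols3 (v p) (n2 p) (n3 p))).
Proof.
move=> Lv L2' L3.
have Lc k : forall j, L2 leb3 SY (fun p => cols3 (v p) (n2 p) (n3 p) k j).
  by apply: ord3P; under eq_fun do rewrite mxE; [exact (Lv k)|exact (L2' k)|exact (L3 k)].
move=> i j; have := L2Z mSY 2^-1 (L2D mSY (Lc i j) (Lc j i)).
by congr L2; apply/funext => p; rewrite !mxE.
Qed.

Lemma L2_0 k : L2 leb3 SY (fun=> (0 : 'cV[R]_3) k 0).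
Proof. by under eq_fun do rewrite mxE; exact: L20. Qed.

(** A rod strain modulated by a mean-zero [f] is relaxed in both regimes: for gamma = 0 the
    primitive of [f] multiplies [K] and a e_1 separately, for gamma = infinity it multiplies the
    whole column, which may depend on x. *)
Lemma Hrel_oscillation gamma (f : R -> R) (K : 'M[R]_3) (a : R) :
  bddY f -> avg f = 0 -> Defs.skew K ->
  Hrel gamma S (fun p => sym (cols3 (f p.2 *: (K *m xvec p.1 + a *: evec R 0)) 0 0)).
Proof.
move=> bf f0 sK.
have LK k : L2 leb2 S (fun x => (K *m xvec x + a *: evec R 0) k 0).
  have -> : (fun x => (K *m xvec x + a *: evec R 0) k 0) =
      (fun x : R * R => (K k 1 * x.1 + K k 2%:R * x.2) + a * evec R 0 k 0).
    by apply/funext => x; rewrite mxE xvecE mulmx_col3 mulr0 add0r [X in _ + X]mxE.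
  have mS := open_measurable_plane oS.
  exact (L2D mS (L2D mS (L2Z mS _ (L2_fst oS bS)) (L2Z mS _ (L2_snd oS bS)))
    (L2_cst mS (leb2_bounded_fin oS bS) _)).
have Lf := bddY_L2 bf.
have fK k : L2 leb3 SY (fun p => (f p.2 *: (K *m xvec p.1 + a *: evec R 0)) k 0).
  have := L2_tensor3 oS (LK k) Lf; congr L2; apply/funext => p.
  by rewrite [RHS]mxE mulrC.
split; first by apply: L2mx_sym_cols3; [exact fK|exact L2_0|exact L2_0].
case: gamma.
- have [mf [C fC]] := bf; have Hf := H1Y_primitive mf fC f0.
  have HfZ (s : R) : H1Y (fun y => primitive f y * s) (fun y => f y * s).
    by have := H1Y_comb s 0 Hf Hf; congr H1Y; apply/funext => y; rewrite mul0r addr0 mulrC.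
  exists (fun y => primitive f y *: K), (fun y => f y *: K).
  exists (fun y => primitive f y *: (a *: evec R 0)), (fun y => f y *: (a *: evec R 0)).
  exists (fun=> 0), (fun=> 0), (fun=> 0); split.
  + move=> i j; have := HfZ (K i j); congr H1Y; apply/funext => y; by rewrite !mxE.
  + by apply: aeW => y _; rewrite /Defs.skew linearZ/= sK scalerN.
  + move=> i; have := HfZ ((a *: evec R 0) i 0); congr H1Y; apply/funext => y;
      by rewrite [RHS]mxE.
  + move=> i; split; try exact (L2_0 i).
    apply: aeW => y _; have := H1S0; congr H1S; apply/funext => x; by rewrite mxE.
  + by apply: aeW => p _; rewrite scalerDr scalemxAl.
- exists (fun p => primitive f p.2 *: (K *m xvec p.1 + a *: evec R 0)).
  exists (fun p => f p.2 *: (K *m xvec p.1 + a *: evec R 0)).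
  exists (fun=> 0), (fun=> 0), (fun=> 0); split.
  + move=> i; have := L2S_H1Y_tensor oS (LK i) bf f0.
    by congr L2S_H1Y; apply/funext => p; rewrite [RHS]mxE mulrC.
  + move=> i; have := H1S0; congr H1S; apply/funext => x; by rewrite mxE.
  + exact: aeW.
Qed.

(** In-plane gradients may be modulated in y only when the potential may depend on y; for gamma =
    infinity the factor [m] has to be constant. *)
Lemma Hrel_section gamma (m : R -> R) (q q2 q3 : R * R -> 'cV[R]_3) :
  bddY m -> (if gamma is GammaInfty then exists c, forall y, m y = c else True) ->
  (forall k, H1S S (fun x => q x k 0) (fun x => q2 x k 0) (fun x => q3 x k 0)) ->
  Hrel gamma S (fun p => sym (cols3 0 (m p.2 *: q2 p.1) (m p.2 *: q3 p.1))).
Proof.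
move=> bm mc Hq.
have Lm (n : R * R -> 'cV[R]_3) : (forall k, L2 leb2 S (fun x => n x k 0)) ->
    forall k, L2 leb3 SY (fun p => (m p.2 *: n p.1) k 0).
  move=> Ln k; have := bddY_L2M oS bm (L2_lift1 oS (Ln k)).
  by congr L2; apply/funext => p; rewrite [RHS]mxE.
split.
  apply: L2mx_sym_cols3; first exact L2_0.
    by apply: Lm => k; have [] := Hq k.
  by apply: Lm => k; have [] := Hq k.
case: gamma mc => mc.
- exists (fun=> 0), (fun=> 0), (fun=> 0), (fun=> 0).
  exists (fun p => m p.2 *: q p.1), (fun p => m p.2 *: q2 p.1), (fun p => m p.2 *: q3 p.1); split.
  + move=> i j; have := H1Y0 R; congr H1Y; apply/funext => y; by rewrite mxE.
  + by apply: aeW => y _; rewrite /Defs.skew trmx0 oppr0.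
  + move=> i; have := H1Y0 R; congr H1Y; apply/funext => y; by rewrite mxE.
  + move=> k; have := L2Y_H1S_tensor oS bS bm (Hq k).
    by congr L2Y_H1S; apply/funext => p; rewrite [RHS]mxE.
  + by apply: aeW => p _; rewrite mul0mx addr0.
- have [c mE] := mc.
  exists (fun=> 0), (fun=> 0), (fun x => c *: q x), (fun x => c *: q2 x), (fun x => c *: q3 x); split.
  + move=> i; split; try exact (L2_0 i).
    apply: aeW => x _; have := H1Y0 R; congr H1Y; apply/funext => y; by rewrite mxE.
  + move=> k; have := H1S_comb c 0 oS bS (Hq k) (Hq k).
    by congr H1S; apply/funext => x; rewrite [RHS]mxE mul0r addr0.
  + by apply: aeW => p _; rewrite !mE.
Qed.

(** For gamma = infinity the oscillating column may have any square-integrable profile in x, not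
    only one affine in xbar; the twist uses this for a profile that involves the gradient of
    [phi]. *)
Lemma Hrel_infty_column (f : R -> R) (v : R * R -> 'cV[R]_3) :
  bddY f -> avg f = 0 -> (forall k, L2 leb2 S (fun x => v x k 0)) ->
  Hrel GammaInfty S (fun p => sym (cols3 (f p.2 *: v p.1) 0 0)).
Proof.
move=> bf f0 Lv; split.
  apply: L2mx_sym_cols3; [|exact L2_0|exact L2_0].
  move=> k; have := L2_tensor3 oS (Lv k) (bddY_L2 bf).
  by congr L2; apply/funext => p; rewrite [RHS]mxE mulrC.
exists (fun p => primitive f p.2 *: v p.1), (fun p => f p.2 *: v p.1).
exists (fun=> 0), (fun=> 0), (fun=> 0); split.
- move=> i; have := L2S_H1Y_tensor oS (Lv i) bf f0.
  by congr L2S_H1Y; apply/funext => p; rewrite [RHS]mxE mulrC.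
- move=> i; have := H1S0; congr H1S; apply/funext => x; by rewrite mxE.
- exact: aeW.
Qed.

End StrainGenerators.

(** * Identification of the correctors *)

Section Correctors.
Context (R : realType) (gamma : regime) (S : set (R * R)).
Hypotheses (oS : open S) (bS : bounded_set S).
Context (mu lam : R -> R) (c : R).
Hypotheses (c0 : 0 < c) (bmu : bddY mu) (blam : bddY lam).
Hypothesis mulam : {ae leb1, forall y, Y y -> c <= mu y /\ 0 <= lam y}.
Context (phi phi2 phi3 : R * R -> R).
Hypothesis Hphi : torsion_function S phi phi2 phi3.
Local Notation RL := (measurableTypeR R).
Local Notation SY := (S `*` Y : set (RL * RL * RL)).
Local Notation pair := (pairing S (Qiso mu lam)).
Implicit Types (F G : (R * R) * R -> 'M[R]_3).

Let mSY := measurable_SY oS.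
Let mS := open_measurable_plane oS.

Let mu_c : {ae leb1, forall y, Y y -> c <= mu y}.
Proof. by apply: (ae_mono (m := leb1) _ mulam) => y H /H[]. Qed.

(** The Lamé stress mu (A + A^T) + lam tr(A) I. Exhibiting it as a matrix presents the pairing as a
    sum of products of L^2 functions. *)
Definition stress (y : R) (A : 'M[R]_3) : 'M[R]_3 :=
  \matrix_(i, j) (mu y * (A i j + A j i) + lam y * ((A 0 0 + A 1 1 + A 2%:R 2%:R) * (i == j)%:R)).

Lemma Lform_stress y (A B : 'M[R]_3) :
  Lform (Qiso mu lam) y A B = \sum_(i < 3) \sum_(j < 3) stress y A i j * B i j.
Proof. by rewrite LformE !sum3E !mxE /=; ring. Qed.

Lemma L2mx_stress F : L2mx leb3 SY F -> L2mx leb3 SY (fun p => stress p.2 (F p)).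
Proof.
move=> LF i j.
have L1 := bddY_L2M oS bmu (L2D mSY (LF i j) (LF j i)).
have Ltr := L2D mSY (L2D mSY (LF 0 0) (LF 1 1)) (LF 2%:R 2%:R).
have L2' := bddY_L2M oS blam (L2Z mSY (i == j)%:R Ltr).
have := L2D mSY L1 L2'; congr L2; apply/funext => p.
by rewrite mxE; congr (_ + lam _ * _); rewrite mulrC.
Qed.

Lemma pairing_integrable F G : L2mx leb3 SY F -> L2mx leb3 SY G ->
  leb3.-integrable SY (EFin \o (fun p => Lform (Qiso mu lam) p.2 (F p) (G p))).
Proof.
move=> /L2mx_stress LF LG.
have -> : (fun p => Lform (Qiso mu lam) p.2 (F p) (G p)) =
  (fun p => \sum_(i < 3) \sum_(j < 3) stress p.2 (F p) i j * G p i j).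
  by apply/funext => p; rewrite Lform_stress.
apply: (integrable_sumR mSY) => i; apply: (integrable_sumR mSY) => j.
exact (L2_mul mSY (LF i j) (LG i j)).
Qed.

Lemma pairing_measurable F G : L2mx leb3 SY F -> L2mx leb3 SY G ->
  measurable_fun SY (fun p => Lform (Qiso mu lam) p.2 (F p) (G p)).
Proof. by move=> LF LG; have /measurable_EFinP := measurable_int _ (pairing_integrable LF LG). Qed.

Lemma pairingC F G : pair F G = pair G F.
Proof. by rewrite /pairing; apply: eq_Rintegral => p _; rewrite !LformE; ring. Qed.

Lemma pairing_combr s t F G G' : L2mx leb3 SY F -> L2mx leb3 SY G -> L2mx leb3 SY G' ->
  pair F (fun p => s *: G p + t *: G' p) = s * pair F G + t * pair F G'.
Proof.
move=> LF LG LG'.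
have i1 := pairing_integrable LF LG; have i2 := pairing_integrable LF LG'.
rewrite /pairing -(RintegralZl s mSY i1) -(RintegralZl t mSY i2).
rewrite -(RintegralD mSY (integrableZR mSY s i1) (integrableZR mSY t i2)).
by apply: eq_Rintegral => p _; rewrite !LformE !combE; ring.
Qed.

Lemma pairing_combl s t F F' G : L2mx leb3 SY F -> L2mx leb3 SY F' -> L2mx leb3 SY G ->
  pair (fun p => s *: F p + t *: F' p) G = s * pair F G + t * pair F' G.
Proof.
by move=> LF LF' LG; rewrite pairingC pairing_combr// (pairingC G F) (pairingC G F').
Qed.

Lemma pairing_ae F F' G : L2mx leb3 SY F -> L2mx leb3 SY F' -> L2mx leb3 SY G ->
  {ae leb3, forall p, SY p -> F p = F' p} -> pair F G = pair F' G.
Proof.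
move=> LF LF' LG E; apply: (ae_eq_Rintegral (m := leb3) mSY).
- exact (pairing_measurable LF LG).
- exact (pairing_measurable LF' LG).
- by apply: (ae_mono (m := leb3) _ E) => p Ep Dp; rewrite (Ep Dp).
Qed.

(* E^(i+1) = weight i * (e_1 (x) e_1) for i < 3; the index 3 is the twist, for
   which weight is the default value 0 of nth. *)
Definition weight (i : nat) (x : R * R) : R := nth 0 [:: 1; - x.1; - x.2] i.

Lemma L2_weight i : L2 leb2 S (weight i).
Proof.
case: i => [|[|[|i]]]; rewrite /weight/=.
- exact (L2_cst mS (leb2_bounded_fin oS bS) 1).
- exact (L2N mS (L2_fst oS bS)).
- exact (L2N mS (L2_snd oS bS)).
- by under eq_fun do rewrite nth_nil; exact: L20.
Qed.

Lemma weight_bounded i : exists C, forall x, S x -> `|weight i x| <= C.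
Proof.
have [A A0 SA] := bounded_plane bS; exists (1 + A) => x /SA[x1 x2].
move: i => [|[|[|i]]]; rewrite /weight/= ?normrN ?normr1 ?nth_nil ?normr0.
- by rewrite lerDl ltW.
- by rewrite (le_trans (ltW x1))// lerDr.
- by rewrite (le_trans (ltW x2))// lerDr.
- by rewrite addr_ge0// ltW.
Qed.

(* The entries (2,2) and (3,3) of the stress of the claimed strain with index
   i < 3 are - transverse_stress * weight i. *)
Definition transverse_stress : R -> R :=
  match gamma with GammaZero => fun=> 0 | GammaInfty => g_infty mu lam end.

Local Notation bet := (beta_eff mu lam gamma).

Lemma transverse_stressP :
  if gamma is GammaZero then forall y, transverse_stress y = 0
  else bddY transverse_stress /\ avg transverse_stress = 0.
Proof.
rewrite /transverse_stress; case: gamma => //; split.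
  exact: (bddY_g_infty c0).
exact: (avg_g_infty c0).
Qed.

Lemma bddY_transverse_stress : bddY transverse_stress.
Proof.
by rewrite /transverse_stress; case: gamma; [exact: bddY_cst|exact: (bddY_g_infty c0)].
Qed.

(** Brings both regimes to the form diag(d, m, m) with the properties used later: mean one turns
    [d - 1] into a y-derivative, the condition on [m] is the one of [Hrel_section], and the last
    clause gives the axial and transverse stresses. *)
Lemma stretchE : exists d m : R -> R,
  [/\ bddY d /\ avg d = 1, bddY m,
      if gamma is GammaInfty then exists s, forall y, m y = s else True,
      forall y, stretch mu lam gamma y = diag3 (d y) (m y) (m y)
    & {ae leb1, forall y, Y y ->
        2 * mu y * d y + lam y * (d y + 2 * m y) = bet /\
        2 * mu y * m y + lam y * (d y + 2 * m y) = - transverse_stress y}].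
Proof.
rewrite /transverse_stress; case: gamma => /=.
- have bb := bddY_beta c0 bmu blam mulam; have bc := beta_ge c0 mulam.
  have bnu := bddY_nu c0 bmu blam mulam.
  pose d y := hmean (beta mu lam) / beta mu lam y.
  have bd : bddY d by exact: bddYM (bddY_cst _) (bddYV c0 bb bc).
  exists d, (fun y => - (d y * nu mu lam y)); split=> //.
  + split=> //; exact (avg_hmean_div c0 bb bc).
  + exact: bddYN (bddYM bd bnu).
  + by move=> y; rewrite !diag3E mx3Z !mulr0 mulr1 mulrN.
  + apply: (ae_mono2 (m := leb1) _ mulam bc) => y H Hb Yy.
    have [cm l0] := H Yy; have cb := Hb Yy.
    move: cb; rewrite /d; move: (hmean _) => hm cb.
    have b0 : beta mu lam y != 0 by rewrite gt_eqF// (lt_le_trans c0).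
    have m0 : 0 < mu y by exact: lt_le_trans c0 cm.
    have s0 : mu y + lam y != 0 by rewrite gt_eqF// ltr_wpDr.
    (* The defining property of the Poisson ratio: under diag(1, -nu, -nu) the lateral stress
       vanishes. *)
    have nuE : lam y - 2 * nu mu lam y * (mu y + lam y) = 0 by rewrite /nu; field.
    split.
      have -> : 2 * mu y * (hm / beta mu lam y) +
          lam y * (hm / beta mu lam y + 2 * - (hm / beta mu lam y * nu mu lam y)) =
          hm / beta mu lam y * beta mu lam y by rewrite /beta; ring.
      by rewrite mulfVK.
    transitivity (hm / beta mu lam y * (lam y - 2 * nu mu lam y * (mu y + lam y))); first by ring.
    by rewrite nuE mulr0 oppr0.
- pose d y := beta_infty mu lam / Mmod mu lam y + 2 * nu_infty mu lam * (lam y / Mmod mu lam y).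
  exists d, (fun=> - nu_infty mu lam); split=> //.
  + split; last exact (avg_stretch_infty c0 bmu blam mulam).
    apply: bddYD; apply: bddYM (bddY_cst _) _.
      exact (bddY_inv_Mmod c0 bmu blam mulam).
    exact (bddY_lam_Mmod c0 bmu blam mulam).
  + exact: bddY_cst.
  + by exists (- nu_infty mu lam).
  + apply: (ae_mono (m := leb1) _ mulam) => y H Yy; have [cm l0] := H Yy.
    rewrite /g_infty /d /Mmod; move: (beta_infty _ _) (nu_infty _ _) (mu y) (lam y) cm l0.
    move=> b n m l cm l0; have M0 : 2 * m + l != 0.
      have := lt_le_trans c0 cm; move: l0; clear; move=> l0 m0.
      by rewrite gt_eqF// ltr_wpDr// mulr_gt0.
    by split; field.
Qed.

Definition claimed (i : 'I_4) (p : (R * R) * R) : 'M[R]_3 :=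
  if (i < 3)%N then weight i p.1 *: stretch mu lam gamma p.2
  else torsion_strain mu phi2 phi3 p.

Local Notation a2 := (fun x : R * R => phi2 x - x.2).
Local Notation a3 := (fun x : R * R => phi3 x + x.1).

Lemma Lform_claimed_bend (i : 'I_4) : (i < 3)%N -> {ae leb3, forall p, SY p -> forall G : 'M[R]_3,
  Lform (Qiso mu lam) p.2 (claimed i p) G =
  bet * (weight i p.1 * G 0 0) -
  transverse_stress p.2 * (weight i p.1 * (G 1 1 + G 2%:R 2%:R))}.
Proof.
move=> i3; have [d [m [_ _ _ sE H]]] := stretchE.
apply: (ae_mono (m := leb3) _ (ae_lift_y H)) => p Hp [_ Yp] G.
have [E1 E2] := Hp Yp.
rewrite /claimed i3 sE diag3E mx3Z LformE !mx3E !mulr0.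
rewrite -E1 -[X in _ - X]opprK -mulNr -E2; ring.
Qed.

(** The factor [hmean mu / mu] cancels the shear modulus; the trace is zero, so [lam] does not
    enter. *)
Lemma Lform_claimed_twist (i : 'I_4) : ~~ (i < 3)%N -> {ae leb3, forall p, SY p -> forall G : 'M[R]_3,
  Lform (Qiso mu lam) p.2 (claimed i p) G =
  hmean mu * (a2 p.1 * (G 0 1 + G 1 0) + a3 p.1 * (G 0 2%:R + G 2%:R 0))}.
Proof.
move=> /negbTE i3.
apply: (ae_mono (m := leb3) _ (ae_lift_y mu_c)) => p Hp [_ Yp] G.
have m0 : mu p.2 != 0 by rewrite gt_eqF// (lt_le_trans c0)// Hp.
rewrite /claimed i3 /torsion_strain mx3Z LformE !mx3E.
by move: (hmean mu) => h; field.
Qed.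

Let L2_phi2 : L2 leb2 S phi2. Proof. by have [[]] := Hphi. Qed.
Let L2_phi3 : L2 leb2 S phi3. Proof. by have [[]] := Hphi. Qed.
Let L2_a2 : L2 leb2 S a2. Proof. exact (L2B mS L2_phi2 (L2_snd oS bS)). Qed.
Let L2_a3 : L2 leb2 S a3. Proof. exact (L2D mS L2_phi3 (L2_fst oS bS)). Qed.

Lemma skewK (i : 'I_4) : Defs.skew (nth 0 [:: 0; K2 R; K3 R; K4 R] i).
Proof.
case: i => [[|[|[|[|//]]]] ?] /=; [|exact: skew_tens|exact: skew_tens|exact: skew_tens].
by rewrite /Defs.skew trmx0 oppr0.
Qed.

Lemma Estrain_cols3 (i : 'I_4) x : Estrain i x =
  sym (cols3 (nth 0 [:: 0; K2 R; K3 R; K4 R] i *m xvec x + (i == 0 :> nat)%:R *: evec R 0) 0 0).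
Proof.
by rewrite /Estrain; case: i => [[|[|[|[|//]]]] ?] /=; rewrite strainE ?scale1r ?scale0r.
Qed.

Lemma L2mx_Estrain (i : 'I_4) : L2mx leb3 SY (fun p => Estrain i p.1).
Proof.
have -> : (fun p : (R * R) * R => Estrain i p.1) = fun p =>
  sym (cols3 (nth 0 [:: 0; K2 R; K3 R; K4 R] i *m xvec p.1 + (i == 0 :> nat)%:R *: evec R 0) 0 0).
  by apply/funext => p; rewrite Estrain_cols3.
apply: (L2mx_sym_cols3 oS); [move=> k|exact (L2_0 S)|exact (L2_0 S)].
set K := nth _ _ _; set a := _%:R.
have -> : (fun p : (R * R) * R => (K *m xvec p.1 + a *: evec R 0) k 0) =
      (fun p => (K k 1 * p.1.1 + K k 2%:R * p.1.2) + a * evec R 0 k 0).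
  by apply/funext => p; rewrite mxE xvecE mulmx_col3 mulr0 add0r [X in _ + X]mxE.
apply: (L2_lift1 oS (a := fun x : R * R => (K k 1 * x.1 + K k 2%:R * x.2) + a * evec R 0 k 0)).
exact (L2D mS (L2D mS (L2Z mS _ (L2_fst oS bS)) (L2Z mS _ (L2_snd oS bS)))
    (L2_cst mS (leb2_bounded_fin oS bS) _)).
Qed.

Let bdmu : bddY (fun y => hmean mu / mu y).
Proof. exact: bddYM (bddY_cst _) (bddY_inv_mu c0 bmu mulam). Qed.

Let bdmu1 : bddY (fun y => hmean mu / mu y - 1) /\ avg (fun y => hmean mu / mu y - 1) = 0.
Proof.
split; first exact: bddYB bdmu (bddY_cst 1).
rewrite (avgB bdmu (bddY_cst 1)) avg_cst (avg_hmean_div c0 bmu mu_c).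
by rewrite subrr.
Qed.

(** The in-plane gradient has the Cauchy-Riemann form with diagonal [weight i] and rotation [r], so
    its symmetric part is [weight i] times the identity. With z = x_2 + i x_3 the potentials are z,
    -z^2/2 and i z^2/2, whose derivatives have real parts 1, -x_2 and -x_3. *)
Lemma bend_fields (i : 'I_4) : (i < 3)%N ->
  exists (r : R * R -> R) (q q2 q3 : R * R -> 'cV[R]_3),
  [/\ forall k, H1S S (fun x => q x k 0) (fun x => q2 x k 0) (fun x => q3 x k 0),
      forall x, q2 x = col3 0 (weight i x) (r x) &
      forall x, q3 x = col3 0 (- r x) (weight i x)].
Proof.
have H0 := H1S0 oS bS; have Hsq s t := H1S_comb s t oS bS (H1S_sq_fst oS bS) (H1S_sq_snd oS bS).
have Hfs := H1S_comb (-1) 0 oS bS (H1S_fst_snd oS bS) (H1S_fst_snd oS bS).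
case: i => [[|[|[|//]]] ?] _; rewrite /weight/=.
- exists (fun=> 0), (fun x => col3 0 x.1 x.2), (fun=> col3 0 1 0), (fun=> col3 0 0 1).
  split=> // [|x]; last by rewrite oppr0.
  apply: ord3P.
  + by move: H0; congr H1S; apply/funext => x; rewrite !col3E.
  + by have := H1S_fst oS bS; congr H1S; apply/funext => x; rewrite !col3E.
  + by have := H1S_snd oS bS; congr H1S; apply/funext => x; rewrite !col3E.
- exists (fun x => - x.2), (fun x => col3 0 (- 2^-1 * x.1 ^+ 2 + 2^-1 * x.2 ^+ 2) (- (x.1 * x.2))).
  exists (fun x => col3 0 (- x.1) (- x.2)), (fun x => col3 0 x.2 (- x.1)).
  split=> // [|x]; last by rewrite opprK.
  apply: ord3P.
  + by move: H0; congr H1S; apply/funext => x; rewrite !col3E.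
  + have := Hsq (- 2^-1) 2^-1; congr H1S; apply/funext => x; rewrite !col3E//; by field.
  + by move: Hfs; congr H1S; apply/funext => x; rewrite !col3E; ring.
- exists (fun x => x.1), (fun x => col3 0 (- (x.1 * x.2)) (2^-1 * x.1 ^+ 2 + - 2^-1 * x.2 ^+ 2)).
  exists (fun x => col3 0 (- x.2) x.1), (fun x => col3 0 (- x.1) (- x.2)).
  split=> //; apply: ord3P.
  + by move: H0; congr H1S; apply/funext => x; rewrite !col3E.
  + by move: Hfs; congr H1S; apply/funext => x; rewrite !col3E; ring.
  + have := Hsq 2^-1 (- 2^-1); congr H1S; apply/funext => x; rewrite !col3E//; by field.
Qed.

Lemma col3_0 : 0 = col3 0 0 0 :> 'cV[R]_3.
Proof. by rewrite [LHS]col3P !mxE. Qed.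

Lemma col3Z (t a b e : R) : t *: col3 a b e = col3 (t * a) (t * b) (t * e).
Proof. by rewrite [LHS]col3P !mxE. Qed.

Lemma col3D (a b e a' b' e' : R) : col3 a b e + col3 a' b' e' = col3 (a + a') (b + b') (e + e').
Proof. by rewrite [LHS]col3P !mxE. Qed.

Lemma Estrain_bend (i : 'I_4) x : (i < 3)%N ->
  nth 0 [:: 0; K2 R; K3 R; K4 R] i *m xvec x + (i == 0 :> nat)%:R *: evec R 0 =
  col3 (weight i x) 0 0.
Proof.
case: i => [[|[|[|//]]] ?] _; rewrite /weight/= ?K2_xvec ?K3_xvec ?mul0mx evec0E;
  by rewrite col3Z ?col3_0 col3D !mulr0 ?mul0r ?mulr1 !addr0 ?add0r.
Qed.

(** The difference splits into the axial part with the mean-zero factor [d - 1] and the transverse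
    part with the factor [m], which is an in-plane gradient by [bend_fields]. *)
Lemma Hrel_claimed_bend (i : 'I_4) : (i < 3)%N ->
  Hrel gamma S (fun p => claimed i p - Estrain i p.1).
Proof.
move=> i3; have [d [m [[bd d1] bm mc sE _]]] := stretchE.
have [r [q [q2 [q3 [Hq q2E q3E]]]]] := bend_fields i3.
have bd1 : bddY (fun y => d y - 1) by exact: bddYB bd (bddY_cst 1).
have ad1 : avg (fun y => d y - 1) = 0 by rewrite (avgB bd (bddY_cst 1)) avg_cst d1 subrr.
have := Hrel_comb oS bS 1 1 (Hrel_oscillation oS bS gamma (i == 0 :> nat)%:R bd1 ad1 (skewK i))
  (Hrel_section oS bS bm mc Hq).
congr Hrel; apply/funext => p; rewrite Estrain_cols3 Estrain_bend// q2E q3E.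
rewrite /claimed i3 sE diag3E mx3Z col3_0 !col3Z !sym_cols3E !mx3Z mx3B mx3D.
by apply: matrix3P; rewrite !mx3E; field.
Qed.

(** Let h be [hmean mu / mu]. For gamma = 0, h times the gradient of [phi] is an in-plane gradient
    with a y-dependent potential, and [h - 1] multiplies the rotation [K4 *m xvec]. For gamma =
    infinity that potential may not oscillate: the gradient of [phi] is kept with factor 1, and
    [h - 1] multiplies the full shear field in the first column. *)
Lemma Hrel_claimed_twist (i : 'I_4) : ~~ (i < 3)%N ->
  Hrel gamma S (fun p => claimed i p - Estrain i p.1).
Proof.
move=> i3; have [bd1 ad1] := bdmu1; have [Hp _ _] := Hphi.
have iE : i = 3%:R by apply/val_inj; case: i i3 => [[|[|[|[|]]]] ?].
have Hq k : H1S S (fun x => col3 (phi x) 0 0 k 0) (fun x => col3 (phi2 x) 0 0 k 0)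
    (fun x => col3 (phi3 x) 0 0 k 0).
  have H0 := H1S0 oS bS; move: k; apply: ord3P.
  - by move: Hp; congr H1S; apply/funext => x; rewrite !col3E.
  - by move: H0; congr H1S; apply/funext => x; rewrite !col3E.
  - by move: H0; congr H1S; apply/funext => x; rewrite !col3E.
have EE (p : (R * R) * R) : Estrain i p.1 = sym (cols3 (col3 0 (- p.1.2) p.1.1) 0 0).
  by rewrite Estrain_cols3 iE /= scale0r addr0 K4_xvec.
case: gamma.
- have := Hrel_comb oS bS 1 1 (Hrel_oscillation oS bS GammaZero 0 bd1 ad1 (skewK i))
    (Hrel_section (gamma := GammaZero) oS bS bdmu I Hq).
  congr Hrel; apply/funext => p; rewrite EE /claimed (negbTE i3) iE /= K4_xvec scale0r addr0.
  rewrite /torsion_strain col3_0 !col3Z !sym_cols3E !mx3Z mx3B mx3D.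
  by move: (hmean mu / mu p.2) => h; apply: matrix3P; rewrite !mx3E; field.
- have Lv k : L2 leb2 S (fun x => col3 0 (phi2 x - x.2) (phi3 x + x.1) k 0).
    move: k; apply: ord3P.
    + by under eq_fun do rewrite col3E; exact: L20.
    + by under eq_fun do rewrite col3E; exact L2_a2.
    + by under eq_fun do rewrite col3E; exact L2_a3.
  have m1 : exists s : R, R -> 1 = s by exists 1.
  have := Hrel_comb oS bS 1 1 (Hrel_infty_column oS bS bd1 ad1 Lv)
    (Hrel_section (gamma := GammaInfty) oS bS (bddY_cst 1) m1 Hq).
  congr Hrel; apply/funext => p; rewrite EE /claimed (negbTE i3).
  rewrite /torsion_strain col3_0 !col3Z !sym_cols3E !mx3Z mx3B mx3D.
  by move: (hmean mu / mu p.2) => h; apply: matrix3P; rewrite !mx3E; field.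
Qed.

Lemma Hrel_claimed i : Hrel gamma S (fun p => claimed i p - Estrain i p.1).
Proof.
by have [i3|i3] := boolP (i < 3)%N; [exact: Hrel_claimed_bend|exact: Hrel_claimed_twist].
Qed.

Lemma L2mx_claimed i : L2mx leb3 SY (claimed i).
Proof.
have [L _] := Hrel_claimed i; have := L2mx_comb oS 1 1 L (@L2mx_Estrain i).
by congr L2mx; apply/funext => p; rewrite !scale1r subrK.
Qed.

Lemma pairing_claimed_bend (i : 'I_4) G : (i < 3)%N -> L2mx leb3 SY G ->
  pair (claimed i) G =
  bet * \int[leb3]_(p in SY) (weight i p.1 * G p 0 0) -
  \int[leb3]_(p in SY) (transverse_stress p.2 * (weight i p.1 * (G p 1 1 + G p 2%:R 2%:R))).
Proof.
move=> i3 LG; have Lw := L2_lift1 oS (L2_weight i).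
have i1 : leb3.-integrable SY (EFin \o (fun p => weight i p.1 * G p 0 0)).
  exact (L2_mul mSY Lw (LG 0 0)).
have i2 : leb3.-integrable SY (EFin \o (fun p => transverse_stress p.2 *
    (weight i p.1 * (G p 1 1 + G p 2%:R 2%:R)))).
  have := L2_mul mSY (bddY_L2M oS bddY_transverse_stress Lw) (L2D mSY (LG 1 1) (LG 2%:R 2%:R)).
  by congr integrable; apply/funext => p /=; rewrite mulrA.
have j1 := integrableZR mSY bet i1.
rewrite -(RintegralZl bet mSY i1) -(RintegralB mSY j1 i2).
apply: (ae_eq_Rintegral (m := leb3) mSY).
- exact (pairing_measurable (@L2mx_claimed i) LG).
- by have /measurable_EFinP := measurable_int _ (integrableBR mSY j1 i2).
- by apply: (ae_mono (m := leb3) _ (Lform_claimed_bend i3)) => p H Dp; rewrite (H Dp).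
Qed.

Lemma pairing_claimed_twist (i : 'I_4) G : ~~ (i < 3)%N -> L2mx leb3 SY G ->
  pair (claimed i) G =
  hmean mu * \int[leb3]_(p in SY)
    (a2 p.1 * (G p 0 1 + G p 1 0) + a3 p.1 * (G p 0 2%:R + G p 2%:R 0)).
Proof.
move=> i3 LG.
have i1 : leb3.-integrable SY (EFin \o (fun p => a2 p.1 * (G p 0 1 + G p 1 0) +
    a3 p.1 * (G p 0 2%:R + G p 2%:R 0))).
  exact (integrableDR mSY (L2_mul mSY (L2_lift1 oS L2_a2) (L2D mSY (LG 0 1) (LG 1 0)))
    (L2_mul mSY (L2_lift1 oS L2_a3) (L2D mSY (LG 0 2%:R) (LG 2%:R 0)))).
have j1 := integrableZR mSY (hmean mu) i1.
rewrite -(RintegralZl (hmean mu) mSY i1).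
apply: (ae_eq_Rintegral (m := leb3) mSY).
- exact (pairing_measurable (@L2mx_claimed i) LG).
- by have /measurable_EFinP := measurable_int _ j1.
- by apply: (ae_mono (m := leb3) _ (Lform_claimed_twist i3)) => p H Dp; rewrite (H Dp).
Qed.

Lemma sym_cols3_entries (v n2 n3 : 'cV[R]_3) (A := sym (cols3 v n2 n3)) :
  [/\ A 0 0 = v 0 0, A 1 1 = n2 1 0, A 2%:R 2%:R = n3 2%:R 0,
      A 0 1 + A 1 0 = v 1 0 + n2 0 0 & A 0 2%:R + A 2%:R 0 = v 2%:R 0 + n3 0 0].
Proof. by rewrite /A (col3P v) (col3P n2) (col3P n3) sym_cols3E !mx3E !col3E; split=> //; field. Qed.

Lemma sym_sym (A : 'M[R]_3) : sym (sym A) = sym A.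
Proof. by apply/matrixP => i j; rewrite !mxE; field. Qed.

Lemma pairing_claimed_orthogonal i eta : Hrel gamma S eta -> pair (claimed i) eta = 0.
Proof.
move=> Heta; have [Leta _] := Heta.
have [v [n2 [n3 [Lv Eeta F1 F2 F3]]]] :=
  Hrel_decomp oS bS Heta transverse_stressP.
have Ls : L2mx leb3 SY (fun p => sym (cols3 (v p) (n2 p) (n3 p))).
  by apply: (L2mx_sym_cols3 oS) => k; have [] := Lv k.
(* [pairing_ae] replaces the left argument, hence the two swaps around it. *)
rewrite pairingC (pairing_ae Leta Ls (@L2mx_claimed i) Eeta) pairingC.
have [i3|i3] := boolP (i < 3)%N.
  rewrite pairing_claimed_bend//.
  have [_ Ln21 _] := Lv 1; have [_ _ Ln32] := Lv 2%:R.
  have Lw := L2_weight i; have wC := weight_bounded i.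
  have bt := bddY_transverse_stress.
  have Ltw := bddY_L2M oS bt (L2_lift1 oS Lw).
  have [z1 _] := F3 1 _ Lw wC; have [_ z2] := F3 2%:R _ Lw wC.
  have -> : \int[leb3]_(p in SY) (weight i p.1 * sym (cols3 (v p) (n2 p) (n3 p)) 0 0) = 0.
    rewrite -[RHS](F1 0 _ Lw); apply: eq_Rintegral => p _.
    by have [-> _ _ _ _] := sym_cols3_entries (v p) (n2 p) (n3 p).
  rewrite mulr0 sub0r; apply/eqP; rewrite oppr_eq0; apply/eqP.
  rewrite -[RHS](addr0 0) -[X in X + _]z1 -[X in _ + X]z2.
  have i1 := L2_mul mSY Ltw Ln21; have i2 := L2_mul mSY Ltw Ln32.
  transitivity (\int[leb3]_(p in SY) (transverse_stress p.2 * weight i p.1 * n2 p 1 0 +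
    transverse_stress p.2 * weight i p.1 * n3 p 2%:R 0)).
    apply: eq_Rintegral => p _.
    by have [_ -> -> _ _] := sym_cols3_entries (v p) (n2 p) (n3 p); rewrite mulrDr mulrDr !mulrA.
  rewrite (RintegralD mSY i1 i2); congr (_ + _); apply: eq_Rintegral => p _; by rewrite mulrA.
rewrite pairing_claimed_twist//.
have [Lv1 _ _] := Lv 1; have [Lv2 _ _] := Lv 2%:R; have [_ Ln2 Ln3] := Lv 0.
have A2 := L2_lift1 oS L2_a2; have A3 := L2_lift1 oS L2_a3.
have z1 := F1 1 _ L2_a2; have z2 := F1 2%:R _ L2_a3.
have z3 := F2 0 _ _ L2_a2 L2_a3 (torsion_euler_lagrange oS bS Hphi).
have i1 := L2_mul mSY A2 Lv1; have i2 := L2_mul mSY A3 Lv2.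
have i3' := integrableDR mSY (L2_mul mSY A2 Ln2) (L2_mul mSY A3 Ln3).
transitivity (hmean mu * (\int[leb3]_(p in SY) (a2 p.1 * v p 1 0 + a3 p.1 * v p 2%:R 0 +
   (a2 p.1 * n2 p 0 0 + a3 p.1 * n3 p 0 0)))).
  congr (_ * _); apply: eq_Rintegral => p _.
  have [_ _ _ -> ->] := sym_cols3_entries (v p) (n2 p) (n3 p).
  by rewrite !mulrDr addrACA.
rewrite (RintegralD mSY (integrableDR mSY i1 i2) i3') (RintegralD mSY i1 i2).
by rewrite z1 z2 z3 !addr0 mulr0.
Qed.

Lemma Qiso_ge0 y (A : 'M[R]_3) : c <= mu y -> 0 <= lam y -> 0 <= Qiso mu lam y A.
Proof.
move=> cm l0; rewrite /Qiso addr_ge0//; apply: mulr_ge0 => //.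
- by rewrite mulr_ge0// (le_trans (ltW c0)).
- by apply: sumr_ge0 => i _; apply: sumr_ge0 => j _; exact: sqr_ge0.
- exact: sqr_ge0.
Qed.

Lemma Qiso_eq0 y (A : 'M[R]_3) : c <= mu y -> 0 <= lam y -> Qiso mu lam y A = 0 -> sym A = 0.
Proof.
move=> cm l0 Q0; apply/matrixP => i j; rewrite [RHS]mxE.
have m0 : 0 < 2 * mu y by rewrite mulr_gt0// (lt_le_trans c0).
have s0 : 0 <= sqnorm (sym A).
  by apply: sumr_ge0 => k _; apply: sumr_ge0 => l _; exact: sqr_ge0.
have : sqnorm (sym A) == 0.
  move/eqP: Q0; rewrite /Qiso paddr_eq0.
  - by rewrite mulf_eq0 gt_eqF//= => /andP[].
  - by rewrite mulr_ge0// ltW.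
  - by rewrite mulr_ge0// sqr_ge0.
rewrite psumr_eq0 => [/allP/(_ i)|k _]; last by apply: sumr_ge0 => l _; exact: sqr_ge0.
rewrite mem_index_enum /= => /(_ isT).
rewrite psumr_eq0 => [/allP/(_ j)|l _]; last exact: sqr_ge0.
by rewrite mem_index_enum /= => /(_ isT); rewrite sqrf_eq0 => /eqP.
Qed.

Lemma pairing_sqr_ge0 F : L2mx leb3 SY F -> 0 <= pair F F.
Proof.
move=> LF; have mF := pairing_measurable LF LF.
have -> : pair F F = \int[leb3]_(p in SY) `|Lform (Qiso mu lam) p.2 (F p) (F p)|.
  apply: (ae_eq_Rintegral (m := leb3) mSY mF); first exact: measurableT_comp.
  apply: (ae_mono (m := leb3) _ (ae_lift_y mulam)) => p H [_ Yp].
  by have [cm l0] := H Yp; rewrite -QisoE ger0_norm// Qiso_ge0.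
by apply: Rintegral_ge0.
Qed.

Lemma pairing_sqr_eq0 F : L2mx leb3 SY F -> pair F F = 0 ->
  {ae leb3, forall p, SY p -> sym (F p) = 0}.
Proof.
move=> LF F0; have iF := pairing_integrable LF LF.
have ge0 : {ae leb3, forall p, SY p -> 0 <= Lform (Qiso mu lam) p.2 (F p) (F p)}.
  apply: (ae_mono (m := leb3) _ (ae_lift_y mulam)) => p H [_ Yp].
  by have [cm l0] := H Yp; rewrite -QisoE Qiso_ge0.
have := Rintegral_ge0_eq0 (m := leb3) mSY iF ge0 F0.
move=> H0; apply: (ae_mono2 (m := leb3) _ (ae_lift_y mulam) H0) => p H Hp Dp.
have [cm l0] := H Dp.2; apply: (Qiso_eq0 cm l0); rewrite QisoE.
exact: Hp.
Qed.

(** The energy controls only the symmetric part; this symmetry lets zero energy imply that a relaxed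
    strain vanishes. *)
Lemma Hrel_sym eta : Hrel gamma S eta -> {ae leb3, forall p, SY p -> sym (eta p) = eta p}.
Proof.
move=> Heta; have [v [n2 [n3 [_ E _ _ _]]]] :=
  Hrel_decomp oS bS Heta transverse_stressP.
by apply: (ae_mono (m := leb3) _ E) => p Ep Dp; rewrite (Ep Dp) sym_sym.
Qed.

Lemma Estrain_entries (j : 'I_4) x (A := Estrain j x : 'M[R]_3) :
  [/\ A 0 0 = if (j < 3)%N then weight j x else 0, A 1 1 = 0, A 2%:R 2%:R = 0,
      A 0 1 + A 1 0 = if (j < 3)%N then 0 else - x.2 &
      A 0 2%:R + A 2%:R 0 = if (j < 3)%N then 0 else x.1].
Proof.
rewrite /A Estrain_cols3; set v := _ + _.
have vE : v = if (j < 3)%N then col3 (weight j x) 0 0 else col3 0 (- x.2) x.1.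
  rewrite /v; case: ifPn => [j3|]; first exact: Estrain_bend.
  case: j {A v} => [[|[|[|[|//]]]] ?] //= _.
  by rewrite K4_xvec scale0r addr0.
have [-> -> -> -> ->] := sym_cols3_entries v 0 0.
by rewrite vE !mxE; case: ifP => _; rewrite !mxE/= ?addr0; split.
Qed.

(** * Values of the correctors, the averaging matrix and the homogenized energy *)

Section solution.
Context (chi : 'I_4 -> (R * R) * R -> 'M[R]_3).
Hypothesis Hchi : correctors gamma S (Qiso mu lam) chi.
Local Notation F := (total_strain chi).

Lemma L2mx_total_strain i : L2mx leb3 SY (F i).
Proof.
have [[L _] _] := Hchi i.
have := L2mx_comb oS 1 1 (@L2mx_Estrain i) L.
by congr L2mx; apply/funext => p; rewrite !scale1r.
Qed.

(** The difference [D] is itself a relaxed strain, and both of its terms are orthogonal to all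
    relaxed strains; hence [pair D D = 0]. *)
Lemma total_strainE i : {ae leb3, forall p, SY p -> F i p = claimed i p}.
Proof.
have [Hchii orth] := Hchi i.
pose D p := F i p - claimed i p.
have HD : Hrel gamma S D.
  have := Hrel_comb oS bS 1 (-1) Hchii (Hrel_claimed i).
  congr Hrel; apply/funext => p; rewrite /D /total_strain scale1r scaleN1r opprB.
  by rewrite addrCA addrA.
have [LD _] := HD.
have DE : (fun p => 1 *: F i p + (-1) *: claimed i p) = D.
  by apply/funext => p; rewrite /D scale1r scaleN1r.
have D0 := pairing_combl 1 (-1) (@L2mx_total_strain i) (@L2mx_claimed i) LD.
rewrite DE (orth _ HD) (pairing_claimed_orthogonal i HD) !mulr0 addr0 in D0.
apply: (ae_mono2 (m := leb3) _ (pairing_sqr_eq0 LD D0) (Hrel_sym HD)) => p s0 sE Dp.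
by apply/eqP; rewrite -subr_eq0 -/(D p) -(sE Dp) (s0 Dp).
Qed.

Lemma pairing_total_strain i G : L2mx leb3 SY G -> pair (F i) G = pair (claimed i) G.
Proof.
move=> LG.
exact (pairing_ae (@L2mx_total_strain i) (@L2mx_claimed i) LG (total_strainE i)).
Qed.

Lemma pairing_total_strain2 i j : pair (F i) (F j) = pair (claimed i) (fun p => Estrain j p.1).
Proof.
have [[Lj _] _] := Hchi j; have [_ orth] := Hchi i.
have LE := @L2mx_Estrain j.
rewrite -(pairing_total_strain i LE).
have FE : (fun p => 1 *: Estrain j p.1 + 1 *: chi j p) = F j.
  by apply/funext => p; rewrite !scale1r.
have [Hj _] := Hchi j.
have := pairing_combr 1 1 (@L2mx_total_strain i) LE Lj.
by rewrite FE (orth _ Hj) mulr0 addr0 mul1r.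
Qed.

Lemma pairing_bend (i j : 'I_4) : (i < 3)%N -> pair (F i) (F j) =
  if (j < 3)%N then bet * \int[leb2]_(x in S) (weight i x * weight j x) else 0.
Proof.
move=> i3; rewrite pairing_total_strain2 (pairing_claimed_bend i3 (@L2mx_Estrain j)).
have -> : \int[leb3]_(p in SY) (transverse_stress p.2 *
    (weight i p.1 * (Estrain j p.1 1 1 + Estrain j p.1 2%:R 2%:R))) = 0.
  rewrite -[RHS](Rintegral0 leb3 SY); apply: eq_Rintegral => p _.
  by have [_ -> -> _ _] := Estrain_entries j p.1; rewrite addr0 !mulr0.
rewrite subr0; have [wC wCE] := weight_bounded i.
case: ifPn => j3.
  have Lw : L2 leb2 S (fun x => weight i x * weight j x).
    apply: (@L2_bddM _ _ _ leb2 S mS _ _ wC (L2_weight i).1 _ (L2_weight j)).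
    exact: aeW.
  rewrite -(Rintegral3_lift1 oS bS Lw); congr (_ * _); apply: eq_Rintegral => p _.
  by have [-> _ _ _ _] := Estrain_entries j p.1; rewrite j3.
rewrite -[RHS](mulr0 bet) -[X in _ = _ * X](Rintegral0 leb3 SY); congr (_ * _).
apply: eq_Rintegral => p _.
by have [-> _ _ _ _] := Estrain_entries j p.1; rewrite (negbTE j3) mulr0.
Qed.

Lemma pairing_twist (i : 'I_4) : ~~ (i < 3)%N -> pair (F i) (F i) = hmean mu * tauS S.
Proof.
move=> i3; rewrite pairing_total_strain2 (pairing_claimed_twist i3 (@L2mx_Estrain i)) (tauSE Hphi).
congr (_ * _).
have [[_ L2p L3p _] _ _] := Hphi; have [Hp _ _] := Hphi.
have L1 := L2_fst oS bS; have L2' := L2_snd oS bS.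
have Ia : leb2.-integrable S (EFin \o (fun x => a2 x * phi2 x + a3 x * phi3 x)).
  exact (integrableDR mS (L2_mul mS L2_a2 L2p) (L2_mul mS L2_a3 L3p)).
have Ib : leb2.-integrable S (EFin \o (fun x => a2 x * - x.2 + a3 x * x.1)).
  exact (integrableDR mS (L2_mul mS L2_a2 (L2N mS L2')) (L2_mul mS L2_a3 L1)).
(* The Euler-Lagrange equation tested with [phi] itself removes the gradient from one factor of the
   energy, leaving the rotation (-x_3, x_2), which is the shear of the fourth basis strain. *)
have -> : torsion_energy S phi2 phi3 = \int[leb2]_(x in S) (a2 x * - x.2 + a3 x * x.1).
  have := RintegralD mS Ia Ib.
  rewrite (torsion_euler_lagrange oS bS Hphi Hp) add0r => <-.
  by apply: eq_Rintegral => x _; ring.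
transitivity (\int[leb3]_(p in SY) (a2 p.1 * - p.1.2 + a3 p.1 * p.1.1)).
  apply: eq_Rintegral => p _.
  by have [_ _ _ -> ->] := Estrain_entries i p.1; rewrite (negbTE i3).
have Ib3 : leb3.-integrable SY (EFin \o (fun p => a2 p.1 * - p.1.2 + a3 p.1 * p.1.1)).
  exact (integrableDR mSY (L2_mul mSY (L2_lift1 oS L2_a2) (L2N mSY (L2_lift1 oS L2')))
    (L2_mul mSY (L2_lift1 oS L2_a3) (L2_lift1 oS L1))).
have := Rintegral_setX12 (m1 := leb2) (m2 := leb1) mS (@measurable_Y R) Ib3.
move=> ->; apply: eq_Rintegral => x _ /=.
exact: avg_cst.
Qed.

Let ord4P (P : 'I_4 -> Prop) : P 0 -> P 1 -> P 2%:R -> P 3%:R -> forall i, P i.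
Proof.
move=> P0 P1 P2 P3 [[|[|[|[|//]]]] p].
- by rewrite (_ : Ordinal p = 0)//; exact: val_inj.
- by rewrite (_ : Ordinal p = 1)//; exact: val_inj.
- by rewrite (_ : Ordinal p = 2%:R)//; exact: val_inj.
- by rewrite (_ : Ordinal p = 3%:R)//; exact: val_inj.
Qed.

Lemma Mmx_diag :
  \int[leb2]_(x in S) x.1 = 0 -> \int[leb2]_(x in S) x.2 = 0 ->
  \int[leb2]_(x in S) (x.1 * x.2) = 0 ->
  Mmx S (Qiso mu lam) chi = diag_mx (\row_j
            [:: bet * \int[leb2]_(x in S) 1;
                bet * \int[leb2]_(x in S) (x.1 ^+ 2);
                bet * \int[leb2]_(x in S) (x.2 ^+ 2);
                hmean mu * tauS S]`_j).
Proof.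
move=> m1 m2 m12.
have L1 := L2_fst oS bS; have L2' := L2_snd oS bS; have fS := leb2_bounded_fin oS bS.
have N1 : \int[leb2]_(x in S) (- x.1) = 0.
  have := RintegralZl (-1) mS (L2_integrable (m := leb2) mS fS L1); rewrite m1 mulr0 => <-.
  by apply: eq_Rintegral => x _; rewrite mulN1r.
have N2 : \int[leb2]_(x in S) (- x.2) = 0.
  have := RintegralZl (-1) mS (L2_integrable (m := leb2) mS fS L2'); rewrite m2 mulr0 => <-.
  by apply: eq_Rintegral => x _; rewrite mulN1r.
have ij (f g : R * R -> R) : (forall x, f x = g x) ->
    \int[leb2]_(x in S) f x = \int[leb2]_(x in S) g x by move=> E; apply: eq_Rintegral => x _.
apply/matrixP; apply: ord4P; apply: ord4P; rewrite [LHS]mxE [RHS]mxE.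
all: rewrite ?[in RHS]mxE /= ?mulr1n ?mulr0n.
all: try (by rewrite pairing_twist).
all: try (by rewrite pairingC pairing_bend).
all: rewrite pairing_bend// /weight /=.
(* The nine entries with both indices below 3 remain, row by row; the off-diagonal ones are, up to
   sign, the three moments of [S] assumed to vanish. *)
- by congr (_ * _); apply: ij => x; rewrite mulr1.
- by rewrite (ij _ _ (fun x => mul1r _)) N1 mulr0.
- by rewrite (ij _ _ (fun x => mul1r _)) N2 mulr0.
- by rewrite (ij _ _ (fun x => mulr1 _)) N1 mulr0.
- by congr (_ * _); apply: ij => x; rewrite mulrNN.
- by rewrite (ij _ _ (fun x => mulrNN _ _)) m12 mulr0.
- by rewrite (ij _ _ (fun x => mulr1 _)) N2 mulr0.
- rewrite (ij _ (fun x => x.1 * x.2)) ?m12 ?mulr0// => x; by rewrite mulrNN mulrC.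
- by congr (_ * _); apply: ij => x; rewrite mulrNN.
Qed.

Lemma bvec_bend (B : (R * R) * R -> 'M[R]_3) (i : 'I_4) : (i < 3)%N -> L2mx leb3 SY B ->
  pair B (F i) = bet * \int[leb3]_(p in SY) (B p 0 0 * weight i p.1) -
    match gamma with
    | GammaZero => 0
    | GammaInfty => \int[leb3]_(p in SY)
        (g_infty mu lam p.2 * (B p 1 1 + B p 2%:R 2%:R) * weight i p.1)
    end.
Proof.
move=> i3 LB; rewrite pairingC.
rewrite (pairing_total_strain i LB) (pairing_claimed_bend i3 LB).
congr (_ * _ - _); first by apply: eq_Rintegral => p _; rewrite mulrC.
rewrite /transverse_stress; case: gamma.
  by rewrite -[RHS](Rintegral0 leb3 SY); apply: eq_Rintegral => p _; rewrite mul0r.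
by apply: eq_Rintegral => p _; rewrite -mulrA [weight _ _ * _]mulrC.
Qed.

Lemma bvec_twist (B : (R * R) * R -> 'M[R]_3) (i : 'I_4) : ~~ (i < 3)%N -> L2mx leb3 SY B ->
  pair B (F i) = hmean mu * \int[leb2]_(x in S)
    (a2 x * avg (fun y => B (x, y) 0 1 + B (x, y) 1 0) +
     a3 x * avg (fun y => B (x, y) 0 2%:R + B (x, y) 2%:R 0)).
Proof.
move=> i3 LB; rewrite pairingC.
rewrite (pairing_total_strain i LB) (pairing_claimed_twist i3 LB).
congr (_ * _).
have LB1 := L2D mSY (LB 0 1) (LB 1 0); have LB2 := L2D mSY (LB 0 2%:R) (LB 2%:R 0).
have mY := @measurable_Y R.
have j1 := L2_mul mSY (L2_lift1 oS L2_a2) LB1; have j2 := L2_mul mSY (L2_lift1 oS L2_a3) LB2.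
have j12 := integrableDR mSY j1 j2.
have s1 := ae_integrable_slice1 (m1 := leb2) (m2 := leb1) mS mY (L2_integrable3 oS bS LB1).
have s2 := ae_integrable_slice1 (m1 := leb2) (m2 := leb1) mS mY (L2_integrable3 oS bS LB2).
(* The shear field does not depend on y, so integrating in y first leaves the means of the shear
   entries of [B]. *)
have := Rintegral_setX12 (m1 := leb2) (m2 := leb1) mS mY j12; move=> ->.
have f12 := fubini_integrable1 (m1 := leb2) (m2 := leb1) mS mY j12.
have fB1 := fubini_integrable1 (m1 := leb2) (m2 := leb1) mS mY (L2_integrable3 oS bS LB1).
have fB2 := fubini_integrable1 (m1 := leb2) (m2 := leb1) mS mY (L2_integrable3 oS bS LB2).
have mB1 := measurable_int _ fB1; have mB2 := measurable_int _ fB2.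
move/measurable_EFinP in mB1; move/measurable_EFinP in mB2.
apply: (ae_eq_Rintegral (m := leb2) mS).
- by have /measurable_EFinP := measurable_int _ f12.
- apply: measurable_funD.
    exact (measurable_funM L2_a2.1 mB1).
  exact (measurable_funM L2_a3.1 mB2).
- apply: (ae_mono2 (m := leb2) _ s1 s2) => x h1 h2 Sx.
  have k1 := h1 Sx; have k2 := h2 Sx.
  rewrite /avg -(RintegralZl (a2 x) mY k1) -(RintegralZl (a3 x) mY k2).
  by rewrite -(RintegralD mY (integrableZR mY (a2 x) k1) (integrableZR mY (a3 x) k2)).
Qed.

Lemma Hrel_sum (k : 'I_4 -> R) (s : seq 'I_4) :
  Hrel gamma S (fun p => \sum_(i <- s) k i *: chi i p).
Proof.
elim: s => [|i s IH].
  have [H0 _] := Hchi 0; have := Hrel_comb oS bS 0 0 H0 H0.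
  by congr Hrel; apply/funext => p; rewrite big_nil !scale0r addr0.
have [Hi _] := Hchi i; have := Hrel_comb oS bS (k i) 1 Hi IH.
by congr Hrel; apply/funext => p; rewrite big_cons scale1r.
Qed.

Lemma L2mx_sum (k : 'I_4 -> R) (s : seq 'I_4) :
  L2mx leb3 SY (fun p => \sum_(i <- s) k i *: F i p).
Proof.
elim: s => [|i s IH].
  have := L2mx_comb oS 0 0 (@L2mx_total_strain 0) (@L2mx_total_strain 0).
  by congr L2mx; apply/funext => p; rewrite big_nil !scale0r addr0.
have := L2mx_comb oS (k i) 1 (@L2mx_total_strain i) IH.
by congr L2mx; apply/funext => p; rewrite big_cons scale1r.
Qed.

Lemma pairing_suml (k : 'I_4 -> R) (s : seq 'I_4) G : L2mx leb3 SY G ->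
  pair (fun p => \sum_(i <- s) k i *: F i p) G = \sum_(i <- s) k i * pair (F i) G.
Proof.
move=> LG; elim: s => [|i s IH].
  rewrite big_nil -[RHS](Rintegral0 leb3 SY); apply: eq_Rintegral => p _.
  by rewrite big_nil LformE !mxE; ring.
have E : (fun p => k i *: F i p + 1 *: \sum_(j <- s) k j *: F j p) =
    (fun p => \sum_(j <- i :: s) k j *: F j p).
  by apply/funext => p; rewrite big_cons scale1r.
have := pairing_combl (k i) 1 (@L2mx_total_strain i) (L2mx_sum k s) LG.
by rewrite E IH mul1r big_cons.
Qed.

(** The infimum is attained at the combination [Xs] of the correctors: any competitor adds the
    energy of its distance to [Xs]. *)
Lemma Qhom_sum (K : 'M[R]_3) (a : R) (k : 'I_4 -> R) :
  (forall x, strain K a x = \sum_(i < 4) k i *: Estrain i x) ->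
  (forall i j, i != j -> pair (F i) (F j) = 0) ->
  Qhom gamma S (Qiso mu lam) K a = (\sum_(i < 4) k i ^+ 2 * pair (F i) (F i))%:E.
Proof.
move=> KE orth.
pose Fs p := \sum_(i < 4) k i *: F i p.
pose Xs p := \sum_(i < 4) k i *: chi i p.
have LFs : L2mx leb3 SY Fs := L2mx_sum k _.
have HXs : Hrel gamma S Xs := Hrel_sum k _.
have FsFs : pair Fs Fs = \sum_(i < 4) k i ^+ 2 * pair (F i) (F i).
  have := pairing_suml k (index_enum _) LFs; rewrite -/Fs => ->.
  apply: eq_bigr => i _; rewrite pairingC.
  have := pairing_suml k (index_enum _) (@L2mx_total_strain i); rewrite -/Fs => ->.
  rewrite (bigD1 i)//= big1 ?addr0 => [|j ji]; first by rewrite mulrA expr2.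
  by rewrite orth// mulr0.
have energy eta : Hrel gamma S eta ->
    (\int[leb3]_(p in SY) (Qiso mu lam p.2 (strain K a p.1 + eta p))%:E)%E =
    (pair Fs Fs + pair (fun p => 1 *: eta p + (-1) *: Xs p) (fun p => 1 *: eta p + (-1) *: Xs p))%:E.
  move=> Heta; have HD := Hrel_comb oS bS 1 (-1) Heta HXs.
  set D := (fun p => 1 *: eta p + (-1) *: Xs p) in HD *.
  have [LD _] := HD.
  (* The competitor's strain is [Fs + D], where [D = eta - Xs] is relaxed and therefore orthogonal
     to [Fs]. *)
  have GE : (fun p => strain K a p.1 + eta p) = (fun p => 1 *: Fs p + 1 *: D p).
    apply/funext => p; rewrite KE /Fs /D /Xs !scale1r scaleN1r.
    have -> : \sum_(i < 4) k i *: F i p =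
        \sum_(i < 4) k i *: Estrain i p.1 + \sum_(i < 4) k i *: chi i p.
      by rewrite -big_split/=; apply: eq_bigr => i _; rewrite -scalerDr.
    by rewrite [eta p - _]addrC addrA addrK.
  have LG : L2mx leb3 SY (fun p => strain K a p.1 + eta p).
    by rewrite GE; exact: L2mx_comb.
  have iG := pairing_integrable LG LG.
  transitivity ((pair (fun p => strain K a p.1 + eta p) (fun p => strain K a p.1 + eta p))%:E).
    rewrite /pairing /Rintegral fineK; last exact: (integrable_fin_num mSY iG).
    by apply: eq_integral => p _; rewrite QisoE.
  congr (_%:E); rewrite GE.
  have FsD : pair Fs D = 0.
    have := pairing_suml k (index_enum _) LD; rewrite -/Fs => ->.
    by rewrite big1// => i _; have [_ /(_ _ HD) ->] := Hchi i; rewrite mulr0.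
  rewrite (pairing_combl 1 1 LFs LD) ?(pairing_combr 1 1 _ LFs LD)//;
    last exact: L2mx_comb.
  by rewrite (pairingC D Fs) FsD !mul1r addr0 add0r.
rewrite -FsFs; apply/eqP; rewrite eq_le; apply/andP; split.
  apply: ereal_inf_lbound; exists Xs => //; rewrite energy//; congr (_%:E).
  rewrite [X in _ = _ + X](_ : _ = 0) ?addr0//.
  rewrite -[RHS](Rintegral0 leb3 SY); apply: eq_Rintegral => p _.
  by rewrite scale1r scaleN1r subrr LformE !mxE; ring.
apply: le_ereal_inf_tmp => _ [eta Heta ->]; rewrite energy// lee_fin lerDl.
apply: pairing_sqr_ge0.
by have [L _] := Hrel_comb oS bS 1 (-1) Heta HXs.
Qed.

(** Each of [K2], [K3], [K4] has -1 above the diagonal, where [K] carries kappa2, kappa3, tau; this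
    explains the minus signs, which disappear on squaring. *)
Lemma strain_comb (a kappa2 kappa3 tau : R) x :
  strain (mx3 [:: [:: 0; kappa2; kappa3]; [:: - kappa2; 0; tau]; [:: - kappa3; - tau; 0]]) a x =
  \sum_(i < 4) [:: a; - kappa2; - kappa3; - tau]`_i *: Estrain i x.
Proof.
rewrite !big_ord_recr big_ord0 /= add0r strainE.
rewrite (Estrain_cols3 (widen_ord _ _)) !Estrain_cols3 /= !K2_xvec !K3_xvec !K4_xvec mul0mx !evec0E.
rewrite [_ *m xvec x]col3P xvecE !mulmx_col3 !mx3E.
rewrite !col3Z !col3_0 !col3D !sym_cols3E !mx3Z !mx3D.
by apply: matrix3P; rewrite !mx3E; field.
Qed.

End solution.
End Correctors.

(** * Bounds on the Lamé coefficients from ellipticity *)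

Section Ellipticity.
Context (R : realType) (mu lam : R -> R) (c1 c2 : R).
Hypotheses (c1_gt0 : 0 < c1) (HQ : elliptic (Qiso mu lam) c1 c2).
Hypothesis Hlam0 : {ae leb1, forall y, Y y -> 0 <= lam y}.

(** The shear with unit entries has squared norm 2 and energy 4 mu, whence the bound c1 / 2; the
    uniaxial strain has norm 1 and energy 2 mu + lam. *)
Lemma elliptic_bounds y : (forall G : 'M[R]_3,
    c1 * sqnorm (sym G) <= Qiso mu lam y G /\ Qiso mu lam y G <= c2 * sqnorm (sym G)) ->
  c1 / 2 <= mu y /\ 2 * mu y + lam y <= c2.
Proof.
move=> H; split.
  have [+ _] := H (mx3 [:: [:: 0; 1; 0]; [:: 1; 0; 0]; [:: 0; 0; 0]]).
  rewrite /Qiso /sqnorm !sum3E /mxtrace !sum3E /sym !mxE /=.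
  by move: (mu y) (lam y) => m l; lra.
have [_] := H (mx3 [:: [:: 1; 0; 0]; [:: 0; 0; 0]; [:: 0; 0; 0]]).
rewrite /Qiso /sqnorm !sum3E /mxtrace !sum3E /sym !mxE /=.
by move: (mu y) (lam y) => m l; lra.
Qed.

Lemma mulam_ge : {ae leb1, forall y, Y y -> c1 / 2 <= mu y /\ 0 <= lam y}.
Proof.
apply: (ae_mono2 (m := leb1) _ HQ Hlam0) => y Hy l0 Yy.
by have [] := elliptic_bounds (Hy Yy); split=> //; exact: l0.
Qed.

Let mulam_le : {ae leb1, forall y, Y y -> `|mu y| <= c2 /\ `|lam y| <= c2}.
Proof.
apply: (ae_mono2 (m := leb1) _ HQ mulam_ge) => y Hy H Yy.
have [_] := elliptic_bounds (Hy Yy); have [cm l0] := H Yy.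
have c0 : 0 < c1 / 2 by rewrite divr_gt0.
move: (mu y) (lam y) cm l0 => m l cm l0 ml.
by rewrite !ger0_norm//; first split; lra.
Qed.

Lemma bddY_mu : LinftyY mu -> bddY mu.
Proof.
by move=> [mm _]; split=> //; exists c2; apply: (ae_mono (m := leb1) _ mulam_le) => y H /H[].
Qed.

Lemma bddY_lam : LinftyY lam -> bddY lam.
Proof.
by move=> [ml _]; split=> //; exists c2; apply: (ae_mono (m := leb1) _ mulam_le) => y H /H[].
Qed.

End Ellipticity.

Lemma invmx_diagE (R : fieldType) n (d : 'rV[R]_n) (b : 'cV[R]_n) :
  (forall i, d 0 i != 0) ->
  diag_mx d \in unitmx /\
  forall i, (invmx (diag_mx d) *m b) i 0 = (diag_mx d i i)^-1 * b i 0.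
Proof.
move=> d0; have dU : diag_mx d \in unitmx.
  by rewrite unitmxE det_diag unitfE; apply/prodf_neq0 => i _.
split=> // i.
(* Writing [b] as the matrix times the expected solution lets the inverse cancel. *)
have -> : b = diag_mx d *m (\col_j ((d 0 j)^-1 * b j 0)).
  by apply/matrixP => j k; rewrite ord1 mul_diag_mx !mxE mulVKf.
by rewrite mulKmx// mul_diag_mx !mxE eqxx mulr1n mulVKf.
Qed.

Lemma weight_evec (R : realType) (i : 'I_3) (x : R * R) :
  (evec R 0 - xvec x) i 0 = weight i x.
Proof.
by move: i; apply: ord3P; rewrite xvecE evec0E !mxE /weight/= ?subr0 ?sub0r.
Qed.

Theorem lemma4p1 (R : realType) (gamma : regime)
  (S : set (R * R)%type) (HS : cross_section S)
  (ell : R) (Hell : 0 < ell)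
  (mu lam : R -> R) (Hmu : LinftyY mu) (Hlam : LinftyY lam)
  (Hmu0 : {ae leb1, forall y, Y y -> 0 <= mu y})
  (Hlam0 : {ae leb1, forall y, Y y -> 0 <= lam y})
  (Hinf : (0 < ess_inf lebY (fun y => (2 * mu y + lam y)%:E))%E)
  (c1 c2 : R) (Hc1 : 0 < c1) (Hc12 : c1 <= c2)
  (HQ : elliptic (Qiso mu lam) c1 c2)
  (B : R * ((R * R) * R) -> 'M[R]_3)
  (HB : L2mx leb4 ([set` `]0, ell[] `*` (S `*` Y)) B)
  (phi phi2 phi3 : R * R -> R) (Hphi : torsion_function S phi phi2 phi3)
  (chi : 'I_4 -> (R * R) * R -> 'M[R]_3)
  (Hchi : correctors gamma S (Qiso mu lam) chi) :
  let Q := Qiso mu lam in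
  let F := total_strain chi in
  let bet := beta_eff mu lam gamma in
  let M := Mmx S Q chi in
  let b := bvec S Q B chi in
  [/\ (* (i) *)
      [/\ {ae leb3, forall p, (S `*` Y) p -> F 0 p = stretch mu lam gamma p.2},
          {ae leb3, forall p, (S `*` Y) p -> F 1 p = - p.1.1 *: F 0 p},
          {ae leb3, forall p, (S `*` Y) p -> F 2%:R p = - p.1.2 *: F 0 p}
        & {ae leb3, forall p, (S `*` Y) p ->
             F 3%:R p = torsion_strain mu phi2 phi3 p}],
      (* (ii) *)
      M = diag_mx (\row_j
            [:: bet * \int[leb2]_(x in S) 1;
                bet * \int[leb2]_(x in S) (x.1 ^+ 2);
                bet * \int[leb2]_(x in S) (x.2 ^+ 2);
                hmean mu * tauS S]`_j),
      (* (iii) *)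
      {ae leb1, forall x1, x1 \in `]0, ell[ ->
        (forall i : 'I_3,
          b x1 (lshift 1 i) 0 =
            bet * \int[leb3]_(p in S `*` Y)
                    (B (x1, p) 0 0 * (evec R 0 - xvec p.1) i 0)
            - match gamma with
              | GammaZero => 0
              | GammaInfty =>
                  \int[leb3]_(p in S `*` Y)
                    (g_infty mu lam p.2
                     * (B (x1, p) 1 1 + B (x1, p) 2%:R 2%:R)
                     * (evec R 0 - xvec p.1) i 0)
              end) /\
        b x1 3%:R 0 =
          hmean mu * \int[leb2]_(x in S)
            ((phi2 x - x.2)
               * avg (fun y => B (x1, (x, y)) 0 1 + B (x1, (x, y)) 1 0)
             + (phi3 x + x.1)
               * avg (fun y => B (x1, (x, y)) 0 2%:R + B (x1, (x, y)) 2%:R 0))}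
    & (* (iv) *)
      [/\ M \in unitmx,
          {ae leb1, forall x1, x1 \in `]0, ell[ ->
            forall i, (invmx M *m b x1) i 0 = (M i i)^-1 * b x1 i 0}
        & forall a kappa2 kappa3 tau : R,
            let K := mx3 [:: [:: 0; kappa2; kappa3];
                             [:: - kappa2; 0; tau];
                             [:: - kappa3; - tau; 0]] in
            Qhom gamma S Q K a =
              (fine (leb2 S) * bet * a ^+ 2
               + (bet * \int[leb2]_(x in S) (x.1 ^+ 2)) * kappa2 ^+ 2
               + (bet * \int[leb2]_(x in S) (x.2 ^+ 2)) * kappa3 ^+ 2
               + hmean mu * tauS S * tau ^+ 2)%:E]].
Proof.
move=> Q F bet M b.
have [[S0 oS _ bS _] [m1 m2 m12]] := HS.
(* The lower bound of [mu]; it serves as the constant [c] of the preceding sections. *)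
have c0 : 0 < c1 / 2 by rewrite divr_gt0.
have mulam := mulam_ge HQ Hlam0.
have bmu := bddY_mu Hc1 HQ Hlam0 Hmu; have blam := bddY_lam Hc1 HQ Hlam0 Hlam.
have mS := open_measurable_plane oS; have mSY := measurable_SY oS.
have FE i := total_strainE oS bS c0 bmu blam mulam Hphi Hchi i.
have ME := Mmx_diag oS bS c0 bmu blam mulam Hphi Hchi m1 m2 m12.
have bet_gt0 : 0 < bet.
  rewrite /bet; case: (gamma) => /=.
    exact: hmean_gt0 c0 (bddY_beta c0 bmu blam mulam) (beta_ge c0 mulam).
  exact: beta_infty_gt0 c0 bmu blam mulam.
have hmu_gt0 : 0 < hmean mu.
  by apply: (hmean_gt0 c0 bmu); apply: (ae_mono (m := leb1) _ mulam) => y H /H[].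
have I1 : 0 < \int[leb2]_(x in S) (1 : R).
  apply: (integral_gt0 oS bS); first by move=> x; exact: cvg_cst.
    by [].
  by have [p Sp] := S0; exists p.
(* A point of the open set [S] off both axes, where x_2^2 and x_3^2 are positive; it makes both
   second moments positive. *)
have [e [Se e1 e2]] : exists p : R * R, [/\ S p, p.1 != 0 & p.2 != 0].
  have [p Sp] := S0.
  have [e e0 eS] := (nbhs_pairP S p).1 (open_nbhs_nbhs (conj oS Sp)).
  have away (t : R) : exists2 s, `|t - s| < e & s != 0.
    have [t0|t0] := eqVneq t 0; last by exists t; rewrite ?subrr ?normr0.
    exists (e / 2); last by rewrite gt_eqF// divr_gt0.
    by rewrite t0 sub0r normrN gtr0_norm ?divr_gt0//; lra.
  have [s ps s0] := away p.1; have [t pt t0] := away p.2.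
  by exists (s, t); split=> //; exact: eS.
have Isq1 : 0 < \int[leb2]_(x in S) (x.1 ^+ 2).
  apply: (integral_gt0 oS bS).
  - by move=> x; apply: cvgM; exact: cvg_fst.
  - by move=> x _; exact: sqr_ge0.
  - by exists e => //; rewrite lt0r sqrf_eq0 e1 sqr_ge0.
have Isq2 : 0 < \int[leb2]_(x in S) (x.2 ^+ 2).
  apply: (integral_gt0 oS bS).
  - by move=> x; apply: cvgM; exact: cvg_snd.
  - by move=> x _; exact: sqr_ge0.
  - by exists e => //; rewrite lt0r sqrf_eq0 e2 sqr_ge0.
have tau_gt0 := tauS_gt0 oS bS S0 Hphi.
pose d : 'rV[R]_4 := \row_j
            [:: bet * \int[leb2]_(x in S) 1;
                bet * \int[leb2]_(x in S) (x.1 ^+ 2);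
                bet * \int[leb2]_(x in S) (x.2 ^+ 2);
                hmean mu * tauS S]`_j.
have d0 i : d 0 i != 0.
  rewrite mxE gt_eqF//; case: i => [[|[|[|[|//]]]] ?] /=; exact: mulr_gt0.
have MdE : M = diag_mx d by exact: ME.
split.
- have E0 : {ae leb3, forall p, (S `*` Y) p -> F 0 p = stretch mu lam gamma p.2}.
    apply: (ae_mono (m := leb3) _ (FE 0)) => p Fp Dp.
    by rewrite /F (Fp Dp) /claimed /weight/= scale1r.
  split; [exact E0| | |exact (FE 3%:R)].
  + apply: (ae_mono2 (m := leb3) _ E0 (FE 1)) => p E0p Fp Dp.
    by rewrite (E0p Dp) /F (Fp Dp).
  + apply: (ae_mono2 (m := leb3) _ E0 (FE 2%:R)) => p E0p Fp Dp.
    by rewrite (E0p Dp) /F (Fp Dp).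
- exact: ME.
(* Slicing handles one entry of [B] at a time; the nine almost-everywhere statements are merged
   along each row, then over the rows. *)
- have LB : {ae leb1, forall x1, [set` `]0, ell[] x1 -> L2mx leb3 (S `*` Y) (fun p => B (x1, p))}.
    have mI : measurable ([set` `]0, ell[] : set (measurableTypeR R)) by exact: measurable_itv.
    have H i j := ae_L2_slice1 (m1 := leb1) (m2 := leb3) mI mSY (HB i j).
    have Hj i : {ae leb1, forall x1, [set` `]0, ell[] x1 -> forall j, L2 leb3 (S `*` Y) (fun p => B (x1, p) i j)}.
      apply: (ae_mono2 (m := leb1) _ (H i 2%:R)); last first.
        apply: (ae_mono2 (m := leb1) (Q := fun x1 => [set` `]0, ell[] x1 ->
          L2 leb3 (S `*` Y) (fun p => B (x1, p) i 0) /\ L2 leb3 (S `*` Y) (fun p => B (x1, p) i 1))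
          _ (H i 0) (H i 1)) => x h0 h1 Ix; split; [exact: h0|exact: h1].
      by move=> x h2 h01 Ix; have [k0 k1] := h01 Ix; apply: ord3P; [exact k0|exact k1|exact: h2].
    apply: (ae_mono2 (m := leb1) _ (Hj 2%:R)); last first.
      apply: (ae_mono2 (m := leb1) (Q := fun x1 => [set` `]0, ell[] x1 ->
        (forall j, L2 leb3 (S `*` Y) (fun p => B (x1, p) 0 j)) /\
        (forall j, L2 leb3 (S `*` Y) (fun p => B (x1, p) 1 j)))
        _ (Hj 0) (Hj 1)) => x h0 h1 Ix; split; [exact: h0|exact: h1].
    by move=> x h2 h01 Ix; have [k0 k1] := h01 Ix; apply: ord3P; [exact k0|exact k1|exact: h2].
  apply: (ae_mono (m := leb1) _ LB) => x1 LBx Ix; have LBx1 := LBx Ix; split.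
  + move=> i; rewrite mxE.
    have i3 : (lshift 1 i < 3)%N := ltn_ord i.
    have := bvec_bend oS bS c0 bmu blam mulam Hphi Hchi i3 LBx1; rewrite /Q => ->.
    congr (_ * _ - _); first by apply: eq_Rintegral => p _; rewrite weight_evec.
    case: (gamma) => //; apply: eq_Rintegral => p _; by rewrite weight_evec.
  + by rewrite mxE; exact (bvec_twist oS bS c0 bmu blam mulam Hphi Hchi (i := 3%:R) isT LBx1).
- split.
  + by rewrite MdE; have [] := invmx_diagE (0 : 'cV[R]_4) d0.
  + apply: aeW => x1 _ i; rewrite MdE.
    by have [_] := invmx_diagE (b x1) d0; exact.
  + move=> a kappa2 kappa3 tau K.
    (* Orthogonality and the diagonal energies are read off the matrix identity of (ii). *)
    have orth i j : i != j -> pairing S Q (F i) (F j) = 0.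
      move=> ij; have /matrixP/(_ i j) := MdE; rewrite [LHS]mxE => ->.
      by rewrite mxE (negbTE ij) mulr0n.
    have diag i : pairing S Q (F i) (F i) = d 0 i.
      have /matrixP/(_ i i) := MdE; rewrite [LHS]mxE => ->.
      by rewrite mxE eqxx mulr1n.
    have := Qhom_sum oS bS c0 bmu blam mulam Hchi
      (k := fun i => [:: a; - kappa2; - kappa3; - tau]`_i)
      (strain_comb a kappa2 kappa3 tau) orth.
    rewrite -/K -/Q => ->; congr (_%:E).
    under eq_bigr do rewrite diag mxE.
    rewrite !big_ord_recr big_ord0 /= add0r !sqrrN.
    have -> : fine (leb2 S) = \int[leb2]_(x in S) (1 : R).
      have := Rintegral_cst leb2 mS 1; rewrite mul1r => ->.
      by [].
    rewrite /bet; move: (Rintegral _ _ _) (Rintegral _ _ _) (Rintegral _ _ _) (hmean mu)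
      (tauS S) (beta_eff _ _ _) => I0 I1' I2' h t be.
    by ring.
Qed.
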